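(* Let $m$ be a positive integer and let $K$ and $L$ be two totally real tame $\mathbb{Z}/m\mathbb{Z}$-number fields. Then the following are equivalent: (a) $\langle \mathfrak{o}_K, \mathrm{Tr}_{K/\mathbb{Q}}\rangle \simeq \langle \mathfrak{o}_L, \mathrm{Tr}_{L/\mathbb{Q}}\rangle$; (b) $(\mathfrak{o}_K^{\bot}, b_K) \simeq (\mathfrak{o}_L^{\bot}, b_L)$; (c) $\langle \mathfrak{o}_K^{0}, \mathrm{Tr}_{K/\mathbb{Q}}\rangle \simeq \langle \mathfrak{o}_L^{0}, \mathrm{Tr}_{L/\mathbb{Q}}\rangle$; (d) $\mathfrak{d}(K) = \mathfrak{d}(L)$.
   Context: A $\mathbb{Z}/m\mathbb{Z}$-number field is a number field $K$ that is Galois over $\mathbb{Q}$ with $\mathrm{Gal}(K/\mathbb{Q}) \cong \mathbb{Z}/m\mathbb{Z}$. It is tame if no rational prime is wildly ramified in $K$. $\mathfrak{d}(K)$ is the discriminant of $K$ and $\mathfrak{o}_K$ its maximal order (ring of integers). $\langle \mathfrak{o}_K, \mathrm{Tr}_{K/\mathbb{Q}}\rangle$ is the $\mathbb{Z}$-module $\mathfrak{o}_K$ with the trace pairing $(x,y) \mapsto \mathrm{Tr}_{K/\mathbb{Q}}(xy)$. The trace zero module is $\mathfrak{o}_K^{0} = \{x \in \mathfrak{o}_K : \mathrm{Tr}_{K/\mathbb{Q}}(x) = 0\}$, and $\langle \mathfrak{o}_K^{0}, \mathrm{Tr}_{K/\mathbb{Q}}\rangle$ denotes it with the restricted trace pairing.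 For $K$ of degree $n$ over $\mathbb{Q}$ (here $n=m$), $\mathfrak{o}_K^{\bot} = \{n\alpha - \mathrm{Tr}_{K/\mathbb{Q}}(\alpha) : \alpha \in \mathfrak{o}_K\}$. The form $b_K$ is the real-valued symmetric $\mathbb{Q}$-bilinear form on $K$ whose associated quadratic form is $b_K(x,x) = \sum_{\sigma : K \hookrightarrow \mathbb{C}} |\sigma(x)|^2$, and $(\mathfrak{o}_K^{\bot}, b_K)$ is $\mathfrak{o}_K^{\bot}$ with the restriction of $b_K$. The symbol $\simeq$ denotes isometry, i.e. the existence of a $\mathbb{Z}$-module isomorphism preserving the bilinear forms. *)

(* Defs.v *)
From HB Require Import structures.
From mathcomp Require Import all_boot all_order all_algebra.
From mathcomp Require Import all_fingroup all_solvable all_field.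
From mathcomp Require Import boolp classical_sets functions cardinality fsbigop.
From mathcomp Require Import reals complex.

Set Implicit Arguments.
Unset Strict Implicit.
Unset Printing Implicit Defensive.

Import Order.TTheory GRing.Theory Num.Theory.
Local Open Scope classical_set_scope.
Local Open Scope ring_scope.

(* For m = 1, Zp 1 is the trivial subgroup of 'Z_1 (= Z/2Z in MathComp), so
   the definition is also right in that case.  A splittingFieldType over rat is
   a normal finite extension of Q. *)
Definition cyclic_number_field (m : nat) (K : splittingFieldType rat) : Prop :=
  galois 1 {:K} /\ ('Gal({:K} / 1) \isog Zp m)%g.

Definition maximal_order (K : fieldExtType rat) : set K :=
  [set x | integralOver (intr : int -> K) x].

(* Tr_{K/Q} x is the trace of the Q-linear map y |-> x * y; it is independent
   of the basis used to write the matrix. *)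
Definition trace (K : fieldExtType rat) (x : K) : rat :=
  \tr (passmx.mxof (vbasis {:K}) (vbasis {:K}) (amull x)).

Definition trace_form (K : fieldExtType rat) (x y : K) : rat := trace (x * y).

Definition trace_zero (K : fieldExtType rat) : set K :=
  [set x | maximal_order x /\ trace x = 0].

Definition maximal_order_perp (K : fieldExtType rat) : set K :=
  [set (\dim {:K})%:R * a - (trace a)%:A | a in @maximal_order K].

Definition integral_basis (K : fieldExtType rat) (w : 'I_(\dim {:K}) -> K) :
    Prop :=
  (forall i, maximal_order (w i)) /\
  (forall x, maximal_order x ->
     exists! c : {ffun 'I_(\dim {:K}) -> int}, x = \sum_i w i *~ c i).

(* Every number field has an integral basis, and the determinant does not
   depend on it, so the default value 0 of xget is never used. *)
Definition discriminant (K : fieldExtType rat) : rat :=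
  xget 0 [set d | exists2 w : 'I_(\dim {:K}) -> K, integral_basis w &
                  d = \det (\matrix_(i, j) trace_form (w i) (w j))].

Definition is_ideal (K : fieldExtType rat) (I : set K) : Prop :=
  [/\ I `<=` @maximal_order K, I 0,
      (forall x y, I x -> I y -> I (x + y)) &
      (forall a x, maximal_order a -> I x -> I (a * x))].

Definition is_prime_ideal (K : fieldExtType rat) (P : set K) : Prop :=
  [/\ is_ideal P, ~ P 1 &
      (forall x y, maximal_order x -> maximal_order y ->
         P (x * y) -> P x \/ P y)].

Definition ideal_mul (K : fieldExtType rat) (I J : set K) : set K :=
  [set x | exists2 s : seq (K * K),
     (forall u, u \in s -> I u.1 /\ J u.2) & x = \sum_(u <- s) u.1 * u.2].

Definition ideal_exp (K : fieldExtType rat) (I : set K) (e : nat) : set K :=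
  iter e (ideal_mul I) (@maximal_order K).

(* The exponent of P in the factorization of p o_K is the e for which P ^ e,
   but not P ^ (e + 1), contains p o_K, i.e. contains p. *)
Definition is_ramification_index (K : fieldExtType rat) (p : nat) (P : set K)
    (e : nat) : Prop :=
  ideal_exp P e p%:R /\ ~ ideal_exp P e.+1 p%:R.

Definition wildly_ramified (K : fieldExtType rat) (p : nat) : Prop :=
  exists (P : set K) (e : nat),
    [/\ is_prime_ideal P, P p%:R, is_ramification_index p P e & (p %| e)%N].

Definition tame (K : fieldExtType rat) : Prop :=
  forall p : nat, prime p -> ~ wildly_ramified K p.

(* The embeddings are collected as plain functions, which form a choiceType,
   so that finitely supported sums over them make sense. *)
Definition embeddings (R : realType) (K : fieldExtType rat) :
    set (K -> R[i]) :=
  [set f | exists g : {rmorphism K -> R[i]}, f = g :> (K -> R[i])].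

Definition totally_real (R : realType) (K : fieldExtType rat) : Prop :=
  forall f : K -> R[i], embeddings f -> forall x, complex.Im (f x) = 0.

Definition b_form (R : realType) (K : fieldExtType rat) (x y : K) : R :=
  \sum_(f \in @embeddings R K) complex.Re (f x * (f y)^*%C).

Lemma finite_embeddings (R : realType) (K : fieldExtType rat) :
  finite_set (@embeddings R K).
Proof.
pose t := separable_generator 1 {:K}; pose p := minPoly 1 t.
have genK (x : K) : x \in <<1; t>>%VS.
  rewrite -eq_adjoin_separable_generator ?memvf ?sub1v //.
  by apply/separableP=> y _; apply: (@pcharf0_separable _ _ 1%AS); move=> k; rewrite pchar_lalg; exact: pchar_num.
have /polyOver1P[q pE] := minPolyOver 1 t.
have [r rE] := closed_field_poly_normal (map_poly (ratr : rat -> R[i]) q).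
have morE (g : {rmorphism K -> R[i]}) (s : {poly rat}) :
    map_poly g (map_poly (in_alg K) s) = map_poly ratr s.
  by rewrite -map_poly_comp; apply: eq_map_poly => a /=; rewrite rmorphZ_num rmorph1 mulr1.
have groot (g : {rmorphism K -> R[i]}) : g t \in r.
  have : root (map_poly g p) (g t) by rewrite fmorph_root root_minPoly.
  rewrite /p pE morE rE rootZ ?root_prod_XsubC // lead_coef_eq0 map_poly_eq0.
  by apply/eqP=> q0; have := monic_neq0 (monic_minPoly 1 t); rewrite pE q0 rmorph0 eqxx.
have ginj (g h : {rmorphism K -> R[i]}) : g t = h t -> g = h :> (K -> R[i]).
  move=> ght; apply/funext=> x.
  have /polyOver1P[s sE] := Fadjoin_polyOver 1 t x.
  rewrite -(Fadjoin_poly_eq (genK x)) sE -!horner_map !morE.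
  by rewrite ght.
apply: (@sub_finite_set _ _ ((fun z => xget (fun=> 0) [set f : K -> R[i] |
    @embeddings R K f /\ f t = z]) @` [set` r])); last exact/finite_image/finite_seq.
move=> _ [g ->]; exists (g t); first exact: groot.
case: xgetP => [f _ [[h ->] /ginj //]|/(_ (g : K -> R[i]))]; case; split=> //; by exists g.
Qed.

(* The quadratic form attached to b_form is x |-> sum of the |f x|^2. *)
Lemma b_formxx (R : realType) (K : fieldExtType rat) (x : K) :
  (b_form R x x)%:C%C = \sum_(f \in @embeddings R K) `|f x| ^+ 2.
Proof.
rewrite /b_form !(fsbig_finite _ _ (finite_embeddings R K)) raddf_sum /=.
apply: eq_bigr => f _; rewrite sqr_normc RRe_real //.
by rewrite -sqr_normc realX // normr_real.
Qed.

Lemma b_formC (R : realType) (K : fieldExtType rat) (x y : K) :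
  b_form R x y = b_form R y x.
Proof.
apply: eq_fsbigr => f _.
by case: (f x) (f y) => [a b] [c d] /=; rewrite !mulrN !opprK mulrC (mulrC b).
Qed.

(* Isometry of Z-submodules M of V and N of W with T-valued forms b and c; only
   the restriction of phi to M matters. *)
Definition isometric (T : Type) (V W : zmodType)
    (M : set V) (b : V -> V -> T) (N : set W) (c : W -> W -> T) : Prop :=
  exists phi : V -> W,
    [/\ set_bij M N phi,
        {in M &, {morph phi : x y / x + y}} &
        {in M &, forall x y, c (phi x) (phi y) = b x y}].

(* Main.v *)
From HB Require Import structures.
Require Import Defs.
From mathcomp Require Import all_boot all_order all_algebra.
From mathcomp Require Import all_fingroup all_solvable all_field.
From mathcomp Require Import boolp classical_sets fsbigop.
From mathcomp Require Import reals complex.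
From mathcomp Require Import ring lra zify.

Set Implicit Arguments.
Unset Strict Implicit.
Unset Printing Implicit Defensive.

Import Order.TTheory GRing.Theory Num.Theory.
Local Open Scope ring_scope.

(** Why the theorem holds. A tame abelian field is contained in a cyclotomic field of squarefree conductor,
   hence its maximal order is spanned by the conjugates of one element a: the trace of a product of roots
   of unity of prime order. When K is cyclic of degree m and g generates its Galois group, the Gram matrix
   (Tr (g ^ i a * g ^ j a)) is circulant, so its eigenvectors are the characters of the group. When K is
   moreover totally real, the eigenvalue at a character is the product of two conjugate Gauss sums, namely
   the product of the primes at which the character is ramified (gram_fourier). Let e_p be the ramification
   index of p. The k-th character is ramified at p exactly when e_p does not divide k, so the discriminant,
   which is the determinant of the Gram matrix, is the product of the p ^ (m - m / e_p). It determines every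
   e_p (spectrum_inj), hence the spectrum, hence the whole Gram matrix (gram_spectrum_inj).

   If K and L have the same discriminant, the Z-linear map between the two normal bases is therefore an
   isometry. With a of trace 1 it maps 1, the sum of the basis, to 1, and the bases of the trace zero module
   and of the module of the n x - Tr x deduced from the normal bases correspond to each other, with equal
   Gram matrices: this gives the three isometries (isometric_gram). Conversely an isometry preserves Gram
   determinants (isometric_det). For the maximal order this determinant is the discriminant; for the two
   other modules it is the discriminant times a nonzero constant depending only on m, as one sees by adding
   the vector 1, orthogonal to both (gram_extend). For a totally real field b_K is the trace form.

   The containment in a cyclotomic field is not proved first: everything happens in the compositum E of K
   with the roots of unity of order p, for p in a finite set S of primes containing the ramified ones.
   - By tameness the inertia groups of E have order prime to p (inertial_wild shows that an element of order
     p in an inertia group makes the ramification wild), and as E is abelian they have at most p - 1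
     elements (inertial_card, by the tame character).
   - The inertia groups generate the Galois group, because the rational field has no abelian extension
     unramified at all primes (unramified_rational). This is Minkowski's theorem for the totally real ones
     (real_unramified), combined with a descent for imaginary quadratic fields.
   - The inertia group at p fixes the roots of unity of order q other than p, so it acts transitively, and
     for reasons of cardinality simply transitively, on those of order p. Hence sums over the Galois group
     of E factor over S (sum_inertia_prod), and the conjugates of the product of the roots of unity have an
     explicit dual basis: the conjugates of the product of the z ^ - 1 - 1, divided by the product n of S
     (trace_zetaS_dualS). The element z ^ - 1 - 1 is in every prime above p, so the traces of its multiples
     are divisible by p; this shows at once that algebraic integers have integral coordinates.
   - Relative traces from E to K transport the basis, its dual and the Gauss sums to K
     (descended_generator).

   Ideals are boolean predicates. The only Dedekind theory used is that a maximal ideal above p has a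
   uniformizer in its local ring, which identifies the ramification index with a valuation (p_val). *)

(** * Algebraic integers and the trace *)

(** The maximal order as a boolean predicate, so that the closure lemmas of subrings apply. *)
Definition oint (E : fieldExtType rat) : {pred E} :=
  fun x => `[< maximal_order x >].
Arguments oint E : clear implicits.

Section Oint.
Variable E : fieldExtType rat.

Lemma ointP (x : E) : reflect (maximal_order x) (x \in oint E).
Proof. exact: asboolP. Qed.

Fact oint_subring : subring_closed (oint E).
Proof.
split=> [|x y /ointP xo /ointP yo|x y /ointP xo /ointP yo]; apply/ointP.
- exact: integral1.
- exact: integral_sub.
- exact: integral_mul.
Qed.
HB.instance Definition _ := GRing.isSubringClosed.Build E (oint E) oint_subring.

Lemma alg_int (z : int) : (z%:~R : rat)%:A = z%:~R :> E.
Proof. by rewrite scaler_int. Qed.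

Lemma alg_nat (n : nat) : (n%:R : rat)%:A = n%:R :> E.
Proof. by rewrite scaler_nat. Qed.

Lemma natE_eq0 n : (n%:R == 0 :> E) = (n == 0)%N.
Proof. by have := fmorph_eq0 (in_alg E) n%:R; rewrite /= alg_nat pnatr_eq0. Qed.

Lemma intE_eq0 (z : int) : (z%:~R == 0 :> E) = (z == 0).
Proof. by have := fmorph_eq0 (in_alg E) z%:~R; rewrite /= alg_int intr_eq0. Qed.

(** The rational root theorem, borrowed from the algebraic integers of algC. *)
Lemma oint_rat (q : rat) : q%:A \in oint E -> q \is a Num.int.
Proof.
move=> /ointP[p mon_p]; set pE := map_poly _ p => rp.
have {}rp : root (map_poly (intr : int -> rat) p) q.
  rewrite -(fmorph_root (in_alg E)) -map_poly_comp.
  by rewrite (_ : map_poly _ p = pE) //; apply: eq_map_poly => z /=; exact: alg_int.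
rewrite -Cint_rat Cint_rat_Aint ?Crat_rat //.
apply: (@root_monic_Aint (map_poly (intr : int -> algC) p)).
- rewrite (_ : map_poly intr p = map_poly (ratr : rat -> algC) (map_poly intr p)).
    by rewrite fmorph_root.
  by rewrite -map_poly_comp; apply: eq_map_poly => z /=; rewrite ratr_int.
- exact: monic_map.
- by apply/polyOverP => i; rewrite coef_map /= rpred_int.
Qed.

(** If l is the leading coefficient of an integral polynomial with root x, then l * x is a root of the
   monic polynomial l ^ (deg - 1) * p ('X / l). *)
Lemma oint_clear (x : E) : exists2 N : nat, (0 < N)%N & N%:R * x \in oint E.
Proof.
have /polyOver1P[q mE] := minPolyOver 1 x.
have q0 : q != 0.
  apply: contraNneq (monic_neq0 (monic_minPoly 1 x)).
  by rewrite mE => ->; rewrite map_poly0.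
have [p [a a0 qE]] := rat_poly_scale q.
have p0 : p != 0 by apply: contraNneq q0 => p0; rewrite qE p0 map_poly0 scaler0.
have rp : root (map_poly (intr : int -> E) p) x.
  have := root_minPoly 1 x; rewrite mE qE map_polyZ /= rootZ; last first.
    by rewrite (fmorph_eq0 (in_alg E)) invr_eq0 intr_eq0.
  rewrite -map_poly_comp; congr (root _ x); apply: eq_map_poly => z /=.
  exact: alg_int.
pose l := lead_coef p; have l0 : l != 0 by rewrite lead_coef_eq0.
suff lx : l%:~R * x \in oint E.
  exists `|l|%N; first by rewrite absz_gt0.
  have -> : `|l|%:R * x = (-1) ^+ (l < 0)%R * (l%:~R * x) :> E.
    rewrite mulrA; congr (_ * _); rewrite pmulrn.
    by rewrite abszEsign rmorphM /= rmorph_sign.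
  by rewrite rpredM // rpredX // rpredN rpred1.
have [d dE] : exists d, size p = d.+2.
  exists (size p).-2; case sp : (size p) => [|[|//]] /=.
    by move/eqP: sp; rewrite size_poly_eq0 (negPf p0).
  have [c c0 cE] := size_poly1P _ (introT eqP sp).
  by move: rp; rewrite cE map_polyC rootC /= intE_eq0 (negPf c0).
(* r (l x) = l ^ d * p (x). *)
pose r : {poly int} := 'X^(d.+1) + \poly_(i < d.+1) (p`_i * l ^+ (d - i)).
have mr : r \is monic.
  rewrite monicE lead_coefDl ?lead_coefXn // size_polyXn.
  exact: leq_ltn_trans (size_poly _ _) _.
apply/ointP; exists r => //; rewrite rootE.
have lE0 : l%:~R != 0 :> E by rewrite intE_eq0.
have -> : (map_poly intr r).[l%:~R * x] = l%:~R ^+ d * (map_poly intr p).[x].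
  rewrite /r rmorphD /= map_polyXn hornerD hornerXn.
  rewrite (@horner_coef_wide _ d.+1 (map_poly _ (\poly_(i < _) _))); last first.
    by rewrite (leq_trans (size_poly _ _)) ?size_poly.
  rewrite (@horner_coef_wide _ d.+2 (map_poly _ p)); last first.
    by rewrite (leq_trans (size_poly _ _)) ?dE.
  rewrite [in RHS]big_ord_recr /= mulrDr mulr_sumr addrC; congr (_ + _).
    apply: eq_bigr => i _; rewrite !coef_map coef_poly ltn_ord /= rmorphM rmorphXn /= exprMn.
    have -> : l%:~R ^+ d = l%:~R ^+ (d - i) * l%:~R ^+ i :> E.
      by rewrite -exprD subnK // -ltnS.
    by ring.
  rewrite coef_map /= -[d.+1]/(d.+2.-1) -dE -/(lead_coef p) -/l dE /= exprMn exprS -/l; ring.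
by rewrite (rootP rp) mulr0.
Qed.

Lemma oint_intP (x : E) (q : rat) : x = q%:A -> x \in oint E ->
  exists z : int, x = z%:~R.
Proof.
move=> -> /oint_rat /intrP[z ->]; by exists z; rewrite alg_int.
Qed.
End Oint.

Section Galois.
Variable E : splittingFieldType rat.
Hypothesis galE : galois 1 {:E}.
Local Notation gal := (gal_of {:E}).
Implicit Types (s t : gal) (x y : E).

Lemma galMx s t x : (s * t)%g x = t (s x).
Proof. by rewrite galM ?memvf. Qed.

Lemma mem_gal s : s \in 'Gal({:E} / 1)%g.
Proof. by rewrite gal_kAut ?sub1v // kAut1E subvf. Qed.

Lemma gal_set : 'Gal({:E} / 1)%g = [set: gal].
Proof. by apply/setP => s; rewrite mem_gal inE. Qed.

Lemma card_gal : #|{: gal}| = \dim {:E}.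
Proof.
by have := galois_dim galE; rewrite dimv1 divn1 gal_set cardsT.
Qed.

Lemma gal_fixedP x : (forall s, s x = x) -> exists q, x = q%:A.
Proof.
move=> fx; have /galois_fixedField fE := galE.
have : x \in fixedField 'Gal({:E} / 1)%g by apply/fixedFieldP => [|s _]; rewrite ?memvf.
by rewrite fE => /vlineP[q ->]; exists q.
Qed.

Lemma gal_oint s x : (s x \in oint E) = (x \in oint E).
Proof.
have sub (u : gal) y : y \in oint E -> u y \in oint E.
  move=> /ointP[p mp rp]; apply/ointP; exists p => //.
  rewrite (_ : map_poly _ p = map_poly u (map_poly intr p)) ?fmorph_root //.
  by apply/polyP => i; rewrite !coef_map /= rmorph_int.
apply/idP/idP => [|/sub//]; move=> /(sub (s^-1)%g).
by rewrite -galMx mulgV gal_id.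
Qed.

Lemma fixed_int x : x \in oint E -> (forall s, s x = x) -> exists z : int, x = z%:~R.
Proof. by move=> xo /gal_fixedP[q xE]; apply: oint_intP xE xo. Qed.

(** Multiplication by x becomes diagonal, with entries s x, in the coordinates (s e_j)_s of a basis e;
   that these coordinates are independent is the linear independence of automorphisms. *)
Lemma traceE x : (trace x)%:A = \sum_(s : gal) s x.
Proof.
pose e := vbasis {:E}.
have e_b : basis_of {:E} e := vbasisP _.
pose u (k : 'I_(\dim {:E})) : gal := enum_val (cast_ord (esym card_gal) k).
have u_bij : bijective u.
  apply: (bij_comp (enum_val_bij _)); exists (cast_ord card_gal) => i.
    exact: cast_ordKV.
  exact: cast_ordK.
(* M is the matrix of multiplication by x, and D has rows (u_k e_j)_k. *)
pose M := passmx.mxof e e (amull x).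
pose D := \matrix_(j < \dim {:E}, k < \dim {:E}) u k e`_j.
pose G := diag_mx (\row_(k < \dim {:E}) u k x).
have MD : map_mx (in_alg E) M *m D = D *m G.
  apply/matrixP => j k; rewrite mul_mx_diag !mxE.
  transitivity (u k (x * e`_j)); last by rewrite rmorphM mulrC.
  rewrite [in RHS](coord_basis e_b (memvf (x * e`_j))) linear_sum /=.
  apply: eq_bigr => i _.
  rewrite !mxE /= passmx.vecof_delta lfunE /=.
  by rewrite linearZ /= mulr_algl.
have D_unit : D \in unitmx.
  rewrite -unitmx_tr -row_free_unit -kermx_eq0; apply/eqP/row_matrixP => i.
  rewrite row0; set c := row i _.
  have cD : c *m D^T = 0 by apply/sub_kermxP; rewrite row_sub.
  have cDj (j : 'I_(\dim {:E})) : \sum_l c 0 l * u l e`_j = 0.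
    have /rowP/(_ j) := cD; rewrite [RHS]mxE => cDj0; rewrite -[RHS]cDj0 [RHS]mxE.
    by apply: eq_bigr => l _; rewrite [D^T _ _]mxE [D _ _]mxE.
  apply/rowP => k; rewrite [RHS]mxE.
  have [v uv vu] := u_bij.
  have := @gal_independent _ _ {:E} predT (fun s => c 0 (v s)) _ (u k) isT.
  rewrite /= uv => -> // a _.
  rewrite (coord_basis e_b (memvf a)) (reindex u) /=; last exact: onW_bij.
  under eq_bigr do rewrite uv linear_sum /= mulr_sumr.
  rewrite exchange_big big1 //= => j _.
  transitivity ((coord e j a)%:A * \sum_l c 0 l * u l e`_j).
    rewrite mulr_sumr; apply: eq_bigr => l _.
    by rewrite linearZ /= mulr_algl -scalerAr.
  by rewrite cDj mulr0.
transitivity (\tr (map_mx (in_alg E) M)).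
  by rewrite /trace -/M /mxtrace scaler_suml; apply: eq_bigr => i _; rewrite [RHS]mxE.
rewrite -(mulmxK D_unit (map_mx _ M)) MD mxtrace_mulC mulmxA mulVmx // mul1mx.
rewrite mxtrace_diag [RHS](reindex u) /=; last exact: onW_bij.
by apply: eq_bigr => k _; rewrite mxE.
Qed.

End Galois.

(** * Divisibility by p and nilpotency modulo p *)

Lemma Fp_int_eq0 p (z : int) : prime p -> (z%:~R == 0 :> 'F_p) = (p %| z)%Z.
Proof.
move=> pp; rewrite dvdzE absz_nat; case: (intP z) => [|n|n].
- by rewrite eqxx dvdn0.
- by rewrite -pmulrn -(dvdn_pcharf (pchar_Fp pp)).
- by rewrite mulrNz oppr_eq0 -pmulrn -(dvdn_pcharf (pchar_Fp pp)) abszN.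
Qed.

(** The ideal p o, by division rather than by an existential, so that membership is decided by oint. *)
Definition pOint (E : fieldExtType rat) (p : nat) : {pred E} :=
  fun x => x / p%:R \in oint E.
Arguments pOint E p : clear implicits.

(** The radical of p o, that is the intersection of the prime ideals above p: it replaces them wherever
   no particular prime is singled out. *)
Definition nilp (E : fieldExtType rat) (p : nat) : {pred E} :=
  fun x => `[< x \in oint E /\ exists k, x ^+ k \in pOint E p >].
Arguments nilp E p : clear implicits.

Record o_ideal (E : fieldExtType rat) (P : {pred E}) : Prop := OIdeal {
  o_ideal_sub : {subset P <= oint E};
  o_ideal0 : 0 \in P;
  o_idealD : forall x y, x \in P -> y \in P -> x + y \in P;
  o_idealM : forall a x, a \in oint E -> x \in P -> a * x \in P }.

Section ModP.
Variable E : fieldExtType rat.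
Implicit Types (x y : E) (P : {pred E}).

Fact pOint_zmod p : zmod_closed (pOint E p).
Proof.
split=> [|x y xp yp]; rewrite unfold_in; first by rewrite mul0r rpred0.
by rewrite mulrBl rpredB.
Qed.
HB.instance Definition _ p := GRing.isZmodClosed.Build E (pOint E p) (pOint_zmod p).

Lemma pOintE p x : (x \in pOint E p) = (x / p%:R \in oint E).
Proof. by []. Qed.

Lemma pOintMl p x y : x \in oint E -> y \in pOint E p -> x * y \in pOint E p.
Proof. by move=> xo yp; rewrite pOintE -mulrA rpredM. Qed.

Lemma pOintMr p x y : x \in oint E -> y \in pOint E p -> y * x \in pOint E p.
Proof. by rewrite mulrC; exact: pOintMl. Qed.

Lemma pOint_p p x : (0 < p)%N -> x \in oint E -> p%:R * x \in pOint E p.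
Proof. by move=> p0 xo; rewrite pOintE mulrC mulKf // natE_eq0 -lt0n. Qed.

Lemma pOint_oint p x : (0 < p)%N -> x \in pOint E p -> x \in oint E.
Proof.
move=> p0; rewrite pOintE => xp; rewrite -(@divfK _ p%:R _ x) ?natE_eq0 -?lt0n //.
by rewrite rpredM // rpred_nat.
Qed.

Lemma intr_oint (z : int) : z%:~R \in oint E. Proof. exact: rpred_int. Qed.

Lemma pOint_int p (z : int) : (0 < p)%N -> (z%:~R \in pOint E p) = (p %| z)%Z.
Proof.
move=> p0; apply/idP/idP; last first.
  by case/dvdzP=> c ->; rewrite intrM mulrC pOint_p // intr_oint.
rewrite pOintE -[z%:~R]alg_int -[p%:R]alg_nat -[_ / _]/((in_alg E _) / (in_alg E _)).
rewrite -fmorph_div => /oint_rat/intrP[c /(canRL (divfK _)) cE].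
apply/dvdzP; exists c; apply/eqP; rewrite -(eqr_int rat) intrM cE //.
by rewrite pnatr_eq0 -lt0n.
Qed.

Lemma nilpP p x : reflect (x \in oint E /\ exists k, x ^+ k \in pOint E p) (x \in nilp E p).
Proof. exact: asboolP. Qed.

Lemma nilp_oint p x : x \in nilp E p -> x \in oint E.
Proof. by case/nilpP. Qed.

Lemma pOint_nilp p x : (0 < p)%N -> x \in pOint E p -> x \in nilp E p.
Proof. by move=> p0 xp; apply/nilpP; split; [exact: pOint_oint xp | exists 1%N]. Qed.

Lemma nilpMl p x y : x \in oint E -> y \in nilp E p -> x * y \in nilp E p.
Proof.
move=> xo /nilpP[yo [k yk]]; apply/nilpP; split; first exact: rpredM.
by exists k; rewrite exprMn pOintMl ?rpredX.
Qed.

(** In the binomial expansion of (x + y) ^ (k + l) each term contains x ^ k or y ^ l. *)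
Fact nilp_zmod p : zmod_closed (nilp E p).
Proof.
split=> [|x y xn yn].
  by apply/nilpP; split; [exact: rpred0 | exists 1%N; rewrite expr1 rpred0].
have {yn} yn : - y \in nilp E p by rewrite -mulN1r nilpMl // rpredN rpred1.
move: (- y) xn yn => {}y /nilpP[xo [k xk]] /nilpP[yo [l yl]].
apply/nilpP; split; first exact: rpredD.
exists (k + l)%N; rewrite exprDn rpred_sum // => i _; rewrite rpredMn //.
have [li|il] := leqP l i.
  by rewrite -[i in y ^+ i](subnK li) exprD mulrA pOintMl // rpredM // rpredX.
have -> : (k + l - i = k + (l - i))%N by rewrite addnBA // ltnW.
by rewrite exprD -mulrA pOintMr // rpredM // rpredX.
Qed.
HB.instance Definition _ p := GRing.isZmodClosed.Build E (nilp E p) (nilp_zmod p).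

(** This is how a congruence between algebraic integers yields one between integers. *)
Lemma nilp_int p (z : int) : prime p -> z%:~R \in nilp E p -> (p %| z)%Z.
Proof.
move=> pp /nilpP[_ [k]]; rewrite -rmorphXn pOint_int ?prime_gt0 //=.
rewrite !dvdzE abszX; case: k => [|k]; last by rewrite Euclid_dvdX // andbT.
by rewrite expn0 dvdn1 /= => /eqP p1; rewrite p1 in pp.
Qed.

Lemma nilp1 p : prime p -> 1 \notin nilp E p.
Proof.
move=> pp; apply/negP; rewrite -[1]/(1%:~R) => /nilp_int-/(_ pp).
by rewrite dvdzE dvdn1 /= => /eqP p1; rewrite p1 in pp.
Qed.

Lemma nilp_root p x k : x \in oint E -> x ^+ k \in nilp E p -> x \in nilp E p.
Proof.
move=> xo /nilpP[_ [l]]; rewrite -exprM => xkl.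
by apply/nilpP; split=> //; exists (k * l)%N.
Qed.

Lemma o_idealN P x : o_ideal P -> x \in P -> - x \in P.
Proof. by move=> iP xP; rewrite -mulN1r (o_idealM iP) // rpredN rpred1. Qed.

Lemma o_idealB P x y : o_ideal P -> x \in P -> y \in P -> x - y \in P.
Proof. by move=> iP xP yP; rewrite (o_idealD iP) // (o_idealN iP). Qed.

Lemma nilp_ideal p : o_ideal (nilp E p).
Proof.
split; first exact: nilp_oint; first exact: rpred0; first by move=> *; exact: rpredD.
exact: nilpMl.
Qed.

Lemma pOint_ideal p : (0 < p)%N -> o_ideal (pOint E p).
Proof.
move=> p0; split; first by move=> x; exact: pOint_oint.
  exact: rpred0.
  by move=> *; exact: rpredD.
exact: pOintMl.
Qed.

Lemma pOint_sub P p x : o_ideal P -> (0 < p)%N -> p%:R \in P -> x \in pOint E p -> x \in P.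
Proof.
move=> iP p0 pP; rewrite pOintE => xp; rewrite -(@divfK _ p%:R _ x) ?natE_eq0 -?lt0n //.
exact: o_idealM.
Qed.

Lemma bezout_coprime p k : coprime p k -> exists u v : int, u * p%:Z + v * k%:Z = 1.
Proof.
by move=> cpk; have [[u v] /= <-] := coprimezP p%:Z k%:Z cpk; exists u, v.
Qed.

Lemma o_ideal_int P p (z : int) : o_ideal P -> 1 \notin P -> prime p ->
  p%:R \in P -> z%:~R \in P -> (p %| z)%Z.
Proof.
move=> iP P1 pp pP zP; rewrite dvdzE; apply: contraNT P1 => npz.
have /coprimezP[[u v] /= uv] : coprimez p z.
  by rewrite coprimezE /= prime_coprime.
rewrite -[1]/(1%:~R) -uv intrD !intrM.
by apply: (o_idealD iP); apply: (o_idealM iP); rewrite ?intr_oint.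
Qed.

(** By a Bezout relation between p and k. *)
Lemma o_ideal_natl P p k x : o_ideal P -> (forall x, x \in oint E -> p%:R * x \in P) ->
  coprime p k -> x \in oint E -> k%:R * x \in P -> x \in P.
Proof.
move=> iP pP /bezout_coprime[u [v uv]] xo kxP.
have -> : x = u%:~R * (p%:R * x) + v%:~R * (k%:R * x).
  rewrite !mulrA -mulrDl !pmulrn -!intrM -intrD uv mul1r //.
by apply: (o_idealD iP); apply: (o_idealM iP); rewrite ?intr_oint ?pP.
Qed.

End ModP.

(** * Conjugates modulo p *)

Section GaloisModP.
Variable E : splittingFieldType rat.
Hypothesis galE : galois 1 {:E}.
Local Notation gal := (gal_of {:E}).
Implicit Types (s t : gal) (x y : E).

Lemma in_alg_inj (a b : rat) : a%:A = b%:A :> E -> a = b.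
Proof. exact: (fmorph_inj (in_alg E)). Qed.

Fact trace_additive : zmod_morphism (@trace E).
Proof.
move=> x y; apply: in_alg_inj; rewrite scalerBl !traceE // -sumrB.
by apply: eq_bigr => s _; rewrite rmorphB.
Qed.

Lemma traceB x y : trace (x - y) = trace x - trace y.
Proof. exact: trace_additive. Qed.

Lemma trace0 : @trace E 0 = 0.
Proof. by rewrite -[X in trace X](subrr (0 : E)) traceB subrr. Qed.

Lemma traceD x y : trace (x + y) = trace x + trace y.
Proof. by rewrite -[y in LHS]opprK traceB -[- y]sub0r traceB trace0 sub0r opprK. Qed.

Lemma trace_sum (I : Type) (r : seq I) (P : pred I) (F : I -> E) :
  trace (\sum_(i <- r | P i) F i) = \sum_(i <- r | P i) trace (F i).
Proof. exact: (big_morph _ traceD trace0). Qed.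

Lemma traceZ (a : rat) x : trace (a *: x) = a * trace x.
Proof.
apply: in_alg_inj; rewrite -scalerA !traceE // scaler_sumr.
by apply: eq_bigr => s _; rewrite linearZ.
Qed.

Lemma trace_gal s x : trace (s x) = trace x.
Proof.
apply: in_alg_inj; rewrite !traceE // [RHS](reindex_inj (mulgI s)) /=.
by apply: eq_bigr => t _; rewrite galMx.
Qed.

Lemma trace_oint x : x \in oint E -> trace x \is a Num.int.
Proof.
move=> xo; apply: (@oint_rat E); rewrite traceE //.
by apply: rpred_sum => s _; rewrite gal_oint.
Qed.

Lemma trace1 : @trace E 1 = (\dim {:E})%:R.
Proof.
apply: in_alg_inj; rewrite traceE // alg_nat.
under eq_bigr do rewrite rmorph1.
by rewrite sumr_const card_gal.
Qed.

Lemma pOint_gal p s x : (s x \in pOint E p) = (x \in pOint E p).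
Proof. by rewrite !pOintE -(gal_oint s (x / _)) fmorph_div rmorph_nat. Qed.

Lemma nilp_gal p s x : (s x \in nilp E p) = (x \in nilp E p).
Proof.
apply/nilpP/nilpP => -[xo [k xk]]; split; try exists k.
- by rewrite -(gal_oint s).
- by rewrite -(pOint_gal p s) rmorphXn.
- by rewrite gal_oint.
- by rewrite -rmorphXn pOint_gal.
Qed.

Lemma trace_nilp p x : prime p -> x \in nilp E p ->
  exists z : int, trace x = (p%:Z * z)%:~R.
Proof.
move=> pp xn; have /intrP[z zE] := trace_oint (nilp_oint xn).
suff /dvdzP[c cE] : (p %| z)%Z by exists c; rewrite zE cE mulrC.
apply: (@nilp_int E) => //; rewrite -alg_int -zE traceE //.
by apply: rpred_sum => s _; rewrite nilp_gal.
Qed.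

Lemma fixed_poly_int (f : {poly E}) : (forall i, f`_i \in oint E) ->
  (forall s i, s f`_i = f`_i) -> exists g : {poly int}, map_poly intr g = f.
Proof.
move=> fo ff; have /choice[c cE] i : exists z : int, f`_i = z%:~R.
  by apply: (fixed_int galE) => [|s]; [exact: fo | exact: ff].
exists (\poly_(i < size f) c i); apply/polyP => i; rewrite coef_map coef_poly /= cE.
case: ltnP => // fi; rewrite -cE nth_default //.
Qed.

(** The characteristic polynomial of x. *)
Definition galpoly x : {poly E} := \prod_(s : gal) ('X - (s x)%:P).

Lemma galpoly_fix s x : map_poly s (galpoly x) = galpoly x.
Proof.
rewrite /galpoly rmorph_prod [RHS](reindex_inj (mulIg s)) /=; apply: eq_bigr => t _.
by rewrite rmorphB /= map_polyX map_polyC /= galMx.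
Qed.

Lemma galpoly_root x : root (galpoly x) x.
Proof.
rewrite /galpoly (bigD1 1%g) //= rootM root_XsubC gal_id eqxx //.
Qed.

Lemma galpoly_int x : x \in oint E ->
  exists2 g : {poly int}, g \is monic & map_poly intr g = galpoly x.
Proof.
move=> xo; have [||g gE] := @fixed_poly_int (galpoly x).
- apply/polyOverP; apply: rpred_prod => s _.
  by rewrite polyOverXsubC gal_oint.
- by move=> s i; rewrite -{2}(galpoly_fix s x) coef_map.
exists g => //; have mon : galpoly x \is monic by apply: monic_prod => s _; exact: monicXsubC.
have g_sz : size g = size (galpoly x).
  rewrite -gE size_map_inj_poly //; first by move=> a b /eqP; rewrite -subr_eq0 -intrB intE_eq0 subr_eq0 => /eqP.
rewrite monicE -(eqr_int rat); apply/eqP/in_alg_inj; rewrite !alg_int /lead_coef g_sz.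
by have := mon; rewrite monicE /lead_coef -{1}gE coef_map /= => /eqP.
Qed.

Lemma coef_prod_ideal (P : {pred E}) (r : seq E) i : o_ideal P ->
  {subset r <= P} -> (i < size r)%N -> (\prod_(c <- r) ('X - c%:P))`_i \in P.
Proof.
move=> iP; elim: r i => //= c r IH i rP.
have cP : c \in P by apply: rP; rewrite mem_head.
have {}rP : {subset r <= P} by move=> x xr; apply: rP; rewrite inE xr orbT.
have qo j : (\prod_(c <- r) ('X - c%:P))`_j \in oint E.
  move: j; apply/polyOverP; elim: (r) rP => [|d r' IH'] rP; first by rewrite big_nil rpred1.
  rewrite big_cons rpredM ?IH' // => [|x xr]; last by apply: rP; rewrite inE xr orbT.
  by rewrite polyOverXsubC (o_ideal_sub iP) // rP ?mem_head.
rewrite big_cons mulrBl coefB coefXM coefCM ltnS => ir.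
apply: (o_idealB iP); last by rewrite mulrC (o_idealM iP).
by case: i ir => [|i] ir /=; [exact: (o_ideal0 iP) | exact: IH].
Qed.

(** Modulo p the characteristic polynomial of x is 'X ^ n: its other coefficients are rational integers
   in a proper ideal containing p. *)
Lemma ideal_conj_nilp (P : {pred E}) p x : prime p -> o_ideal P -> 1 \notin P ->
  p%:R \in P -> (forall s, s x \in P) -> x \in nilp E p.
Proof.
move=> pp iP P1 pP xP; have xo : x \in oint E by rewrite -(gal_id {:E} x) (o_ideal_sub iP).
apply/nilpP; split=> //; exists (\dim {:E}).
have [g mg gE] := galpoly_int xo; have [r rE] : exists r, galpoly x = \prod_(c <- r) ('X - c%:P) /\
   (size r = \dim {:E} /\ {subset r <= P}).
  exists [seq s x | s : gal]; rewrite /galpoly big_image size_image card_gal //.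
  by split; [exact: eq_bigl | split=> // y /mapP[s _ ->]].
move: rE => [rE [sr rP]].
have := rootP (galpoly_root x).
rewrite horner_coef rE size_prod_XsubC big_ord_recr /=.
have -> : (\prod_(c <- r) ('X - c%:P))`_(size r) = 1.
  have : \prod_(c <- r) ('X - c%:P) \is monic by apply: monic_prod_XsubC.
  by rewrite monicE /lead_coef size_prod_XsubC => /eqP.
rewrite mul1r sr => /eqP; rewrite addrC addr_eq0 => /eqP ->; rewrite rpredN.
apply: rpred_sum => i _; apply: pOintMr; first exact: rpredX.
have := @coef_prod_ideal P r i iP rP; rewrite sr => /(_ (ltn_ord i)).
rewrite -rE -gE coef_map /= => giP.
by rewrite pOint_int ?prime_gt0 //; apply: o_ideal_int giP.
Qed.

Lemma pOint_binom p x y : prime p -> x \in oint E -> y \in oint E ->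
  (x + y) ^+ p - (x ^+ p + y ^+ p) \in pOint E p.
Proof.
move=> pp xo yo; have [q pE] : exists q, p = q.+1 by exists p.-1; rewrite prednK ?prime_gt0.
have -> : (x + y) ^+ p - (x ^+ p + y ^+ p) =
    \sum_(i < q) (x ^+ (p - i.+1) * y ^+ i.+1) *+ 'C(p, i.+1).
  rewrite exprDn big_ord_recl; set S := \sum_(i < p) _.
  have -> : S = \sum_(i < q) (x ^+ (p - i.+1) * y ^+ i.+1) *+ 'C(p, i.+1) + y ^+ p.
    rewrite /S pE big_ord_recr /= /bump /= add1n subnn expr0 mul1r binn mulr1n.
    by congr (_ + _).
  by rewrite subn0 bin0 mulr1 mulr1n; ring.
apply: rpred_sum => i _; rewrite -mulr_natl.
have /dvdnP[c ->] : (p %| 'C(p, i.+1))%N by apply: prime_dvd_bin; rewrite //= pE ltnS.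
rewrite mulnC natrM -mulrA pOint_p ?prime_gt0 //.
by rewrite !rpredM ?rpredX ?rpred_nat.
Qed.

Lemma fermat_int p (c : int) : prime p -> (p %| c ^+ p - c)%Z.
Proof.
move=> pp; rewrite -Fp_int_eq0 // rmorphB rmorphXn /=.
by have := expf_card (c%:~R : 'F_p); rewrite card_Fp // => ->; rewrite subrr.
Qed.

(** Frobenius fixes the integers modulo p, hence commutes with integral polynomials. *)
Lemma pOint_frob_poly p x (g : {poly int}) : prime p -> x \in oint E ->
  (map_poly intr g).[x] ^+ p - (map_poly intr g).[x ^+ p] \in pOint E p.
Proof.
move=> pp xo; elim/poly_ind: g => [|g c IH].
  by rewrite map_poly0 !hornerC expr0n gtn_eqF ?prime_gt0 // subr0 rpred0.
have go : (map_poly intr g).[x] \in oint E.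
  by apply: rpred_horner => //; apply/polyOverP => i; rewrite coef_map /= intr_oint.
rewrite rmorphD rmorphM /= map_polyX map_polyC /= !hornerE.
set a := _.[x] in IH go *; set b := _.[x ^+ p] in IH *.
have -> : (a * x + c%:~R) ^+ p - (b * x ^+ p + c%:~R) =
   ((a * x + c%:~R) ^+ p - ((a * x) ^+ p + c%:~R ^+ p)) +
   (x ^+ p * (a ^+ p - b) + (c%:~R ^+ p - c%:~R)).
  by rewrite exprMn; ring.
rewrite rpredD ?pOint_binom ?rpredM ?intr_oint // rpredD ?pOintMl ?rpredX //.
by rewrite -rmorphXn -rmorphB /= pOint_int ?prime_gt0 // fermat_int.
Qed.

(** If f is the characteristic polynomial of z, then f (z ^ p) is congruent to f (z) ^ p = 0. *)
Lemma prod_frobenius p z : prime p -> z \in oint E ->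
  \prod_(s : gal) (z ^+ p - s z) \in pOint E p.
Proof.
move=> pp zo; have [g _ gE] := galpoly_int zo.
have := pOint_frob_poly g pp zo; rewrite gE (rootP (galpoly_root z)).
rewrite expr0n gtn_eqF ?prime_gt0 // sub0r rpredN /galpoly horner_prod.
by under eq_bigr do rewrite hornerXsubC.
Qed.

End GaloisModP.

(** * Integral bases *)

(** The matrix determinant lemma, from the two block triangular factorizations of one bordered matrix. *)
Lemma det_1Dmul (R : comNzRingType) n (u : 'cV[R]_n) (v : 'rV[R]_n) :
  \det (1%:M + u *m v) = 1 + (v *m u) 0 0.
Proof.
pose B := block_mx 1%:M (- v) u 1%:M : 'M_(1 + n).
have d1 : \det B = \det (1%:M + u *m v).
  have := det_mulmx (block_mx 1%:M 0 (- u) 1%:M : 'M_(1 + n)) B.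
  rewrite det_lblock !det1 !mul1r => <-; rewrite mulmx_block !mul1mx !mul0mx !addr0.
  by rewrite mulmx1 addNr mulNmx mulmxN opprK det_ublock det1 mul1r addrC.
have := det_mulmx (block_mx 1%:M v 0 1%:M : 'M_(1 + n)) B.
rewrite det_ublock !det1 !mul1r -d1 => <-; rewrite mulmx_block !mul1mx !mul0mx !add0r.
rewrite mulmx1 addNr det_lblock det1 mulr1 [_ + _]mx11_scalar det_scalar1 !mxE.
by rewrite eqxx.
Qed.

Definition gram (E : fieldExtType rat) n (w : 'I_n -> E) : 'M[rat]_n :=
  \matrix_(i, j) trace_form (w i) (w j).

Section Lattice.
Variable E : splittingFieldType rat.
Hypothesis galE : galois 1 {:E}.
Local Notation gal := (gal_of {:E}).

Lemma gram_change n (w w' : 'I_n -> E) (S : 'M[rat]_n) :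
  (forall i, w' i = \sum_j S i j *: w j) -> gram w' = S *m gram w *m S^T.
Proof.
move=> w'E; apply/matrixP => i k; rewrite !mxE /trace_form !w'E mulr_sumr trace_sum //.
apply: eq_bigr => l _; rewrite mulr_suml trace_sum // !mxE mulr_suml.
apply: eq_bigr => j _; rewrite !mxE /trace_form -scalerAl -scalerAr !traceZ //; ring.
Qed.

Lemma basis_change (V : {vspace E}) (w w' : (\dim V).-tuple E) (S : 'M[rat]_(\dim V)) :
  basis_of V w -> S \in unitmx ->
  (forall i : 'I_(\dim V), w'`_i = \sum_j S i j *: w`_j) -> basis_of V w'.
Proof.
move=> bw uS w'E; rewrite basisEdim size_tuple leqnn andbT.
suff : (<<w>> <= <<w'>>)%VS by rewrite (span_basis bw).
apply/span_subvP => _ /tnthP[i0 ->]; rewrite (tnth_nth 0).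
have -> : w`_i0 = \sum_j (invmx S) i0 j *: w'`_j.
  under eq_bigr do rewrite w'E scaler_sumr.
  rewrite exchange_big /= (bigD1 i0) //= [X in _ + X]big1 => [|j ji0].
    have := mulVmx uS => /matrixP/(_ i0 i0); rewrite !mxE eqxx => /= E1.
    rewrite addr0; under eq_bigr do rewrite scalerA.
    by rewrite -scaler_suml E1 scale1r.
  have := mulVmx uS => /matrixP/(_ i0 j); rewrite !mxE eq_sym (negPf ji0) => /= E1.
  under eq_bigr do rewrite scalerA.
  by rewrite -scaler_suml E1 scale0r.
by apply: rpred_sum => j _; rewrite rpredZ // memv_span // mem_nth // size_tuple.
Qed.

Section Basis.
Variables (V : {vspace E}) (M : {pred E}).
Hypothesis Mo : {subset M <= oint E}.
Hypothesis MV : {subset M <= V}.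
Hypothesis MZ : zmod_closed M.
Hypothesis Mfull : forall v, v \in V -> exists2 N : nat, (0 < N)%N & N%:R * v \in M.
Hypothesis Vnondeg : forall y, y \in V -> y != 0 -> exists2 x, x \in V & trace (x * y) != 0.
Local Notation r := (\dim V).

Lemma gram_det_neq0 (w : r.-tuple E) : basis_of V w -> \det (gram (fun i : 'I_r => w`_i)) != 0.
Proof.
move=> bw; apply/negP => /det0P[c c0 cG].
pose y := \sum_i c 0 i *: w`_i.
have yV : y \in V.
  by apply: rpred_sum => i _; rewrite rpredZ // (basis_mem bw) // mem_nth // size_tuple.
have y0 : y != 0.
  apply: contraNneq c0 => y0; apply/eqP/rowP => i; rewrite mxE.
  by have /freeP/(_ (c 0) y0 i) := basis_free bw.
have [x xV /eqP[]] := Vnondeg yV y0.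
rewrite (coord_basis bw xV) mulr_suml trace_sum // big1 // => j _.
rewrite -scalerAl traceZ // (_ : trace _ = (c *m gram (fun i : 'I_r => w`_i)) 0 j).
  by rewrite cG mxE mulr0.
rewrite mxE mulr_sumr trace_sum //; apply: eq_bigr => i _.
by rewrite !mxE /trace_form -scalerAr traceZ // [w`_j * _]mulrC.
Qed.

Lemma gram_det_int (w : r.-tuple E) : {subset w <= M} ->
  \det (gram (fun i : 'I_r => w`_i)) \is a Num.int.
Proof.
move=> wM; apply: rpred_sum => s _; rewrite rpredMsign; apply: rpred_prod => i _.
by rewrite mxE trace_oint // rpredM // Mo // wM // mem_nth // size_tuple.
Qed.

Lemma lattice_sum (I : Type) (s : seq I) (P : pred I) (F : I -> E) :
  (forall i, P i -> F i \in M) -> \sum_(i <- s | P i) F i \in M.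
Proof.
have [M0 MB] := MZ; move=> FM; elim/big_rec: _ => // i x Pi xM.
rewrite -[x]opprK MB ?FM // -[- x]add0r MB //.
Qed.

Lemma lattice_natMl n x : x \in M -> n%:R * x \in M.
Proof. by move=> xM; rewrite mulr_natl -[n]card_ord -sumr_const lattice_sum. Qed.

Lemma lattice_intMl (z : int) x : x \in M -> z%:~R * x \in M.
Proof.
have [M0 MB] := MZ; move=> xM; case: (intP z) => [|n|n].
- by rewrite mul0r.
- exact: lattice_natMl.
- by rewrite mulrNz mulNr -[- _]add0r MB // lattice_natMl.
Qed.

(** Among the bases of V with entries in M take one with minimal Gram determinant in absolute value. If
   x in M had a coordinate with fractional part e > 0, replacing that basis vector by x - floor * w_j
   would multiply the determinant by e ^ 2 < 1. *)
Lemma lattice_basis : exists w : r.-tuple E,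
  [/\ basis_of V w, {subset w <= M} &
      forall x, x \in M -> exists c : 'I_r -> int, x = \sum_i (c i)%:~R * w`_i].
Proof.
have [M0 MB] := MZ.
pose Q N := `[< exists w : r.-tuple E, [/\ basis_of V w, {subset w <= M} &
   `|\det (gram (fun i : 'I_r => w`_i))| = N%:R] >].
have [w0 bw0 w0M] : exists2 w : r.-tuple E, basis_of V w & {subset w <= M}.
  have /choice[N NE] (i : 'I_r) : exists N, (0 < N)%N /\ N%:R * (vbasis V)`_i \in M.
    have [|N N0 NM] := @Mfull (vbasis V)`_i; last by exists N.
    by rewrite vbasis_mem // mem_nth // size_tuple.
  pose w := [tuple (N i)%:R * (vbasis V)`_i | i < r].
  exists w; last by move=> _ /mapP[i _ ->]; case: (NE i).
  apply: (@basis_change _ _ _ (diag_mx (\row_i (N i)%:R)) (vbasisP V)).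
    rewrite unitmxE det_diag unitfE; apply/prodf_neq0 => i _.
    by rewrite mxE pnatr_eq0 -lt0n; case: (NE i).
  move=> i; rewrite nth_mktuple (bigD1 i) //= big1 ?addr0 => [|j ji].
    by rewrite !mxE eqxx mulr1n scaler_nat mulr_natl.
  by rewrite !mxE eq_sym (negPf ji) mulr0n scale0r.
have exQ : exists N, Q N.
  have /intrP[z zE] := gram_det_int w0M.
  exists `|z|%N; apply/asboolP; exists w0; split=> //.
  by rewrite zE -intr_norm -abszE.
case: (ex_minnP exQ) => N /asboolP[w [bw wM wN]] Nmin.
exists w; split=> // x xM.
have cint (j : 'I_r) : coord w j x \is a Num.int.
  apply/negPn/negP => cj.
  pose f := Num.floor (coord w j x); pose e := coord w j x - f%:~R.
  have e_gt0 : 0 < e.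
    rewrite lt_def subr_ge0 Num.Theory.floor_le_tmp andbT.
    by rewrite subr_eq0; apply: contraNneq cj => ->; rewrite rpred_int.
  have e_lt1 : e < 1 by rewrite ltrBlDl -[1 in ltRHS]/(1%:~R) -intrD Num.Theory.floorD1_gt.
  (* S is the identity except in row j, which expresses x - f * w_j on w. *)
  pose rw : 'rV[rat]_r := \row_k (coord w k x - (f%:~R + 1) *+ (k == j)).
  pose S : 'M[rat]_r := 1%:M + delta_mx j 0 *m rw.
  have dS : \det S = e.
    rewrite det_1Dmul -colE !mxE eqxx mulr1n /e; ring.
  pose w' := [tuple if i == j then x - f%:~R * w`_j else w`_i | i < r].
  have wj : w`_j \in M by rewrite wM // mem_nth // size_tuple.
  have w'E (i : 'I_r) : w'`_i = \sum_k S i k *: w`_k.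
    rewrite nth_mktuple; under eq_bigr => k _.
      rewrite !mxE big_ord1 !mxE eqxx andbT scalerDl. over.
    rewrite big_split /= (bigD1 i) //= eqxx scale1r [X in _ + X + _]big1 => [|k ki]; last first.
      by rewrite eq_sym (negPf ki) scale0r.
    case: eqP => [->|_]; last by rewrite big1 ?addr0 // => k _; rewrite mul0r scale0r.
    under eq_bigr do rewrite mul1r scalerBl.
    rewrite sumrB -(coord_basis bw (MV xM)) (bigD1 j) //= eqxx mulr1n.
    rewrite [X in _ - (_ + X)]big1 => [|k kj]; last by rewrite (negPf kj) mulr0n scale0r.
    by rewrite scalerDl scale1r addr0 -[f%:~R *: _]mulr_algl alg_int; ring.
  have bw' : basis_of V w'.
    by apply: basis_change bw _ w'E; rewrite unitmxE dS unitfE gt_eqF.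
  have w'M : {subset w' <= M}.
    move=> _ /mapP[i _ ->]; case: ifP => _; first by rewrite MB // lattice_intMl.
    by rewrite wM // mem_nth // size_tuple.
  have gE := gram_change w'E.
  have dg : \det (gram (fun i : 'I_r => w'`_i)) = e * e * \det (gram (fun i : 'I_r => w`_i)).
    by rewrite gE !det_mulmx det_tr dS; ring.
  have /intrP[z zE] := gram_det_int w'M.
  have /Nmin : Q `|z|%N.
    apply/asboolP; exists w'; split=> //.
    by rewrite zE -intr_norm -abszE.
  apply/negP; rewrite -ltnNge -(ltr_nat rat) -wN.
  have -> : `|z|%N%:R = `|z%:~R : rat| by rewrite -intr_norm -abszE.
  rewrite -zE dg normrM gtr_pMl ?normr_gt0 ?gram_det_neq0 //.
  rewrite ger0_norm ?mulr_ge0 ?ltW // (lt_trans _ e_lt1) // -[X in _ < X]mulr1.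
  by rewrite ltr_pM2l.
exists (fun i => Num.floor (coord w i x)).
rewrite {1}(coord_basis bw (MV xM)); apply: eq_bigr => i _.
by rewrite -alg_int floorK // mulr_algl.
Qed.

End Basis.

Lemma trace_nondeg (F : {subfield E}) y : y \in F -> y != 0 ->
  exists2 x, x \in F & trace (x * y) != 0.
Proof.
move=> yF y0; exists y^-1; first by rewrite rpredV.
by rewrite mulVf // trace1 // pnatr_eq0 -lt0n adim_gt0.
Qed.

Lemma oint_basis : exists w : (\dim {:E}).-tuple E,
  [/\ basis_of {:E} w, {subset w <= oint E} &
      forall x, x \in oint E -> exists c : 'I_(\dim {:E}) -> int, x = \sum_i (c i)%:~R * w`_i].
Proof.
apply: lattice_basis => [||||y _ y0]; rewrite //.
- by move=> x _; rewrite memvf.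
- by split=> [|x y]; [exact: rpred0 | exact: rpredB].
- by move=> v _; exact: oint_clear.
- by apply: (@trace_nondeg {:E}%AS) y0; rewrite memvf.
Qed.

(** The Cayley-Hamilton argument: y is an eigenvalue of the integral matrix of its action on a lattice. *)
Lemma stable_oint (M : {pred E}) (y x0 : E) : {subset M <= oint E} -> zmod_closed M ->
  (forall a x, a \in oint E -> x \in M -> a * x \in M) -> x0 \in M -> x0 != 0 ->
  (forall x, x \in M -> y * x \in M) -> y \in oint E.
Proof.
move=> Mo MZ oM x0M x00 yM.
have Mfull v : v \in {:E}%VS -> exists2 N : nat, (0 < N)%N & N%:R * v \in M.
  move=> _; have [N N0 No] := oint_clear (v / x0); exists N => //.
  by rewrite -(divfK x00 v) mulrA oM.
have nondeg z : z \in {:E}%VS -> z != 0 -> exists2 x, x \in {:E}%VS & trace (x * z) != 0.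
  exact: (@trace_nondeg {:E}%AS).
have [w [bw wM wE]] := lattice_basis Mo (fun x _ => memvf x) MZ Mfull nondeg.
have /choice[A AE] (i : 'I_(\dim {:E})) : exists c : 'I_(\dim {:E}) -> int,
    y * w`_i = \sum_j (c j)%:~R * w`_j.
  by apply: wE; rewrite yM // wM // mem_nth // size_tuple.
pose B : 'M[int]_(\dim {:E}) := \matrix_(i, j) A j i.
apply/ointP; exists (char_poly B); first exact: char_poly_monic.
rewrite map_char_poly -eigenvalue_root_char; apply/eigenvalueP.
exists (\row_i w`_i).
  apply/rowP => i; rewrite !mxE AE; apply: eq_bigr => j _.
  by rewrite !mxE mulrC.
apply/negP => /eqP/rowP w0.
have := bw; rewrite basisEfree => /and3P[/free_not0 wn0 _ _].
have d0 : (0 < \dim {:E})%N := adim_gt0 {:E}%AS.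
have := wn0 w`_0; rewrite mem_nth ?size_tuple // => /(_ isT).
by have := w0 (Ordinal d0); rewrite !mxE /= => ->; rewrite eqxx.
Qed.

End Lattice.

(** * A prime ideal above p and its local ring *)

(** A maximal ideal above p; maximality is stated as invertibility modulo P outside P. *)
Record max_ideal (E : fieldExtType rat) (p : nat) (P : {pred E}) : Prop := MaxIdeal {
  max_ideal_o : o_ideal P;
  max_ideal_p : p%:R \in P;
  max_ideal1 : 1 \notin P;
  max_ideal_inv : forall s, s \in oint E -> s \notin P ->
    exists2 t, t \in oint E & 1 - t * s \in P }.

Section MaxIdeal.
Variable E : splittingFieldType rat.
Hypothesis galE : galois 1 {:E}.

(** Representatives of o / p o, from the coordinates on an integral basis. *)
Lemma finite_mod p : (0 < p)%N -> exists (T : finType) (rep : T -> E),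
  (forall t, rep t \in oint E) /\
  forall x, x \in oint E -> exists t, x - rep t \in pOint E p.
Proof.
move=> p0; have [w [_ wo wE]] := oint_basis galE.
have wo' i : (i < \dim {:E})%N -> w`_i \in oint E.
  by move=> lti; rewrite wo // mem_nth // size_tuple.
exists {ffun 'I_(\dim {:E}) -> 'I_p}.
exists (fun c : {ffun 'I_(\dim {:E}) -> 'I_p} => \sum_i (c i)%:R * w`_i); split=> [c|x xo].
  by apply: rpred_sum => i _; rewrite rpredM ?rpred_nat ?wo'.
have [c ->] := wE x xo.
have pz : p%:Z != 0 by rewrite eqz_nat -lt0n.
have cp i : (`|(c i %% p)%Z| < p)%N.
  by rewrite -ltz_nat gez0_abs ?modz_ge0 ?ltz_pmod.
exists [ffun i => Ordinal (cp i)]; rewrite -sumrB; apply: rpred_sum => i _.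
rewrite -mulrBl pOintMr ?wo' // ffunE /= pmulrn gez0_abs ?modz_ge0 // -intrB.
by rewrite pOint_int // -eqz_mod_dvd modz_mod.
Qed.

Lemma pigeonhole_mod p (f : nat -> E) : (0 < p)%N -> (forall i, f i \in oint E) ->
  exists i j : nat, (i < j)%N /\ f i - f j \in pOint E p.
Proof.
move=> p0 fo; have [T [rep [rep_o repP]]] := finite_mod p0.
have /choice[g gE] i : exists t, f i - rep t \in pOint E p by exact: repP.
have /injectivePn[i [j ij gij]] : ~~ injectiveb (fun i : 'I_#|T|.+1 => g i).
  apply: contraT; rewrite negbK => /injectiveP/leq_card.
  by rewrite card_ord ltnn.
have sub (a b : nat) : g a = g b -> f a - f b \in pOint E p.
  move=> gab; rewrite -(subrKA (rep (g a))) {2}gab -[rep _ - _]opprB.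
  by rewrite rpredB.
case: (ltngtP i j) => [lt|lt|/val_inj/eqP]; last by rewrite (negPf ij).
- by exists i, j; split=> //; exact: sub.
- by exists j, i; split=> //; apply: sub.
Qed.

(** A proper ideal containing p is determined by its representatives modulo p, so one with the largest
   number of representatives is maximal. *)
Lemma max_ideal_exists p : prime p -> exists P : {pred E}, max_ideal p P.
Proof.
move=> pp; have p0 := prime_gt0 pp.
have [T [rep [rep_o repP]]] := finite_mod p0.
pose S (I : {pred E}) := [pred t | rep t \in I].
pose ok (I : {pred E}) := [/\ o_ideal I, p%:R \in I & 1 \notin I].
pose Q N := `[< exists2 I, ok I & #|S I| = N >].
have exQ : exists N, Q N.
  exists #|S (pOint E p)|; apply/asboolP; exists (pOint E p); rewrite //; split.
  - exact: pOint_ideal.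
  - by rewrite -[p%:R]mulr1 pOint_p // rpred1.
  - by apply: contra (nilp1 E pp); exact: pOint_nilp.
have ubQ N : Q N -> (N <= #|T|)%N by move=> /asboolP[I _ <-]; exact: max_card.
case: (ex_maxnP exQ ubQ) => N /asboolP[P [iP pP P1] PN] Nmax.
exists P; split=> // s so sP.
(* The ideal P + s o. *)
pose I : {pred E} := fun x => `[< x \in oint E /\ exists2 a, a \in oint E & x - a * s \in P >].
have II x : reflect (x \in oint E /\ exists2 a, a \in oint E & x - a * s \in P) (x \in I).
  exact: asboolP.
have iI : o_ideal I.
  split.
  - by move=> x /II[].
  - apply/II; split; first exact: rpred0.
    by exists 0; rewrite ?rpred0 // mul0r subr0 (o_ideal0 iP).
  - move=> x y /II[xo [a ao aP]] /II[yo [b bo bP]]; apply/II; split; first exact: rpredD.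
    exists (a + b); first exact: rpredD.
    by have -> : x + y - (a + b) * s = (x - a * s) + (y - b * s) by [ring]; exact: (o_idealD iP).
  - move=> c x co /II[xo [a ao aP]]; apply/II; split; first exact: rpredM.
    by exists (c * a); [exact: rpredM | rewrite -mulrA -mulrBr (o_idealM iP)].
have PI x : x \in P -> x \in I.
  move=> xP; apply/II; split; first exact: (o_ideal_sub iP).
  by exists 0; rewrite ?rpred0 // mul0r subr0.
have sI : s \in I.
  apply/II; split=> //; exists 1; rewrite ?rpred1 // mul1r subrr; exact: (o_ideal0 iP).
have [/II[_ [a ao aP]]|I1] := boolP (1 \in I); first by exists a.
have : (#|S I| <= N)%N by apply: Nmax; apply/asboolP; exists I => //; split=> //; exact: PI.
rewrite -PN => leS; case/negP: sP.
have SPI : S P \subset S I by apply/fintype.subsetP => t; exact: (PI (rep t)).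
have [t tP] := repP s so.
have tI : t \in S I.
  have : rep t \in I by rewrite -[rep t](subKr s) (o_idealB iI) // PI // (pOint_sub iP p0 pP).
  by [].
have : t \in S P.
  by have /subset_cardP/(_ SPI) -> : #|S P| = #|S I| by apply/eqP; rewrite eqn_leq subset_leq_card.
move=> trP; rewrite -[s](subrK (rep t)) (o_idealD iP) //.
exact: pOint_sub tP.
Qed.
End MaxIdeal.

Section Local.
Variable E : splittingFieldType rat.
Hypothesis galE : galois 1 {:E}.
Variables (p : nat) (P : {pred E}).
Hypothesis pp : prime p.
Hypothesis mP : max_ideal p P.
Let iP := max_ideal_o mP.
Let p0 := prime_gt0 pp.

Lemma max_ideal_prime x y : x \in oint E -> y \in oint E -> x * y \in P ->
  (x \in P) || (y \in P).
Proof.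
move=> xo yo xyP; have [//|xP] := boolP (x \in P); rewrite /=.
have [t to tP] := max_ideal_inv mP xo xP.
have -> : y = y * (1 - t * x) + t * (x * y) by ring.
by apply: (o_idealD iP); apply: (o_idealM iP).
Qed.

Lemma max_idealX x k : x \in oint E -> x ^+ k \in P -> x \in P.
Proof.
move=> xo; elim: k => [|k IH]; first by rewrite expr0 (negPf (max_ideal1 mP)).
by rewrite exprS => /max_ideal_prime; rewrite rpredX // => /(_ xo isT)/orP[|/IH].
Qed.

Lemma max_ideal_prod (I : Type) (r : seq I) (Q : pred I) (F : I -> E) :
  (forall i, Q i -> F i \in oint E /\ F i \notin P) ->
  \prod_(i <- r | Q i) F i \notin P.
Proof.
move=> fixed_subfieldP; suff [] : \prod_(i <- r | Q i) F i \in oint E /\ \prod_(i <- r | Q i) F i \notin P by [].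
elim/big_rec: _ => [|i x Qi [xo xP]]; first by rewrite rpred1 (max_ideal1 mP).
have [Fo FnP] := fixed_subfieldP i Qi; rewrite rpredM //; split=> //.
by apply/negP => /(max_ideal_prime Fo xo); rewrite (negPf FnP) (negPf xP).
Qed.

Lemma pOint_max x : x \in pOint E p -> x \in P.
Proof. exact: (pOint_sub iP p0 (max_ideal_p mP)). Qed.

Lemma nilp_max x : x \in nilp E p -> x \in P.
Proof. by move=> /nilpP[xo [k /pOint_max]]; exact: max_idealX. Qed.

Lemma max_ideal_nat k : coprime p k -> k%:R \notin P.
Proof.
rewrite prime_coprime //; apply: contra => kP.
have := o_ideal_int iP (max_ideal1 mP) pp (max_ideal_p mP) (_ : (k%:Z)%:~R \in P).
by rewrite -pmulrn => /(_ kP); rewrite dvdzE.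
Qed.

(** The localization of o at P, inside E. *)
Definition loc : {pred E} :=
  fun x => `[< exists s, [/\ s \in oint E, s \notin P & s * x \in oint E] >].

Lemma locP x : reflect (exists s, [/\ s \in oint E, s \notin P & s * x \in oint E]) (x \in loc).
Proof. exact: asboolP. Qed.

Fact loc_subring : subring_closed loc.
Proof.
have mulP s t : s \in oint E -> s \notin P -> t \in oint E -> t \notin P -> s * t \notin P.
  move=> so sP to tP; apply/negP => /(max_ideal_prime so to).
  by rewrite (negPf sP) (negPf tP).
split=> [|x y|x y]; first by apply/locP; exists 1; rewrite mulr1 rpred1 (max_ideal1 mP).
- move=> /locP[s [so sP sx]] /locP[t [to tP ty]]; apply/locP; exists (s * t).
  split; [exact: rpredM | exact: mulP |].
  have -> : s * t * (x - y) = t * (s * x) - s * (t * y) by ring.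
  by rewrite rpredB // rpredM.
- move=> /locP[s [so sP sx]] /locP[t [to tP ty]]; apply/locP; exists (s * t).
  split; [exact: rpredM | exact: mulP |].
  have -> : s * t * (x * y) = (s * x) * (t * y) by ring.
  by rewrite rpredM.
Qed.
HB.instance Definition _ := GRing.isSubringClosed.Build E loc loc_subring.

Lemma oint_loc x : x \in oint E -> x \in loc.
Proof. by move=> xo; apply/locP; exists 1; rewrite mul1r rpred1 (max_ideal1 mP). Qed.

Lemma unit_loc x : x \in oint E -> x \notin P -> x^-1 \in loc.
Proof.
move=> xo xP; apply/locP; exists x; split=> //; rewrite divff ?rpred1 //.
by apply: contraNneq xP => ->; exact: (o_ideal0 iP).
Qed.

Lemma P_nonunit x : x \in P -> x != 0 -> x^-1 \notin loc.
Proof.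
move=> xP x0; apply/locP => -[s [so sP sx]]; case/negP: sP.
by rewrite -[s](divfK x0) (o_idealM iP).
Qed.

Lemma natV_loc k : coprime p k -> (k%:R)^-1 \in loc.
Proof. by move=> /max_ideal_nat kP; rewrite unit_loc ?rpred_nat. Qed.

(** The quotient b / p is an element outside o that maps P into o. Starting from 1, which no element
   outside P multiplies into p o, multiply for each representative g of P by the largest power of g
   that keeps this property; then some s outside P kills all products b * g modulo p. *)
Lemma annihilator : exists b, [/\ b \in oint E, b \notin pOint E p &
  forall g, g \in P -> b * g \in pOint E p].
Proof.
have [T [rep [rep_o repP]]] := finite_mod galE p0.
pose out s := s \in oint E /\ s \notin P.
have outM s t : out s -> out t -> out (s * t).
  move=> [so sP] [to tP]; split; first exact: rpredM.
  by apply/negP => /(max_ideal_prime so to); rewrite (negPf sP) (negPf tP).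
have nil_loc g : g \in P -> exists k s, out s /\ s * g ^+ k \in pOint E p.
  move=> gP; have go := o_ideal_sub iP gP.
  have [i [j [ltij gij]]] := pigeonhole_mod galE p0 (fun i => rpredX i go).
  exists i, (1 - g ^+ (j - i)); split.
    split; first by rewrite rpredB ?rpred1 ?rpredX.
    apply: contra (max_ideal1 mP) => H; rewrite -[1](subrK (g ^+ (j - i))).
    apply: (o_idealD iP) => //; have := ltij; rewrite -subn_gt0.
    by case: (j - i)%N => // k _; rewrite exprS mulrC (o_idealM iP) // rpredX.
  by rewrite mulrBl mul1r -exprD subnK // ltnW.
pose bad b := b \in oint E /\ forall s, out s -> s * b \notin pOint E p.
have bad1 : bad 1.
  split=> [|s [so sP]]; first exact: rpred1.
  by rewrite mulr1; apply: contra sP; exact: pOint_max.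
have step (gs : seq E) : {subset gs <= P} -> exists b, bad b /\
    forall g, g \in gs -> exists2 s, out s & s * (b * g) \in pOint E p.
  elim: gs => [|g gs IH] gsP; first by exists 1.
  have [|b [[bo bb] bg]] := IH; first by move=> x xg; apply: gsP; rewrite inE xg orbT.
  have gP : g \in P by apply: gsP; rewrite mem_head.
  have go := o_ideal_sub iP gP.
  pose Q k := `[< exists2 s, out s & s * (b * g ^+ k) \in pOint E p >].
  have exQ : exists k, Q k.
    have [k [s [os sg]]] := nil_loc g gP; exists k; apply/asboolP; exists s => //.
    by rewrite mulrCA pOintMl.
  case: (ex_minnP exQ) => -[|k] /asboolP[s os sk] kmin.
    by have := bb s os; rewrite -[b]mulr1 -(expr0 g) sk.
  exists (b * g ^+ k); split.
    split; first by rewrite rpredM // rpredX.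
    move=> s' os'; apply/negP => H; suff : Q k by move=> /kmin; rewrite ltnn.
    by apply/asboolP; exists s'.
  move=> h; rewrite inE => /orP[/eqP->|/bg[s' os' H]].
    by exists s => //; rewrite -[b * _ * _]mulrA -exprSr.
  by exists s' => //; rewrite mulrAC mulrA pOintMr // rpredX.
have [|b [[bo bb] bg]] := step [seq rep t | t <- enum T & rep t \in P].
  by move=> x /mapP[t]; rewrite mem_filter => /andP[? _] ->.
have /choice[s sE] (t : T) : exists s, out s /\ (rep t \in P -> s * (b * rep t) \in pOint E p).
  have [tP|tP] := boolP (rep t \in P); last by exists 1; split=> //; split; rewrite ?rpred1 ?(max_ideal1 mP).
  have [|s os H] := bg (rep t); last by exists s.
  by apply/mapP; exists t; rewrite // mem_filter tP mem_enum.
pose s0 := \prod_t s t.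
have s0o : s0 \in oint E by apply: rpred_prod => t _; case: (sE t) => [[]].
have s0P : s0 \notin P by apply: max_ideal_prod => t _; case: (sE t).
exists (s0 * b); split; first exact: rpredM.
  by apply: bb; split.
move=> g gP; have [t tP] := repP g (o_ideal_sub iP gP).
rewrite -[g](subrK (rep t)) mulrDr; apply: rpredD.
  by rewrite pOintMl // rpredM.
have trP : rep t \in P by rewrite -[rep t](subKr g) (o_idealB iP) // pOint_max.
rewrite /s0 (bigD1 t) //= mulrC; set s1 := \prod_(i | _) _.
have -> : rep t * (s t * s1 * b) = s1 * (s t * (b * rep t)) by ring.
rewrite pOintMl //; last by case: (sE t) => _; apply.
by apply: rpred_prod => i _; case: (sE i) => [[]].
Qed.

(** A generator of the maximal ideal of the local ring. *)
Definition uniformizer u := [/\ u \in loc, u^-1 \notin loc &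
  forall x, x \in loc -> x^-1 \notin loc -> x / u \in loc].

(** For y = b / p as above, y * P is not contained in P since y is not integral, so y * P contains a unit
   of the local ring and y ^-1 generates its maximal ideal. *)
Lemma uniformizer_exists : exists2 u, uniformizer u &
  (u^-1 \notin oint E) /\ forall z, z \in P -> z / u \in oint E.
Proof.
have [b [bo bp bP]] := annihilator.
pose y := b / p%:R.
have yo : y \notin oint E by [].
have yP z : z \in P -> z * y \in oint E by move=> /bP; rewrite pOintE mulrAC mulrC.
have y0 : y != 0 by apply: contraNneq yo => ->; exact: rpred0.
have [x xP yxP] : exists2 x, x \in P & y * x \notin P.
  apply: contrapT => H; case/negP: yo.
  apply: (stable_oint galE (M := P) (x0 := p%:R)).
  - exact: (o_ideal_sub iP).
  - by split; [exact: (o_ideal0 iP) | move=> x z; exact: (o_idealB iP)].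
  - exact: (o_idealM iP).
  - exact: (max_ideal_p mP).
  - by rewrite natE_eq0 -lt0n.
  - by move=> x xP; apply: contrapT => /negP xyP; apply: H; exists x.
have xyo : y * x \in oint E by rewrite mulrC yP.
exists y^-1; last by rewrite invrK; split.
rewrite /uniformizer invrK; split.
- by apply/locP; exists (y * x); split=> //; rewrite mulrAC divff // mul1r (o_ideal_sub iP).
- apply/locP => -[s [so sP sy]].
  have /(max_ideal_prime so xyo) : s * (y * x) \in P by rewrite mulrA (o_idealM iP).
  by rewrite (negPf sP) (negPf yxP).
- move=> z /locP[s [so sP sz]] zV; apply/locP; exists s; split=> //.
  rewrite mulrA yP //; apply: contraNT zV => szP.
  have sz0 : s * z != 0 by apply: contraNneq szP => ->; exact: (o_ideal0 iP).
  have -> : z^-1 = s * (s * z)^-1.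
    by move: sz0; rewrite mulf_eq0 negb_or => /andP[s0 z0]; rewrite invfM mulrA divff ?mul1r.
  by rewrite rpredM ?unit_loc // oint_loc.
Qed.

Section Uniformizer.
Variable u : E.
Hypothesis uu : uniformizer u.

Lemma unif_loc : u \in loc. Proof. by case: uu. Qed.

Lemma unif_neq0 : u != 0.
Proof. by case: uu => _ H _; apply: contraNneq H => ->; rewrite invr0 rpred0. Qed.

Lemma unitVloc x : x \in loc -> (x^-1 \in loc) || (x / u \in loc).
Proof. by move=> xl; case: uu => _ _ /(_ x xl); case: (x^-1 \in loc) => //=; apply. Qed.

Lemma locu_nonunit x : x / u \in loc -> x != 0 -> x^-1 \notin loc.
Proof.
move=> xu x0; apply/negP => xV; case: uu => _ uV _; case/negP: uV.
by rewrite -[u^-1](mulKf x0) rpredM.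
Qed.

Lemma locuM x y : x \in loc -> y / u \in loc -> x * y / u \in loc.
Proof. by move=> xl yu; rewrite -mulrA rpredM. Qed.

Lemma P_locu x : x \in oint E -> (x / u \in loc) = (x \in P).
Proof.
move=> xo; apply/idP/idP => [xu|xP].
  apply: contraT => xP.
  have x0 : x != 0 by apply: contraNneq xP => ->; exact: (o_ideal0 iP).
  by have := locu_nonunit xu x0; rewrite unit_loc.
have [->|x0] := eqVneq x 0; first by rewrite mul0r rpred0.
by have := unitVloc (oint_loc xo); rewrite (negPf (P_nonunit xP x0)).
Qed.

Lemma loc_approx x : x \in loc -> exists2 a, a \in oint E & (x - a) / u \in loc.
Proof.
move=> xl; have /locP[s [so sP sx]] := xl.
have [t to tP] := max_ideal_inv mP so sP.
exists (t * (s * x)); first exact: rpredM.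
have -> : x - t * (s * x) = x * (1 - t * s) by ring.
rewrite locuM // P_locu //; exact: (o_ideal_sub iP).
Qed.

(** The z in o divisible by all powers of a uniformizer v form a lattice stable under v ^-1, which would
   make v ^-1 integral if that lattice were not zero. *)
Lemma loc_krull x : (forall k, x / u ^+ k \in loc) -> x = 0.
Proof.
move=> xk; have [v vv [vo vP]] := uniformizer_exists.
have v0 : v != 0 by apply: contraNneq vo => ->; rewrite invr0 rpred0.
have uv : u / v \in loc.
  by case: vv => _ _; apply; [exact: unif_loc | case: uu].
apply: contrapT => /eqP x0; case/negP: vo.
pose M : {pred E} := fun z => `[< z \in oint E /\ forall k, z / v ^+ k \in loc >].
have MM z : reflect (z \in oint E /\ forall k, z / v ^+ k \in loc) (z \in M) by exact: asboolP.
have /locP[s [so sP sx]] : x \in loc by have := xk 0%N; rewrite expr0 divr1.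
apply: (stable_oint galE (M := M) (x0 := s * x)).
- by move=> z /MM[].
- split; first by apply/MM; rewrite rpred0; split=> // k; rewrite mul0r rpred0.
  move=> z t /MM[zo zk] /MM[to tk]; apply/MM; split; first exact: rpredB.
  by move=> k; rewrite mulrBl rpredB.
- move=> a z ao /MM[zo zk]; apply/MM; split; first exact: rpredM.
  by move=> k; rewrite -mulrA rpredM // oint_loc.
- apply/MM; split=> // k.
  have -> : s * x / v ^+ k = s * ((x / u ^+ k) * (u / v) ^+ k).
    by rewrite expr_div_n; field; rewrite !expf_neq0 ?unif_neq0.
  by apply: rpredM; [exact: oint_loc | apply: rpredM; [exact: xk | exact: rpredX]].
- by rewrite mulf_neq0 //; apply: contraNneq sP => ->; exact: (o_ideal0 iP).
- move=> z /MM[zo zk].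
  have zP : z \in P.
    apply: contraT => zP; have zV := unit_loc zo zP.
    have z0 : z != 0 by apply: contraNneq zP => ->; exact: (o_ideal0 iP).
    case: vv => _ vV _; case/negP: vV; rewrite -[v^-1](mulKf z0) rpredM //.
    by have := zk 1%N; rewrite expr1.
  apply/MM; rewrite mulrC vP //; split=> // k.
  by rewrite -mulrA -invfM -exprS zk.
Qed.

Lemma loc_val x : x \in loc -> x != 0 ->
  exists k, x / u ^+ k \in loc /\ (x / u ^+ k)^-1 \in loc.
Proof.
move=> xl x0.
have exk : exists k, x / u ^+ k \notin loc.
  apply: contrapT => H; case/eqP: x0; apply: loc_krull => k.
  by apply: contrapT => /negP Hk; apply: H; exists k.
case: (ex_minnP exk) => -[|k]; first by rewrite expr0 divr1 xl.
move=> xk kmin; exists k.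
have xkl : x / u ^+ k \in loc.
  by apply: contraT => /kmin; rewrite ltnn.
split=> //; have := unitVloc xkl; rewrite -mulrA -invfM -exprSr (negPf xk) orbF //.
Qed.

Lemma unif_eq v : v != 0 -> v / u \in loc -> u / v \in loc -> uniformizer v.
Proof.
have u0 := unif_neq0; move=> v0 vu uv; split.
- by rewrite -[v](divfK u0) rpredM ?unif_loc.
- apply/negP => vV; case: uu => _ uV _; case/negP: uV.
  by rewrite -[u^-1](mulKf v0) rpredM.
- move=> x xl xV; have -> : x / v = x / u * (u / v) by field; rewrite v0 u0.
  by rewrite rpredM //; have := unitVloc xl; rewrite (negPf xV).
Qed.

Lemma ideal_exp_locu k x : ideal_exp (fun y => y \in P) k x ->
  x \in oint E /\ x / u ^+ k \in loc.
Proof.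
elim: k x => [|k IH] x /=.
  by move=> /ointP xo; rewrite expr0 divr1 oint_loc.
case=> s sP ->; rewrite mulr_suml; split.
  rewrite big_seq; apply: rpred_sum => y /sP[y1 /IH[y2 _]].
  by rewrite rpredM // (o_ideal_sub iP).
rewrite big_seq; apply: rpred_sum => y /sP[y1 /IH[y2 y3]].
have -> : y.1 * y.2 / u ^+ k.+1 = y.1 / u * (y.2 / u ^+ k) by rewrite exprS invfM; ring.
by rewrite rpredM // P_locu // (o_ideal_sub iP).
Qed.

(** The local generator u is P up to units: with t * u in P, an element of order at least k + 1 is
   divided by t * u, and the denominator s is corrected by an inverse of s modulo P. *)
Lemma locu_ideal_exp k x : x \in oint E -> x / u ^+ k \in loc ->
  ideal_exp (fun y => y \in P) k x.
Proof.
have u0 := unif_neq0.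
elim: k x => [|k IH] x xo xk; first exact/ointP.
have /locP[t [to tP tu]] := unif_loc.
have t0 : t != 0 by apply: contraNneq tP => ->; exact: (o_ideal0 iP).
have tuP : t * u \in P by rewrite -P_locu // mulfK // oint_loc.
pose y := x / (t * u).
have yk : y / u ^+ k \in loc.
  have -> : y / u ^+ k = t^-1 * (x / u ^+ k.+1).
    by rewrite /y exprS; field; rewrite expf_neq0 // u0 t0.
  by rewrite rpredM // unit_loc.
have yl : y \in loc by rewrite -[y](divfK (expf_neq0 k u0)) rpredM // rpredX // unif_loc.
have /locP[s [so sP sy]] := yl.
have [a ao aP] := max_ideal_inv mP so sP.
exists [:: (a * (t * u), s * y); (1 - a * s, x)].
  move=> z; rewrite !inE => /orP[]/eqP -> /=; split.
  - exact: (o_idealM iP).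
  - by apply: IH; rewrite // -mulrA rpredM // oint_loc.
  - exact: aP.
  - apply: IH => //; have -> : x / u ^+ k = u * (x / u ^+ k.+1).
      by rewrite exprS; field; rewrite expf_neq0 // u0.
    by rewrite rpredM // unif_loc.
rewrite !big_cons big_nil /= /y; field; by rewrite u0 t0.
Qed.

(** The u-adic valuation of p is the ramification index of P. *)
Lemma p_val : exists k, [/\ (0 < k)%N, p%:R / u ^+ k \in loc, u ^+ k / p%:R \in loc &
  is_ramification_index p (fun y => y \in P) k].
Proof.
have po : p%:R \in oint E by rewrite rpred_nat.
have pn0 : p%:R != 0 :> E by rewrite natE_eq0 -lt0n.
have [k [k1]] := loc_val (oint_loc po) pn0; rewrite invf_div => k2.
exists k; split=> //.
  case: k k1 k2 => // _; rewrite expr0 mul1r => pV.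
  by have := P_nonunit (max_ideal_p mP) pn0; rewrite pV.
split; first exact: locu_ideal_exp.
move=> /ideal_exp_locu[_ H]; case: uu => _ uV _; case/negP: uV.
have -> : u^-1 = u ^+ k / p%:R * (p%:R / u ^+ k.+1).
  by rewrite exprS; field; rewrite pn0 expf_neq0 ?unif_neq0.
exact: rpredM.
Qed.

End Uniformizer.

(** * Wild inertia *)

Local Notation gal := (gal_of {:E}).

(** The inertia group of P itself; the group inertia p defined later is contained in it. *)
Definition inertial (s : gal) := forall x, x \in oint E -> s x - x \in P.

Lemma inertialV s : inertial s -> inertial s^-1%g.
Proof.
move=> sI x xo; have yo : (s^-1)%g x \in oint E by rewrite gal_oint.
by rewrite -opprB (o_idealN iP) //; have := sI _ yo; rewrite -galMx mulVg gal_id.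
Qed.

Lemma inertial_P s x : inertial s -> x \in oint E -> (s x \in P) = (x \in P).
Proof.
move=> sI xo; have H := sI x xo; apply/idP/idP => xP.
  by rewrite -(subKr (s x) x) (o_idealB iP).
by rewrite -(subrK x (s x)) (o_idealD iP).
Qed.

Lemma inertial_loc s x : inertial s -> x \in loc -> s x \in loc.
Proof.
move=> sI /locP[t [to tP tx]]; apply/locP; exists (s t).
by rewrite gal_oint -rmorphM gal_oint (inertial_P sI).
Qed.

Section Uniformizer2.
Variable u : E.
Hypothesis uu : uniformizer u.
Let u0 := unif_neq0 uu.

Lemma inertial_locu s x : inertial s -> x \in loc -> (s x - x) / u \in loc.
Proof.
move=> sI /locP[t [to tP tx]].
have t0 : t != 0 by apply: contraNneq tP => ->; exact: (o_ideal0 iP).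
have st0 : s t != 0 by rewrite fmorph_eq0.
set b := t * x in tx; have -> : s x - x = (t * (s b - b) - b * (s t - t)) / (t * s t).
  by rewrite /b rmorphM /=; field; rewrite t0 st0.
rewrite mulrAC rpredM //; last first.
  by rewrite invfM rpredM ?unit_loc ?gal_oint // (inertial_P sI).
have H : t * (s b - b) - b * (s t - t) \in P.
  by apply: (o_idealB iP); apply: (o_idealM iP); rewrite // sI.
by rewrite P_locu // (o_ideal_sub iP).
Qed.

Lemma inertial_unif s : inertial s -> s u / u \in loc.
Proof.
move=> sI; case: (uu) => ul uV; apply; first exact: inertial_loc.
apply: contra uV => /(inertial_loc (inertialV sI)).
by rewrite fmorphV /= -galMx mulgV gal_id.
Qed.

Lemma inertial_unifV s : inertial s -> u / s u \in loc.
Proof.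
move=> sI; have := inertial_loc sI (inertial_unif (inertialV sI)).
by rewrite fmorph_div /= -galMx mulVg gal_id.
Qed.

Lemma gal_eq1 (s : gal) : (forall x, x \in loc -> s x = x) -> s = 1%g.
Proof.
move=> sx; apply/eqP/gal_eqP => x _; rewrite gal_id.
have [N N0 No] := oint_clear x; have := sx _ (oint_loc No).
rewrite rmorphM rmorph_nat => /mulfI; apply.
by rewrite natE_eq0 -lt0n.
Qed.

(** Krull's intersection theorem separates automorphisms that agree to all orders. *)
Lemma inertial_krull (s : gal) :
  (forall k x, x \in loc -> (s x - x) / u ^+ k \in loc) -> s = 1%g.
Proof.
move=> H; apply: gal_eq1 => x xl; apply/eqP; rewrite -subr_eq0; apply/eqP.
by apply: (loc_krull uu) => k; exact: H.
Qed.

(** The kernel of the tame character s |-> s u / u is a p-group. If s u is congruent to u to second order,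
   then s moves y = s x - x by less and less; as the conjugates s ^ j y sum to 0, the order of s times
   y is small, and the order is a unit. *)
Lemma inertial_kernel s : inertial s -> coprime p #[s]%g -> (s u / u - 1) / u \in loc ->
  s = 1%g.
Proof.
move=> sI cop su1; apply: inertial_krull => k; case: k => [x xl|k].
  by rewrite expr0 divr1 rpredB // inertial_loc.
elim: k => [|k IH] x xl; first by rewrite expr1 inertial_locu.
set c := s u / u in su1; have suE : s u = c * u by rewrite /c divfK.
have cl : c \in loc by exact: inertial_unif.
have c0 : c != 0 by rewrite mulf_neq0 ?invr_eq0 // fmorph_eq0.
have ck : (c ^+ k.+1 - 1) / u \in loc.
  rewrite subrX1 mulrAC rpredM // rpred_sum // => i _; exact: rpredX.
have step z : z / u ^+ k.+1 \in loc -> (s z - z) / u ^+ k.+2 \in loc.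
  move=> zk; set w := z / u ^+ k.+1 in zk.
  have -> : (s z - z) / u ^+ k.+2 = (c ^+ k.+1 - 1) / u * s w + (s w - w) / u.
    have zE : z = u ^+ k.+1 * w by rewrite /w mulrC divfK ?expf_neq0.
    have sz : s z = c ^+ k.+1 * u ^+ k.+1 * s w.
      by rewrite [in LHS]zE rmorphM rmorphXn /= suE exprMn.
    rewrite sz [in LHS]zE [u ^+ k.+2]exprS; field; by rewrite u0 expf_neq0.
  by rewrite rpredD // ?inertial_locu // rpredM // inertial_loc.
have loc1 z : z / u ^+ k.+2 \in loc -> z / u ^+ k.+1 \in loc.
  move=> zk; have -> : z / u ^+ k.+1 = u * (z / u ^+ k.+2).
    by rewrite [u ^+ k.+2]exprS; field; rewrite u0 expf_neq0.
  by rewrite rpredM // unif_loc.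
pose y := s x - x; have yk : y / u ^+ k.+1 \in loc by exact: IH.
have iter_step j : ((s ^+ j)%g y - y) / u ^+ k.+2 \in loc.
  elim: j => [|j IHj]; first by rewrite expg0 gal_id subrr mul0r rpred0.
  have zk : (s ^+ j)%g y / u ^+ k.+1 \in loc.
    by rewrite -[X in X / _](subrK y) mulrDl rpredD // loc1.
  by rewrite expgSr galMx -[s _](subrK ((s ^+ j)%g y)) -addrA mulrDl rpredD // step.
have sum0 : \sum_(0 <= j < #[s]%g) (s ^+ j)%g y = 0.
  under eq_bigr do rewrite /y rmorphB /= -galMx -expgS.
  by rewrite telescope_sumr // expg_order expg0 subrr.
have : (\sum_(0 <= j < #[s]%g) ((s ^+ j)%g y - y)) / u ^+ k.+2 \in loc.
  by rewrite mulr_suml rpred_sum.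
rewrite sumrB sum0 sub0r sumr_const_nat subn0 mulNr rpredN -mulr_natl -mulrA.
move=> H; rewrite -[_ / _](mulKf (_ : #[s]%g%:R != 0 :> E)) ?natE_eq0 -?lt0n //.
by rewrite rpredM // natV_loc.
Qed.

(** x is congruent to a p-th power since Frobenius is injective, hence bijective, on the finite ring o/P. *)
Lemma residue_perfect x : x \in oint E -> exists2 z, z \in oint E & z ^+ p - x \in P.
Proof.
move=> xo.
have frobB a b i : a \in oint E -> b \in oint E ->
    (a - b) ^+ (p ^ i) - (a ^+ (p ^ i) - b ^+ (p ^ i)) \in P.
  move=> ao bo; elim: i => [|i IH]; first by rewrite expn0 !expr1 subrr (o_ideal0 iP).
  rewrite expnSr !exprM; set A := _ ^+ _ in IH *; set a' := _ ^+ _ in IH *.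
  set b' := _ ^+ _ in IH *.
  have Ao : A \in oint E by rewrite rpredX // rpredB.
  have a'o : a' \in oint E by exact: rpredX.
  have b'o : b' \in oint E by exact: rpredX.
  have -> : A ^+ p - (a' ^+ p - b' ^+ p) =
     (A ^+ p - (a' - b') ^+ p) - ((a' - b' + b') ^+ p - ((a' - b') ^+ p + b' ^+ p)).
    by rewrite subrK; ring.
  apply: (o_idealB iP); last by rewrite pOint_max // pOint_binom // rpredB.
  rewrite subrXX mulrC (o_idealM iP) // rpred_sum // => j _.
  by rewrite rpredM // rpredX // rpredB.
have [i [j [ltij xij]]] := pigeonhole_mod galE p0 (fun i => rpredX (p ^ i) xo).
(* Since x ^ (p ^ i) and x ^ (p ^ j) are congruent, x is congruent to x ^ (p ^ (j - i)). *)
have dij : (j - i = (j - i).-1.+1)%N by rewrite prednK // subn_gt0.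
exists (x ^+ (p ^ (j - i).-1)); first exact: rpredX.
rewrite -exprM -expnSr -dij -opprB (o_idealN iP) //.
set y := x ^+ (p ^ (j - i)).
have yo : y \in oint E by exact: rpredX.
apply: (@max_idealX _ (p ^ i)); first exact: rpredB.
rewrite -[_ ^+ _](subrK (x ^+ (p ^ i) - y ^+ (p ^ i))) (o_idealD iP) ?frobB //.
rewrite -exprM -expnD subnK 1?ltnW //.
exact: pOint_max.
Qed.

Lemma inertialX s k : inertial s -> inertial (s ^+ k)%g.
Proof.
move=> sI; elim: k => [|k IH] x xo; first by rewrite expg0 gal_id subrr (o_ideal0 iP).
rewrite expgSr galMx -[s _](subrK ((s ^+ k)%g x)) -addrA (o_idealD iP) ?IH //.
by rewrite sI // gal_oint.
Qed.

(** The norm for the cyclic group generated by s, when s ^+ p = 1. *)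
Definition gnorm (s : gal) x := \prod_(j < p) (s ^+ j)%g x.

Lemma gnorm_fix (s : gal) x : (s ^+ p = 1)%g -> s (gnorm s x) = gnorm s x.
Proof.
move=> sp; have [q pE] : exists q, p = q.+1 by exists p.-1; rewrite prednK.
rewrite /gnorm rmorph_prod /=; under eq_bigr do rewrite -galMx -expgSr.
move: sp; rewrite pE => sp.
by rewrite big_ord_recr [RHS]big_ord_recl /= sp expg0 mulrC.
Qed.

(** Every x in the local ring is, modulo u, the norm of some z with z ^ p congruent to x, and norms are
   fixed by s. Hence x has a u-adic expansion with coefficients fixed by s. *)
Lemma inertial_fixed_unif s : inertial s -> (s ^+ p = 1)%g -> s u = u -> s = 1%g.
Proof.
move=> sI sp su; apply: inertial_krull => k; elim: k => [|k IH] x xl.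
  by rewrite expr0 divr1 rpredB // inertial_loc.
have [a ao xa] := loc_approx uu xl.
have [z zo za] := residue_perfect ao.
have nP : gnorm s z - z ^+ p \in P.
  rewrite /gnorm; have -> : z ^+ p = \prod_(j < p) z by rewrite prodr_const card_ord.
  have : \prod_(j < p) (s ^+ j)%g z \in oint E /\ \prod_(j < p) (s ^+ j)%g z - \prod_(j < p) z \in P.
    elim/big_rec2: _ => [|j A B _ [Bo BA]]; first by rewrite subrr rpred1 (o_ideal0 iP).
    rewrite rpredM ?gal_oint //; split=> //.
    have -> : (s ^+ j)%g z * B - z * A = B * ((s ^+ j)%g z - z) + z * (B - A) by ring.
    by apply: (o_idealD iP); apply: (o_idealM iP); rewrite // inertialX.
  by case.
have no : gnorm s z \in oint E by apply: rpred_prod => j _; rewrite gal_oint.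
pose x1 := (x - gnorm s z) / u.
have x1l : x1 \in loc.
  have -> : x1 = (x - a) / u - (gnorm s z - z ^+ p + (z ^+ p - a)) / u.
    by rewrite /x1; field.
  have H : gnorm s z - z ^+ p + (z ^+ p - a) \in P by exact: (o_idealD iP).
  by rewrite rpredB // P_locu // (o_ideal_sub iP).
have xE : x = gnorm s z + u * x1 by rewrite /x1; field.
have -> : (s x - x) / u ^+ k.+1 = (s x1 - x1) / u ^+ k.
  rewrite xE rmorphD rmorphM /= gnorm_fix // su exprS; field.
  by rewrite u0 expf_neq0.
exact: IH.
Qed.

End Uniformizer2.

(** If p does not divide the ramification index e, then a e = b p + 1 and p ^ a / N(u) ^ b is a uniformizer
   fixed by s. *)
Lemma inertial_wild s : inertial s -> (s ^+ p = 1)%g -> s != 1%g -> wildly_ramified E p.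
Proof.
move=> sI sp s1; have [u uu _] := uniformizer_exists; have u0 := unif_neq0 uu.
have [k [k0 k1 k2 rk]] := p_val uu.
exists (fun y => y \in P), k; split=> //; last 2 first.
  exact: (max_ideal_p mP).
  apply: contraT => npk; case/eqP: s1.
  have ckp : coprime k p by rewrite coprime_sym prime_coprime.
  have [a b abE _] := egcdnP p k0.
  have {}abE : (a * k = b * p + 1)%N by rewrite abE (eqP ckp).
  pose n := gnorm s u.
  have pn0 : p%:R != 0 :> E by rewrite natE_eq0 -lt0n.
  have n0 : n != 0 by apply/prodf_neq0 => j _; rewrite fmorph_eq0.
  have nu : n / u ^+ p \in loc.
    have -> : u ^+ p = \prod_(j < p) u by rewrite prodr_const card_ord.
    rewrite -prodf_div; apply: rpred_prod => j _.
    exact: (inertial_unif uu (inertialX j sI)).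
  have un : u ^+ p / n \in loc.
    have -> : u ^+ p = \prod_(j < p) u by rewrite prodr_const card_ord.
    rewrite -prodf_div; apply: rpred_prod => j _.
    exact: (inertial_unifV uu (inertialX j sI)).
  (* By the choice of a and b, f is a unit times u. *)
  pose f := p%:R ^+ a / n ^+ b.
  have f0 : f != 0 by rewrite mulf_neq0 ?invr_eq0 ?expf_neq0.
  have uak : u ^+ k ^+ a = u ^+ p ^+ b * u by rewrite -!exprM -exprSr mulnC abE mulnC addn1.
  have fE : f / u = (p%:R / u ^+ k) ^+ a * (u ^+ p / n) ^+ b.
    rewrite /f !expr_div_n uak; field.
    by rewrite u0 !expf_neq0.
  have fVE : u / f = (u ^+ k / p%:R) ^+ a * (n / u ^+ p) ^+ b.
    rewrite /f !expr_div_n uak; field.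
    by rewrite !expf_neq0.
  have uf : uniformizer f.
    by apply: (unif_eq uu f0); rewrite ?fE ?fVE rpredM // rpredX.
  apply: (inertial_fixed_unif uf) => //.
  by rewrite /f fmorph_div !rmorphXn rmorph_nat /= /n gnorm_fix.
split; last by move=> x y /ointP xo /ointP yo /(max_ideal_prime xo yo)/orP.
  split; first by move=> x xP; apply/ointP; exact: (o_ideal_sub iP).
  - exact: (o_ideal0 iP).
  - by move=> x y; exact: (o_idealD iP).
  - by move=> a x /ointP ao; exact: (o_idealM iP).
by apply/negP; exact: (max_ideal1 mP).
Qed.

(** * Inertia of order prime to p *)

(** The decomposition group of P. *)
Definition decomp (t : gal) := forall x, x \in oint E -> t x \in P -> x \in P.

Lemma decompM s t : decomp s -> decomp t -> decomp (s * t)%g.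
Proof. by move=> sD tD x xo; rewrite galMx => /tD; rewrite gal_oint => /(_ xo)/(sD x xo). Qed.

Lemma decompV t : decomp t -> decomp t^-1%g.
Proof.
move=> tD; have -> : (t^-1 = t ^+ #[t].-1)%g by rewrite invg_expg.
elim: (_.-1) => [|k IH]; last by rewrite expgS; exact: decompM.
by move=> x _; rewrite expg0 gal_id.
Qed.

Lemma decomp_P t x : decomp t -> x \in oint E -> (t x \in P) = (x \in P).
Proof.
move=> tD xo; apply/idP/idP; first exact: tD.
by move=> xP; apply: (decompV tD); rewrite ?gal_oint // -galMx mulgV gal_id.
Qed.

Lemma decomp_loc t x : decomp t -> x \in loc -> t x \in loc.
Proof.
move=> tD /locP[s [so sP sx]]; apply/locP; exists (t s).
by rewrite gal_oint -rmorphM gal_oint (decomp_P tD).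
Qed.

Section Abelian.
Hypothesis abel : forall (s t : gal) x, s (t x) = t (s x).
Variable u : E.
Hypothesis uu : uniformizer u.
Let u0 := unif_neq0 uu.

Lemma decomp_unif t : decomp t -> t u / u \in loc.
Proof.
move=> tD; case: (uu) => ul uV; apply; first exact: decomp_loc.
apply: contra uV => /(decomp_loc (decompV tD)).
by rewrite fmorphV /= -galMx mulgV gal_id.
Qed.

(** The tame character has values fixed by the decomposition group: here the group has to be abelian. *)
Lemma tame_character_fixed s t : inertial s -> decomp t ->
  (t (s u / u) - s u / u) / u \in loc.
Proof.
move=> sI tD; set c := s u / u; set e := t u / u.
have el : e \in loc by exact: decomp_unif.
have e0 : e != 0 by rewrite mulf_neq0 ?invr_eq0 // fmorph_eq0.
have tu : t u = e * u by rewrite /e divfK.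
have eV : e^-1 \in loc.
  have := decomp_loc tD (decomp_unif (decompV tD)).
  by rewrite fmorph_div /= -galMx mulVg gal_id tu invfM mulrCA divff // mulr1.
have -> : t c - c = c * e^-1 * (s e - e).
  have -> : t c = s e / e * c.
    rewrite /c fmorph_div /= -abel tu rmorphM /=; field; by rewrite u0 e0.
  by field.
rewrite locuM ?inertial_locu // rpredM //; exact: inertial_unif.
Qed.

(** By the Chinese remainder theorem, a is congruent modulo P to some z whose conjugates outside the
   decomposition group lie in P. As the product of the z ^ p - t z is divisible by p, one factor is in P;
   the factors are congruent to a ^ p - a, or to a ^ p outside the decomposition group. *)
Lemma decomp_fixed_frobenius a : a \in oint E ->
  (forall t, decomp t -> t a - a \in P) -> a \notin P -> a ^+ p - a \in P.
Proof.
move=> ao aD aP.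
have /choice[b bE] (t : gal) : exists b, [/\ b \in oint E, b \notin P &
    ~ decomp t -> t b \in P].
  have [tD|ntD] := pselect (decomp t).
    by exists 1; split=> //; rewrite ?rpred1 ?(max_ideal1 mP).
  have [x [xo xP txP]] : exists x, [/\ x \in oint E, x \notin P & t x \in P].
    apply: contrapT => H; apply: ntD => x xo tx; apply: contrapT => /negP xP.
    by apply: H; exists x.
  by exists x.
pose B := \prod_t b t.
have Bo : B \in oint E by apply: rpred_prod => t _; case: (bE t).
have BP : B \notin P by apply: max_ideal_prod => t _; case: (bE t).
have [r ro rP] := max_ideal_inv mP Bo BP.
(* z is a modulo P and lies in every t ^-1 P for t outside the decomposition group. *)
pose z := r * B * a.
have zo : z \in oint E by rewrite !rpredM.
have zD t : decomp t -> t z - a \in P.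
  move=> tD; have -> : t z - a = t a - a - t a * t (1 - r * B).
    by rewrite /z !(rmorphB, rmorphM, rmorph1) /=; ring.
  apply: (o_idealB iP); first exact: aD.
  by rewrite (o_idealM iP) ?gal_oint // (decomp_P tD) // (o_ideal_sub iP).
have znD t : ~ decomp t -> t z \in P.
  move=> ntD; have [_ _ /(_ ntD) tb] := bE t.
  rewrite /z /B (bigD1 t) //= !rmorphM /=; set w := t (\prod_(i | _) _).
  have wo : w \in oint E by rewrite gal_oint; apply: rpred_prod => i _; case: (bE i).
  have -> : t r * (t (b t) * w) * t a = t r * w * t a * t (b t) by ring.
  by rewrite (o_idealM iP) // !rpredM // gal_oint.
have D1 : decomp 1%g by move=> x _; rewrite gal_id.
have z_a : z - a \in P by have := zD 1%g D1; rewrite gal_id.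
have zap : z ^+ p - a ^+ p \in P.
  by rewrite subrXX mulrC (o_idealM iP) // rpred_sum // => j _; rewrite rpredM // rpredX.
have /pOint_max := prod_frobenius galE pp zo.
apply: contraTT => apP; apply: max_ideal_prod => t _; split.
  by rewrite rpredB ?rpredX ?gal_oint.
have [tD|ntD] := pselect (decomp t).
  apply: contra apP => H; have -> : a ^+ p - a = (z ^+ p - t z) - (z ^+ p - a ^+ p) + (t z - a) by ring.
  by rewrite (o_idealD iP) ?zD // (o_idealB iP).
apply: contra aP => H; apply: (@max_idealX _ p) => //.
have -> : a ^+ p = (z ^+ p - t z) - (z ^+ p - a ^+ p) + t z by ring.
by rewrite (o_idealD iP) ?znD // (o_idealB iP).
Qed.

(** Fermat's factorization of 'X ^ p - 'X over F_p. *)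
Lemma prod_sub_nat a : a \in oint E ->
  \prod_(0 <= j < p) (a - j%:R) - (a ^+ p - a) \in pOint E p.
Proof.
move=> ao; pose g : {poly int} := \prod_(0 <= j < p) ('X - (j%:R)%:P) - ('X^p - 'X).
have g0 : map_poly (intr : int -> 'F_p) g = 0.
  rewrite rmorphB rmorph_prod /= rmorphB /= map_polyXn map_polyX.
  have -> : 'X^p - 'X = \prod_x ('X - x%:P) :> {poly 'F_p}.
    by rewrite -finField_genPoly card_Fp.
  apply/eqP; rewrite subr_eq0; apply/eqP.
  transitivity (\prod_(0 <= j < p) ('X - (j%:R : 'F_p)%:P)).
    by apply: eq_bigr => j _; rewrite rmorphB /= map_polyX map_polyC /= rmorph_nat.
  rewrite [index_iota 0 p](_ : _ = index_iota 0 (Zp_trunc (pdiv p)).+2); last by rewrite Fp_cast.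
  rewrite big_mkord; apply: eq_bigr => j _.
  by rewrite natr_Zp.
have gp i : (p %| g`_i)%Z.
  have := congr1 (fun q : {poly 'F_p} => q`_i) g0; rewrite coef_map coef0 /=.
  by move/eqP; rewrite Fp_int_eq0.
have -> : \prod_(0 <= j < p) (a - j%:R) - (a ^+ p - a) = (map_poly intr g).[a].
  rewrite rmorphB rmorph_prod /= rmorphB /= map_polyXn map_polyX !(hornerXn, horner_prod, hornerD, hornerN, hornerX).
  congr (_ - _); apply: eq_bigr => j _.
  by rewrite rmorphB /= map_polyX map_polyC /= rmorph_nat !hornerE.
rewrite horner_coef; apply: rpred_sum => i _; rewrite pOintMr ?rpredX //.
by rewrite coef_map /= pOint_int.
Qed.

(** The value of the tame character is an element of the residue field fixed by Frobenius, hence in F_p. *)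
Lemma tame_character_int s : inertial s ->
  exists2 j : 'I_p, (0 < j)%N & (s u / u - j%:R) / u \in loc.
Proof.
move=> sI; set c := s u / u; have cl : c \in loc by exact: inertial_unif.
have c0 : c != 0 by rewrite mulf_neq0 ?invr_eq0 // fmorph_eq0.
have cV : c^-1 \in loc by rewrite /c invf_div; exact: inertial_unifV.
have [a ao ca] := loc_approx uu cl.
have aP : a \notin P.
  apply: contraL cV => aP; apply: (locu_nonunit uu) => //.
  by rewrite -(subrK a c) mulrDl rpredD // P_locu.
have aD t : decomp t -> t a - a \in P.
  move=> tD; rewrite -(P_locu uu) ?rpredB ?gal_oint //.
  have -> : t a - a = (t c - c) - t (c - a) + (c - a) by rewrite rmorphB /=; ring.
  rewrite mulrDl mulrBl rpredD // rpredB //; first exact: tame_character_fixed.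
  have -> : t (c - a) / u = t ((c - a) / u) * (t u / u).
    by rewrite fmorph_div /=; field; rewrite u0 fmorph_eq0.
  by rewrite rpredM ?decomp_unif // decomp_loc.
have apP := decomp_fixed_frobenius ao aD aP.
have prodP : \prod_(0 <= j < p) (a - j%:R) \in P.
  by rewrite -[X in X \in P](subrK (a ^+ p - a)) (o_idealD iP) // pOint_max // prod_sub_nat.
have [j aj] : exists j : 'I_p, a - j%:R \in P.
  apply: contrapT => H; move: prodP; apply/negP; rewrite big_mkord.
  apply: max_ideal_prod => j _; rewrite rpredB ?rpred_nat //; split=> //.
  by apply/negP => aj; apply: H; exists j.
exists j.
  by rewrite lt0n; apply: contra aP => /eqP j0; rewrite j0 subr0 in aj.
have -> : c - j%:R = (c - a) + (a - j%:R) by ring.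
by rewrite mulrDl rpredD // P_locu // rpredB ?rpred_nat.
Qed.

(** The tame character embeds the group into the units of F_p. *)
Lemma inertial_card (I : {group gal}) : (forall s, s \in I -> inertial s) ->
  coprime p #|I| -> (#|I| <= p.-1)%N.
Proof.
move=> II cop.
have /choice[f fE] (s : gal) : exists j : 'I_p, s \in I ->
    (0 < j)%N /\ (s u / u - j%:R) / u \in loc.
  have [sI|_] := boolP (s \in I); last by exists (Ordinal p0).
  by have [j j0 sj] := tame_character_int (II s sI); exists j.
have f_inj : {in I &, injective f}.
  move=> s s' sI s'I fss'; have [_ cs] := fE s sI; have [_ cs'] := fE s' s'I.
  pose r := (s^-1 * s')%g; have rI : r \in I by rewrite groupM ?groupV.
  suff r1 : r = 1%g by apply/eqP; rewrite eq_mulVg1 -/r r1.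
  apply: (inertial_kernel uu); first exact: II.
    exact: coprime_dvdr (order_dvdG rI) cop.
  set c := s u / u in cs; set c' := s' u / u in cs'.
  have c0 : c != 0 by rewrite mulf_neq0 ?invr_eq0 // fmorph_eq0.
  have cV : c^-1 \in loc by rewrite /c invf_div; exact: inertial_unifV (II s sI).
  have sV : inertial (s^-1)%g by exact: inertialV (II s sI).
  have -> : r u / u = (s^-1)%g (c' / c).
    have -> : c' / c = s' u / s u by rewrite /c /c' invf_div mulrA divfK.
    by rewrite fmorph_div /= -!galMx mulgV gal_id /r galMx abel -galMx.
  have -> : (s^-1)%g (c' / c) - 1 = (s^-1)%g (c^-1 * ((c' - (f s')%:R) - (c - (f s)%:R))).
    have <- : c' / c - 1 = c^-1 * ((c' - (f s')%:R) - (c - (f s)%:R)) by rewrite fss'; field.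
    by rewrite rmorphB rmorph1.
  set d := _ - _ - _; have du : d / u \in loc by rewrite /d mulrBl rpredB.
  have -> : (s^-1)%g (c^-1 * d) / u = (s^-1)%g (c^-1 * (d / u)) * ((s^-1)%g u / u).
    by rewrite mulrA -rmorphM /= -mulrA divfK.
  by rewrite rpredM ?inertial_unif // inertial_loc // rpredM.
rewrite -(card_in_imset f_inj).
have sub : f @: I \subset [set~ Ordinal p0]%SET.
  apply/fintype.subsetP => _ /imsetP[s sI ->]; rewrite !inE.
  by have [+ _] := fE s sI; rewrite lt0n; apply: contra => /eqP ->.
by apply: leq_trans (subset_leq_card sub) _; rewrite cardsC1 card_ord.
Qed.

End Abelian.
End Local.

(** * Minkowski's bound for rational forms *)

(** The index of M Z^n is the absolute value of det M, read off the Smith normal form. *)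
Lemma lattice_pigeonhole n (M : 'M[int]_n) (S : finType) (f : S -> 'cV[int]_n) :
  \det M != 0 -> (`|\det M| < #|S|)%N ->
  exists s t, s != t /\ exists x : 'cV[int]_n, f s - f t = M *m x.
Proof.
move=> dM0 ltS; have [L uL [R uR [d _ ME]]] := int_Smith_normal_form M.
set D := \matrix_(i, j) _ in ME.
have dD : (`|\det M| = `|\det D|)%N.
  have unit1 (A : 'M[int]_n) : A \in unitmx -> `|\det A|%N = 1%N.
    move=> uA; have := congr1 (fun B : 'M[int]_n => `|\det B|%N) (mulmxV uA).
    by rewrite det_mulmx det1 abszM => /eqP; rewrite muln_eq1 => /andP[/eqP].
  by rewrite ME !det_mulmx !abszM (unit1 L) // (unit1 R) // mul1n muln1.
have DE : D = diag_mx (\row_i d`_i).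
  by apply/matrixP => i j; rewrite !mxE.
have dDE : `|\det D|%N = \prod_(i < n) `|(d`_i)%R|%N.
  rewrite DE det_diag (big_morph absz abszM (erefl : `|1|%N = 1%N)).
  by apply: eq_bigr => i _; rewrite mxE.
have d0 (i : 'I_n) : d`_i != 0.
  have : \det D != 0 by rewrite -absz_eq0 -dD absz_eq0.
  by rewrite DE det_diag => /prodf_neq0/(_ i isT); rewrite mxE.
(* g s is the class of f s modulo M Z^n in the coordinates that diagonalize M. *)
pose g s : {dffun forall i : 'I_n, 'I_(`|(d`_i)%R|.-1.+1)} :=
  [ffun i : 'I_n => inord `|((invmx L *m f s)%R i 0%R %% (d`_i)%R)%Z|%N].
have [/injectiveP/leq_card|/injectivePn[s [t st gst]]] := boolP (injectiveb g).
  rewrite card_dep_ffun foldrE big_map big_enum /= => le.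
  suff : (#|S| <= `|\det M|)%N by rewrite leqNgt ltS.
  rewrite dD dDE (leq_trans le) //; apply/eq_leq; apply: eq_bigr => i _.
  by rewrite card_ord prednK // lt0n absz_eq0.
exists s, t; split; first exact: st.
have /choice[y yE] (i : 'I_n) : exists y, (invmx L *m f s) i 0 - (invmx L *m f t) i 0 = d`_i * y.
  have := congr1 (fun h : {dffun forall i : 'I_n, 'I_(`|(d`_i)%R|.-1.+1)} => h i) gst.
  rewrite !ffunE => /(congr1 val) /=.
  have lt z : (`|(z %% (d`_i)%R)%Z| < `|(d`_i)%R|.-1.+1)%N.
    rewrite prednK ?lt0n ?absz_eq0 // -ltz_nat gez0_abs ?modz_ge0 //.
    by rewrite abszE ltz_mod.
  rewrite !inordK // => /(congr1 Posz); rewrite !gez0_abs ?modz_ge0 // => /eqP.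
  by rewrite eqz_mod_dvd => /dvdzP[q ->]; exists q; rewrite mulrC.
exists (invmx R *m \col_i y i); rewrite ME !mulmxA mulmxK //.
rewrite -[f s](mulKVmx uL) -[f t](mulKVmx uL) -mulmxBr -mulmxA; congr (_ *m _).
apply/colP => i; rewrite [LHS]mxE [X in _ + X]mxE yE DE mul_diag_mx.
by rewrite [RHS]mxE !mxE.
Qed.

Definition posdef n (H : 'M[rat]_n) :=
  H^T = H /\ forall x : 'cV[rat]_n, x != 0 -> 0 < (x^T *m H *m x) 0 0.

(** Completing the square in one variable after the other. *)
Lemma posdef_LDL n (H : 'M[rat]_n) : posdef H ->
  exists (D : 'rV[rat]_n) (U : 'M[rat]_n),
   [/\ forall i, 0 < D 0 i, \det U = 1 & H = U^T *m diag_mx D *m U].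
Proof.
elim: n H => [|n IH] H [Hs Hp].
  exists 0, 1%:M; split; [by case | exact: det1 |].
  by apply/matrixP => -[].
pose H' : 'M_(1 + n) := H.
pose a := H 0 0; pose b : 'rV_n := ursubmx H'; pose C := drsubmx H'.
have bT : dlsubmx H' = b^T by rewrite /b trmx_ursub Hs.
have ulE : ulsubmx H' = a%:M.
  by rewrite [LHS]mx11_scalar !mxE /a; congr (H _ _)%:M; apply: val_inj.
have HE : H' = block_mx a%:M b b^T C by rewrite -[LHS]submxK ulE bT.
have a0 : 0 < a.
  have := Hp (delta_mx 0 0); rewrite trmx_delta -rowE -colE !mxE; apply.
  by apply/eqP => /matrixP/(_ 0 0); rewrite !mxE eqxx.
pose S := C - a^-1 *: (b^T *m b).
have CT : C^T = C by rewrite /C trmx_drsub Hs.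
have pS : posdef S.
  split; first by rewrite /S linearB linearZ /= trmx_mul trmxK CT.
  move=> x x0; pose z : 'cV_(1 + n) := col_mx (- a^-1 *: (b *m x)) x.
  have z0 : z != 0 by apply: contraNneq x0 => /(congr1 dsubmx); rewrite col_mxKd linear0 => ->.
  have : 0 < (z^T *m H' *m z) 0 0 by exact: Hp.
  rewrite HE /z tr_col_mx mul_row_block mul_row_col.
  congr (0 < _ 0 0).
  set w := - a^-1 *: (b *m x).
  have wT : w^T = - a^-1 *: (x^T *m b^T).
    by apply/matrixP => i j; rewrite /w -trmx_mul !mxE.
  rewrite mul_mx_scalar wT scalerA mulrN mulfV ?gt_eqF // scaleN1r addNr mul0mx add0r.
  rewrite /S mulmxBr !mulmxBl mulmxDl -scalemxAr -!scalemxAl !mulmxA scaleNr addrC //.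
have [D [U [D0 dU SE]]] := IH S pS.
pose U' : 'M_(1 + n) := block_mx 1%:M (a^-1 *: b) 0 U.
pose D' : 'rV_(1 + n) := row_mx a%:M D.
have dU' : \det U' = 1 by rewrite /U' (@det_ublock _ 1 n) det1 dU mulr1.
have HE' : H' = U'^T *m diag_mx D' *m U'.
  rewrite HE /U' /D' diag_mx_row tr_block_mx !mulmx_block.
  have bT' : (a^-1 *: b)^T = a^-1 *: b^T by apply/matrixP => i j; rewrite !mxE.
  rewrite trmx1 trmx0 bT' !(mul1mx, mul0mx, mulmx0, addr0, add0r, mulmx1).
  have -> : diag_mx (a%:M : 'rV[rat]_1) = a%:M :> 'M_1.
    by apply/matrixP => i j; rewrite !mxE !ord1 eqxx.
  rewrite mul_scalar_mx mul_mx_scalar !scalerA mulfV ?mulVf ?gt_eqF // !scale1r.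
  congr block_mx; first by rewrite -SE /S -scalemxAr addrC subrK.
exists D', U'; split; [move=> i | exact: dU' | exact: HE'].
rewrite /D' mxE; case: splitP => j _; last exact: D0.
by rewrite !mxE ord1 eqxx mulr1n.
Qed.

Lemma exists_denominator (I : finType) (q : I -> rat) :
  exists2 N : nat, (0 < N)%N & forall i, N%:R * q i \is a Num.int.
Proof.
exists (\prod_i `|denq (q i)|)%N; first by rewrite prodn_gt0 // => i; rewrite absz_gt0 denq_eq0.
move=> i; rewrite (bigD1 i) //= natrM mulrAC.
by rewrite rpredM ?rpred_nat // pmulrn absz_denq mulrC -numqE rpred_int.
Qed.

(** In the coordinates y = U x the form is the sum of the D_i y_i ^ 2. The box with sides K_i, chosen minimal
   with (K_i / N) ^ 2 D_i >= b, contains more integer points than the index of N U Z^n, and the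
   difference of two of them that are congruent is the required vector. *)
Lemma minkowski_form n (H : 'M[rat]_n) (b : rat) : (0 < n)%N -> posdef H -> 0 < b -> \det H < b ^+ n ->
  exists2 x : 'cV[int]_n, x != 0 &
    ((map_mx intr x)^T *m H *m map_mx intr x) 0 0 < n%:R * b.
Proof.
move=> n0 pH b0 dH; have [D [U [D0 dU HE]]] := posdef_LDL pH.
have [N N0 NU] := exists_denominator (fun ij : 'I_n * 'I_n => U ij.1 ij.2).
have NQ0 : 0 < N%:R :> rat by rewrite ltr0n.
pose M : 'M[int]_n := \matrix_(i, j) Num.floor (N%:R * U i j).
have ME : map_mx intr M = N%:R *: U.
  by apply/matrixP => i j; rewrite !mxE floorK // (NU (i, j)).
have dM : \det M = N%:Z ^+ n.
  apply: (@intr_inj rat); rewrite -det_map_mx ME detZ dU mulr1 rmorphXn /=.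
  by rewrite pmulrn.
have exK (i : 'I_n) : exists k : nat, N%:R ^+ 2 * b <= k%:R ^+ 2 * D 0 i.
  have Di := D0 i; exists (Num.truncn (N%:R ^+ 2 * b / D 0 i)).+1.
  set t := N%:R ^+ 2 * b / D 0 i; have t0 : 0 <= t by rewrite !mulr_ge0 ?invr_ge0 // ltW.
  have lt : t < (Num.truncn t).+1%:R by exact: truncnS_gt.
  have le1 : 1 <= (Num.truncn t).+1%:R :> rat by rewrite ler1n.
  rewrite -[N%:R ^+ 2 * b](divfK (lt0r_neq0 Di)) ler_wpM2r ?(ltW Di) // -/t.
  by rewrite (le_trans (ltW lt)) // expr2 ler_peMl // (le_trans _ le1).
pose K i := ex_minn (exK i).
have KP i : N%:R ^+ 2 * b <= (K i)%:R ^+ 2 * D 0 i by rewrite /K; case: ex_minnP.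
have K0 i : (0 < K i)%N.
  rewrite lt0n; apply/eqP => Ki0; have := KP i.
  by rewrite Ki0 expr0n mul0r leNgt !mulr_gt0 // exprn_gt0.
have Kmin i k : (k < K i)%N -> k%:R ^+ 2 * D 0 i < N%:R ^+ 2 * b.
  by rewrite /K; case: ex_minnP => m _ mmin km; rewrite ltNge; apply: contraL km => /mmin; rewrite -leqNgt.
pose S : finType := {dffun forall i : 'I_n, 'I_(K i)}.
have cS : #|S| = (\prod_i K i)%N.
  rewrite card_dep_ffun foldrE big_map big_enum /=.
  by apply: eq_bigr => i _; rewrite card_ord.
have ltS : (`|\det M| < #|S|)%N.
  rewrite dM abszX cS /= -(ltr_nat rat) natrX natr_prod.
  rewrite -(ltr_pXn2r (isT : (0 < 2)%N)) ?nnegrE ?exprn_ge0 ?prodr_ge0 ?ler0n //.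
  have dH' : \det H = \prod_i D 0 i by rewrite HE !det_mulmx det_tr dU det_diag mulr1 mul1r.
  have pD : 0 < \prod_i D 0 i by apply: prodr_gt0 => i _.
  rewrite -(ltr_pM2r pD) -prodrXl -big_split /=.
  apply: (@lt_le_trans _ _ (\prod_(i < n) (N%:R ^+ 2 * b))); last first.
    by apply: ler_prod => i _; rewrite KP !mulr_ge0 ?ler0n ?(ltW b0).
  rewrite prodr_const card_ord exprMn exprAC ltr_pM2l ?exprn_gt0 //.
  by rewrite -dH'.
pose f (s : S) : 'cV[int]_n := \col_i (s i : nat)%:Z.
have dM0 : \det M != 0 by rewrite dM expf_neq0 // eqz_nat -lt0n.
have [s [t [st [x fx]]]] := lattice_pigeonhole f dM0 ltS.
exists x.
  apply: contra_neq st => x0; apply/ffunP => i; apply: val_inj.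
  have := congr1 (fun y : 'cV[int]_n => y i 0) fx; rewrite x0 mulmx0 !mxE => /eqP.
  by rewrite subr_eq0 => /eqP[].
pose y : 'cV[rat]_n := U *m map_mx intr x.
have yE i : y i 0 = ((s i : nat)%:Z - (t i : nat)%:Z)%:~R / N%:R.
  have := congr1 (fun z : 'cV[int]_n => (z i 0)%:~R : rat) fx; rewrite /= ![in X in X -> _]mxE => ->.
  have -> : (\sum_j M i j * x j 0)%:~R = (map_mx intr M *m map_mx intr x) i 0 :> rat.
    by rewrite mxE rmorph_sum /=; apply: eq_bigr => j _; rewrite !mxE rmorphM.
  have -> : map_mx intr M *m map_mx intr x = N%:R *: y by rewrite ME -scalemxAl.
  by rewrite [X in _ = X / _]mxE [RHS]mulrC mulKf ?gt_eqF.
have -> : ((map_mx intr x)^T *m H *m map_mx intr x) 0 0 = \sum_i D 0 i * y i 0 ^+ 2.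
  rewrite HE !mulmxA -mulmxA -/y -trmx_mul -/y mxE; apply: eq_bigr => i _.
  by rewrite mul_mx_diag !mxE; ring.
have -> : n%:R * b = \sum_(i < n) b by rewrite sumr_const card_ord mulr_natl.
apply: ltr_sum => [|i _]; first by apply/hasP; exists (Ordinal n0); rewrite ?mem_index_enum.
rewrite yE expr_div_n mulrA ltr_pdivrMr ?exprn_gt0 // [b * _]mulrC.
set z := (_ - _); have [k kK zk] : exists2 k, (k < K i)%N & (z%:~R : rat) ^+ 2 = k%:R ^+ 2.
  exists `|z|%N; last by rewrite {1}[z]intEsign rmorphM rmorph_sign exprMn sqrr_sign mul1r.
  rewrite /z; have := ltn_ord (s i); have := ltn_ord (t i); lia.
by rewrite zk [X in X < _]mulrC Kmin.
Qed.


Lemma posdef_det_gt0 n (H : 'M[rat]_n) : posdef H -> 0 < \det H.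
Proof.
move=> /posdef_LDL[D [U [D0 dU ->]]].
by rewrite !det_mulmx det_tr dU det_diag mulr1 mul1r; apply: prodr_gt0 => i _.
Qed.

Lemma bernoulli (R : realDomainType) (h : R) n : 0 <= h -> 1 + n%:R * h <= (1 + h) ^+ n.
Proof.
move=> h0; elim: n => [|n IH]; first by rewrite mul0r addr0.
rewrite exprS; apply: le_trans (ler_wpM2l _ IH); last by rewrite addr_ge0.
have : 0 <= n%:R * h * h by rewrite !mulr_ge0 ?ler0n.
rewrite -natr1; lra.
Qed.

(** The constant 2 is the determinant of the form to which Minkowski's bound is applied below. *)
Lemma two_lt_pow r : (1 < r)%N -> 2 < (1 + r%:R^-1 : rat) ^+ r.
Proof.
case: r => [|[|r]] // _; set n : rat := (r.+2)%:R; have n2 : 2 <= n by rewrite ler_nat.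
have n0 : 0 < n by lra.
have h0 : 0 <= n^-1 by rewrite invr_ge0 ltW.
have -> : (1 + n^-1) ^+ r.+2 = (1 + n^-1) ^+ 2 * (1 + n^-1) ^+ r by rewrite -exprD add2n.
have sq0 : 0 <= (1 + n^-1) ^+ 2 by rewrite exprn_ge0 // addr_ge0.
apply: lt_le_trans (ler_wpM2l sq0 (bernoulli r h0)).
have -> : r%:R = n - 2 by rewrite /n -[r.+2]addn2 natrD; ring.
have nn : n * n^-1 = 1 by rewrite mulfV // gt_eqF.
have : 0 < n^-1 by rewrite invr_gt0.
rewrite mulrBl nn; set h := n^-1 in h0 nn * => hp.
have h2 : 2 * h <= 1 by rewrite -nn; nra.
have hh : 2 * (h * h) <= h by nra.
have hhh : 4 * (h * h * h) <= h by nra.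
have -> : (1 + h) ^+ 2 * (1 + (1 - 2 * h)) = 2 + 2 * h - 2 * (h * h) - 2 * (h * h * h) by ring.
lra.
Qed.

(** * Inertia groups *)

Section Inertia.
Variable E : splittingFieldType rat.
Hypothesis galE : galois 1 {:E}.
Local Notation gal := (gal_of {:E}).
Implicit Types (s t : gal) (x y : E).

(** For an abelian group the inertia groups of the primes above p coincide, so that their common value can
   be defined through the radical of p. *)
Definition inertia p : {set gal} :=
  [set s : gal | `[< forall x, x \in oint E -> s x - x \in nilp E p >]].

Lemma inertiaP p s : reflect (forall x, x \in oint E -> s x - x \in nilp E p) (s \in inertia p).
Proof. by rewrite inE; exact: asboolP. Qed.

Fact inertia_group_set p : group_set (inertia p).
Proof.
apply/group_setP; split; first by apply/inertiaP => x _; rewrite gal_id subrr rpred0.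
move=> s t /inertiaP sI /inertiaP tI; apply/inertiaP => x xo.
rewrite galMx -[t _](subrK (s x)) -addrA rpredD ?sI //.
by rewrite tI // gal_oint.
Qed.
Canonical inertia_group p := Group (inertia_group_set p).

(** By Cauchy's theorem there would be an element of order p, and inertial_wild applies to it. *)
Lemma tame_inertia_coprime p : tame E -> prime p -> coprime p #|inertia p|.
Proof.
move=> tE pp; rewrite prime_coprime //; apply/negP => /(Cauchy pp)[s sI os].
have [P mP] := max_ideal_exists galE pp.
apply: (tE p pp); apply: (inertial_wild galE pp mP (s := s)).
- by move=> x xo; apply: (nilp_max pp mP); move/inertiaP: sI; apply.
- by rewrite -os expg_order.
- by apply: contraTneq pp => s1; rewrite -os s1 order1.
Qed.

Definition fixedby (B : {set gal}) x := forall s, s \in B -> s x = x.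

Hypothesis abel : forall s t x, s (t x) = t (s x).

Lemma inertia_card p : prime p -> coprime p #|inertia p| -> (#|inertia p| <= p.-1)%N.
Proof.
move=> pp cop; have [P mP] := max_ideal_exists galE pp.
have [u uu _] := uniformizer_exists galE pp mP.
apply: (inertial_card galE pp mP abel uu (I := inertia_group p)) => // s /inertiaP sI x xo.
by apply: (nilp_max pp mP); exact: sI.
Qed.

Lemma fixedby_gal B s x : fixedby B x -> fixedby B (s x).
Proof. by move=> xB t tB; rewrite abel xB. Qed.

Lemma sum_fixedby (B : {group gal}) x : fixedby B (\sum_(s in B) s x).
Proof.
move=> t tB; rewrite rmorph_sum [RHS](reindex_inj (mulIg t)) /=.
apply: eq_big => [s|s _]; first by rewrite groupMr.
by rewrite galMx.
Qed.

Lemma natl_nilp p k x : prime p -> coprime p k -> x \in oint E -> k%:R * x \in nilp E p ->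
  x \in nilp E p.
Proof.
move=> pp cop xo; apply: (o_ideal_natl (nilp_ideal E p)) cop xo => y yo.
by apply: pOint_nilp; rewrite ?prime_gt0 // pOint_p ?prime_gt0.
Qed.

Lemma natl_pOint p k x : prime p -> coprime p k -> x \in oint E -> k%:R * x \in pOint E p ->
  x \in pOint E p.
Proof.
move=> pp cop xo; apply: (o_ideal_natl (pOint_ideal E (prime_gt0 pp))) cop xo => y yo.
by rewrite pOint_p ?prime_gt0.
Qed.

(** Outside the inertia group, the differences s x - x generate the unit ideal modulo p. Otherwise, by
   ideal_conj_nilp, they are nilpotent modulo p for x fixed by inertia, hence for all x by averaging over
   the inertia group, whose order is prime to p. *)
Lemma noninertia_unit p s : prime p -> coprime p #|inertia p| -> s \notin inertia p ->
  exists (r : seq (E * E)) (w : E),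
   [/\ forall u, u \in r -> [/\ u.1 \in oint E, u.2 \in oint E & fixedby (inertia p) u.2],
       w \in oint E & 1 = \sum_(u <- r) u.1 * (s u.2 - u.2) + p%:R * w].
Proof.
move=> pp cop sI; have p0 := prime_gt0 pp.
pose ok (r : seq (E * E)) := forall u : E * E, u \in r -> [/\ u.1 \in oint E, u.2 \in oint E & fixedby (inertia p) u.2].
pose a : {pred E} := fun z => `[< exists r w, [/\ ok r, w \in oint E &
   z = \sum_(u <- r) u.1 * (s u.2 - u.2) + p%:R * w] >].
have aP z : reflect (exists r w, [/\ ok r, w \in oint E &
   z = \sum_(u <- r) u.1 * (s u.2 - u.2) + p%:R * w]) (z \in a) by exact: asboolP.
have [/aP[r [w [okr wo E1]]]|a1] := boolP (1 \in a); first by exists r, w.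
case/negP: sI.
have ia : o_ideal a.
  split.
  - move=> z /aP[r [w [okr wo ->]]]; rewrite rpredD ?rpredM ?rpred_nat //.
    rewrite big_seq; apply: rpred_sum => u /okr[u1 u2 _].
    by rewrite rpredM // rpredB // gal_oint.
  - by apply/aP; exists [::], 0; rewrite rpred0 big_nil mulr0 addr0; split.
  - move=> _ _ /aP[r [w [okr wo ->]]] /aP[r' [w' [okr' wo' ->]]]; apply/aP.
    exists (r ++ r'), (w + w'); split.
    + by move=> u; rewrite mem_cat => /orP[/okr|/okr'].
    + exact: rpredD.
    + by rewrite big_cat /=; ring.
  - move=> b _ bo /aP[r [w [okr wo ->]]]; apply/aP.
    exists [seq (b * u.1, u.2) | u <- r], (b * w); split.
    + by move=> _ /mapP[u /okr[u1 u2 uf] ->]; split=> //; exact: rpredM.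
    + exact: rpredM.
    + rewrite big_map /= mulrDr mulr_sumr; congr (_ + _); last by ring.
      by apply: eq_bigr => u _; rewrite mulrA.
have ap : p%:R \in a.
  by apply/aP; exists [::], 1; rewrite rpred1 big_nil mulr1 add0r; split.
have diff x : x \in oint E -> fixedby (inertia p) x -> s x - x \in nilp E p.
  move=> xo xf; apply: (ideal_conj_nilp galE pp ia a1 ap) => t.
  rewrite rmorphB /= abel; apply/aP; exists [:: (1, t x)], 0; split.
  - move=> u; rewrite inE => /eqP ->; split; rewrite /= ?rpred1 ?gal_oint //.
    exact: fixedby_gal.
  - exact: rpred0.
  - by rewrite big_seq1 mulr0 addr0 mul1r.
apply/inertiaP => x xo; apply: (natl_nilp pp cop); first by rewrite rpredB ?gal_oint.
pose tr := \sum_(t in inertia p) t x.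
have trx : tr - #|inertia p|%:R * x \in nilp E p.
  rewrite /tr mulr_natl -sumr_const -sumrB; apply: rpred_sum => t /inertiaP tI.
  exact: tI.
have tro : tr \in oint E by apply: rpred_sum => t _; rewrite gal_oint.
have -> : #|inertia p|%:R * (s x - x) =
   (s tr - tr) - (s (tr - #|inertia p|%:R * x) - (tr - #|inertia p|%:R * x)).
  by rewrite !(rmorphB, rmorphM, rmorph_nat) /=; ring.
rewrite rpredB //; last by rewrite rpredB ?nilp_gal.
by apply: diff => //; exact: (sum_fixedby (B := inertia_group p)).
Qed.

(** The fixed field of inertia is unramified at p: its trace form is nondegenerate modulo p. The proof is the
   linear independence of automorphisms modulo p, eliminating one automorphism at a time. *)
Lemma unramified_trace p y : prime p -> coprime p #|inertia p| -> y \in oint E ->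
  fixedby (inertia p) y ->
  (forall x, x \in oint E -> fixedby (inertia p) x -> exists z : int, trace (x * y) = (p%:Z * z)%:~R) ->
  y \in pOint E p.
Proof.
move=> pp cop yo yf ytr; have p0 := prime_gt0 pp.
have elim_gal (S : seq gal) (d : E) (c : gal -> E) : (forall s, s \in S -> s \notin inertia p) ->
    d \in oint E -> (forall s, c s \in oint E) ->
    (forall x, x \in oint E -> fixedby (inertia p) x -> x * d + \sum_(t <- S) t x * c t \in pOint E p) ->
    d \in pOint E p.
  elim: S c => [|s S IH] c SI dO cO H.
    have := H 1 (rpred1 _); rewrite big_nil addr0 mul1r; apply.
    by move=> t _; rewrite rmorph1.
  have [|r [w [okr wo E1]]] := noninertia_unit pp cop (s := s); first by apply: SI; rewrite mem_head.
  (* Subtracting s u.2 times the relation at x from the relation at x * u.2 kills the term of s. *)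
  pose c' t := - \sum_(u <- r) u.1 * (t u.2 - s u.2) * c t.
  apply: (IH c').
  - by move=> t tS; apply: SI; rewrite inE tS orbT.
  - exact: dO.
  - move=> t; rewrite rpredN big_seq; apply: rpred_sum => u /okr[u1 u2 _].
    by rewrite !rpredM ?rpredB ?gal_oint.
  move=> x xo xf.
  have step (u : E * E) : u \in r ->
      u.1 * (x * (u.2 - s u.2) * d + \sum_(t <- S) t x * (t u.2 - s u.2) * c t) \in pOint E p.
    move=> /okr[u1 u2 uf]; apply: pOintMl => //.
    have xuf : fixedby (inertia p) (x * u.2) by move=> t tI; rewrite rmorphM /= xf // uf.
    have -> : x * (u.2 - s u.2) * d + \sum_(t <- S) t x * (t u.2 - s u.2) * c t =
       (x * u.2 * d + \sum_(t <- s :: S) t (x * u.2) * c t) -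
       s u.2 * (x * d + \sum_(t <- s :: S) t x * c t).
      have -> : \sum_(t <- S) t x * (t u.2 - s u.2) * c t =
          \sum_(t <- S) t (x * u.2) * c t - s u.2 * \sum_(t <- S) t x * c t.
        by rewrite mulr_sumr -sumrB; apply: eq_bigr => t _; rewrite rmorphM /=; ring.
      by rewrite !big_cons rmorphM /=; ring.
    by rewrite rpredB ?H ?pOintMl ?gal_oint ?H ?rpredM.
  have -> : x * d + \sum_(t <- S) t x * c' t =
    - (\sum_(u <- r) u.1 * (x * (u.2 - s u.2) * d + \sum_(t <- S) t x * (t u.2 - s u.2) * c t))
    + p%:R * (w * x * d).
    rewrite -[x * d]mul1r {1}E1 mulrDl addrAC; congr (_ + _); last by ring.
    under [in RHS]eq_bigr do rewrite mulrDr mulr_sumr.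
    rewrite big_split /= opprD mulr_suml; congr (_ + _).
      by rewrite -sumrN; apply: eq_bigr => u _; ring.
    rewrite exchange_big -sumrN /=; apply: eq_bigr => t _.
    rewrite /c' mulrN mulr_sumr; congr (- _); apply: eq_bigr => u _; ring.
  rewrite rpredD ?rpredN ?pOint_p ?rpredM //.
  by rewrite big_seq; apply: rpred_sum => u ur; exact: step.
apply: (natl_pOint pp cop) => //.
apply: (elim_gal (enum (~: inertia p)) _ (fun t => t y)).
- by move=> s; rewrite mem_enum inE.
- by rewrite rpredM ?rpred_nat.
- by move=> s; rewrite gal_oint.
move=> x xo xf; have [z zE] := ytr x xo xf.
have -> : x * (#|inertia p|%:R * y) + \sum_(t <- enum (~: inertia p)) t x * t y = (trace (x * y))%:A.
  rewrite traceE // [in RHS](bigID (mem (inertia p))) /=; congr (_ + _).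
    rewrite mulrCA mulr_natl -sumr_const; apply: eq_bigr => t tI.
    by rewrite rmorphM /= xf // yf.
  rewrite big_enum /=; apply: eq_big => [t|t _]; by rewrite ?inE ?rmorphM.
by rewrite zE alg_int pOint_int // dvdz_mulr.
Qed.

Lemma nilp_fixedby p y : prime p -> coprime p #|inertia p| -> y \in nilp E p ->
  fixedby (inertia p) y -> y \in pOint E p.
Proof.
move=> pp cop yn yf; apply: (unramified_trace pp cop) => //; first exact: nilp_oint yn.
by move=> x xo xf; apply: trace_nilp => //; apply: nilpMl.
Qed.

(** * Unramified abelian extensions of the rationals *)

Section Minkowski.
Variables (C : numClosedFieldType) (j : {rmorphism E -> C}) (c : gal).
Hypothesis jc : forall x, j (c x) = (j x)^*.

Lemma embed_rat (q : rat) : j q%:A = ratr q.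
Proof. by rewrite rmorphZ_num rmorph1 mulr1. Qed.

Lemma embed_real x : c x = x -> j x \is Num.real.
Proof. by move=> cx; apply/CrealP; rewrite -jc cx. Qed.

Lemma embed_trace x : ratr (trace x) = \sum_(s : gal) j (s x).
Proof. by rewrite -embed_rat traceE // rmorph_sum. Qed.

Lemma trace_sqr_gt0 x : c x = x -> x != 0 -> 0 < trace (x * x).
Proof.
move=> cx x0; rewrite -(ltr0q C) embed_trace.
have sq s : 0 <= j (s (x * x)).
  by rewrite !rmorphM -expr2 /= -realEsqr embed_real // abel cx.
rewrite lt_def sumr_ge0 // andbT psumr_neq0 //; apply/hasP; exists 1%g; first exact: mem_index_enum.
by rewrite /= lt_def sq andbT gal_id fmorph_eq0 mulf_neq0.
Qed.

(** By the arithmetic-geometric mean inequality, as the norm of x is at least 1. *)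
Lemma trace_sqr_min x : x \in oint E -> c x = x -> x != 0 ->
  trace (x * x) <= (\dim {:E})%:R -> x * x = 1.
Proof.
move=> xo cx x0 tr_le.
pose F (s : gal) := j (s (x * x)).
have F0 s : 0 <= F s.
  by rewrite /F !rmorphM -expr2 /= -realEsqr embed_real // abel cx.
have n0 : (0 < #|{: gal}|)%N by rewrite (card_gal galE) adim_gt0.
have nC0 : 0 < #|{: gal}|%:R :> C by rewrite ltr0n.
have sumF : \sum_s F s = ratr (trace (x * x)) by rewrite embed_trace.
have [z zE] : exists z : int, \prod_(s : gal) s (x * x) = z%:~R.
  apply: (fixed_int galE); first by apply: rpred_prod => s _; rewrite gal_oint rpredM.
  move=> t; rewrite rmorph_prod [RHS](reindex_inj (mulIg t)) /=.
  by apply: eq_bigr => s _; rewrite galMx.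
have prodF : \prod_s F s = z%:~R by rewrite -rmorph_prod /= zE rmorph_int.
have z0 : z != 0.
  rewrite -(@intE_eq0 E) -zE; apply/prodf_neq0 => s _.
  by rewrite fmorph_eq0 mulf_neq0.
have prod_ge1 : 1 <= \prod_s F s.
  have : 0 <= \prod_s F s by apply: prodr_ge0.
  by rewrite prodF ler0z -[1]/(1%:~R) ler_int => zge; rewrite -gtz0_ge1 lt_def z0.
have [le_AGM eq_AGM] := @leif_AGM C gal predT F (in1W F0).
have mean_le1 : (\sum_s F s) / #|{: gal}|%:R <= 1.
  rewrite ler_pdivrMr // mul1r sumF (card_gal galE).
  by rewrite -[X in _ <= X](ratr_nat C) ler_rat.
have mean_ge0 : 0 <= (\sum_s F s) / #|{: gal}|%:R by rewrite divr_ge0 ?sumr_ge0 // ltW.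
have mean_X : ((\sum_s F s) / #|{: gal}|%:R) ^+ #|{: gal}| = 1.
  apply/eqP; rewrite eq_le exprn_ile1 //=.
  exact: le_trans prod_ge1 le_AGM.
have mean1 : (\sum_s F s) / #|{: gal}|%:R = 1.
  by apply/eqP; rewrite -(pexpr_eq1 n0 mean_ge0) mean_X.
have /forall_inP alleq : [forall i in predT, forall k in predT, F i == F k].
  rewrite -eq_AGM mean_X; apply/eqP/le_anti; rewrite prod_ge1 andbT.
  exact: le_trans le_AGM (exprn_ile1 _ mean_ge0 mean_le1).
have Fc s : F s = F 1%g by have /forall_inP/(_ s isT)/eqP -> := alleq 1%g isT.
apply: (fmorph_inj j); rewrite rmorph1 -mean1.
under eq_bigr do rewrite Fc.
by rewrite sumr_const -[F 1%g *+ _]mulr_natr mulfK ?gt_eqF // /F gal_id.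
Qed.

Section RealUnramified.
Variable B : {group gal}.
Hypothesis cB : c \in B.
Hypothesis tame_cop : forall p, prime p -> coprime p #|inertia p|.
Hypothesis inertiaB : forall p, prime p -> inertia p \subset B.
Let F := fixedField B.

Lemma fixed_subfieldP x : reflect (fixedby B x) (x \in F).
Proof. exact: (fixedFieldP (memvf x)). Qed.

Let M : {pred E} := fun x => (x \in oint E) && (x \in F).

(** The trace of the fixed field of B over Q, for arguments in that field. *)
Definition reltrace x : rat := trace x / #|B|%:R.

Let B0 : #|B|%:R != 0 :> rat. Proof. by rewrite pnatr_eq0 -lt0n cardG_gt0. Qed.

Lemma reltrace_int x : x \in oint E -> fixedby B x -> reltrace x \is a Num.int.
Proof.
move=> xo xf; apply: (@oint_rat E).
have -> : (reltrace x)%:A = \sum_(D in rcosets B [set: gal]) repr D x.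
  rewrite /reltrace mulrC -scalerA traceE //.
  have -> : \sum_(s : gal) s x = \sum_(D in rcosets B [set: gal]) \sum_(s in D) (s : gal) x.
    have /and3P[/eqP covE trivP _] := rcosets_partition (finset.subsetT B).
    have := @big_trivIset _ _ _ _ _ (fun s : gal => s x) trivP; rewrite covE => <-.
    by apply: eq_bigl => s; rewrite inE.
  rewrite scaler_sumr; apply: eq_bigr => D /rcosetsP[t _ ->].
  have st s : s \in (B :* t)%g -> s x = t x.
    by move=> /rcosetP[b bB ->]; rewrite galMx xf.
  rewrite (eq_bigr (fun=> t x)) // sumr_const card_rcoset -scaler_nat scalerA mulVf // scale1r.
  by rewrite st // mem_repr_rcoset.
by apply: rpred_sum => D _; rewrite gal_oint.
Qed.

Lemma reltraceM x y : fixedby B y -> reltrace ((\sum_(s in B) s x) * y) = trace (x * y).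
Proof.
move=> yf; have -> : (\sum_(s in B) s x) * y = \sum_(s in B) s (x * y).
  by rewrite mulr_suml; apply: eq_bigr => s sB; rewrite rmorphM /= yf.
rewrite /reltrace trace_sum // (eq_bigr (fun=> trace (x * y))) => [|s _].
  by rewrite sumr_const -[trace _ *+ _]mulr_natr mulfK.
by rewrite trace_gal.
Qed.

Lemma reltraceZ a x : reltrace (a *: x) = a * reltrace x.
Proof. by rewrite /reltrace traceZ // mulrA. Qed.

Lemma reltrace_sum n (f : 'I_n -> E) : reltrace (\sum_i f i) = \sum_i reltrace (f i).
Proof. by rewrite /reltrace trace_sum // mulr_suml. Qed.

Local Notation r := (\dim F).

Lemma dim_F : (r * #|B| = \dim {:E})%N.
Proof.
have := dim_fixedField B; rewrite -/F => ->.
by rewrite muln_divA ?field_dimS ?subvf // mulKn // adim_gt0.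
Qed.

Lemma reltrace1 : reltrace 1 = r%:R.
Proof. by rewrite /reltrace trace1 // -dim_F natrM mulfK. Qed.

Lemma F_basis : exists w : r.-tuple E, [/\ basis_of F w, {subset w <= M} &
  forall x, x \in M -> exists z : 'I_r -> int, x = \sum_i (z i)%:~R * w`_i].
Proof.
apply: (lattice_basis galE).
- by move=> x /andP[].
- by move=> x /andP[].
- split; first by rewrite unfold_in rpred0 mem0v.
  by move=> x y /andP[xo xF] /andP[yo yF]; rewrite unfold_in rpredB //= rpredB.
- move=> v vF; have [N N0 No] := oint_clear v; exists N => //.
  by rewrite unfold_in No /= mulr_natl rpredMn.
- exact: (trace_nondeg galE).
Qed.

(** No prime divides the determinant of the trace form of the fixed field F of B, by unramified_trace. If F
   had degree r > 1, adding the rank one form (Tr x) ^ 2 / r would double this determinant, and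
   2 < (1 + 1 / r) ^ r gives a nonzero integer x with Tr (x ^ 2) + (Tr x) ^ 2 / r < r + 1. Then
   Tr (x ^ 2) <= r forces x = 1 or x = - 1, for which the left side is 2 r. *)
Lemma real_unramified : B = [set: gal]%G.
Proof.
have [w [bw wM wE]] := F_basis.
have wi (i : 'I_r) : w`_i \in M by rewrite wM // mem_nth // size_tuple.
have wo i := proj1 (andP (wi i)); have wF i := proj2 (andP (wi i)).
pose H : 'M[rat]_r := \matrix_(i, k) reltrace (w`_i * w`_k).
pose vec (x : 'cV[rat]_r) := \sum_i x i 0 *: w`_i.
have vecF (x : 'cV[rat]_r) : vec x \in F by apply: rpred_sum => i _; rewrite rpredZ.
have bil (x y : 'cV[rat]_r) : (x^T *m H *m y) 0 0 = reltrace (vec x * vec y).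
  rewrite /vec mulr_suml reltrace_sum -mulmxA mxE; apply: eq_bigr => i _.
  rewrite mulr_sumr reltrace_sum !mxE mulr_sumr; apply: eq_bigr => k _.
  by rewrite mxE -scalerAl -scalerAr !reltraceZ; ring.
have quad (x : 'cV[rat]_r) := bil x x.
have vec0 (x : 'cV[rat]_r) : x != 0 -> vec x != 0.
  apply: contraNneq => v0; apply/eqP/colP => i; rewrite mxE.
  by have /freeP/(_ (fun i => x i 0) v0 i) := basis_free bw.
have cF x : x \in F -> c x = x by move=> /fixed_subfieldP; apply.
have HT : H^T = H by apply/matrixP => i k; rewrite !mxE mulrC.
have pH : posdef H.
  split=> // x x0; rewrite quad divr_gt0 ?trace_sqr_gt0 ?vec0 ?cF //.
  by rewrite ltr0n cardG_gt0.
have [Hz HzE] : exists Hz : 'M[int]_r, H = map_mx intr Hz.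
  exists (\matrix_(i, k) Num.floor (H i k)); apply/matrixP => i k; rewrite !mxE floorK //.
  by apply: reltrace_int; [rewrite rpredM | apply/fixed_subfieldP; rewrite rpredM].
have dHE : \det H = (\det Hz)%:~R by rewrite HzE det_map_mx.
have dH0 : 0 < \det Hz by rewrite -(ltr0z rat) -dHE posdef_det_gt0.
(* A null vector of the form modulo p would be an integer y outside p o all of whose traces are in p Z. *)
have npr p : prime p -> ~~ (p %| \det Hz)%Z.
  move=> pp; apply/negP => pd.
  have : \det (map_mx (intr : int -> 'F_p) Hz) = 0.
    rewrite det_map_mx /=; case/dvdzP: pd => q ->.
    by rewrite rmorphM /= -pmulrn pchar_Fp_0 // mulr0.
  move=> /eqP/det0P[v v0 vH].
  pose z (i : 'I_r) : int := (v 0 i : nat)%:Z.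
  have zv i : (z i)%:~R = v 0 i by rewrite /z -pmulrn natr_Zp.
  pose y := \sum_i (z i)%:~R * w`_i.
  have yo : y \in oint E by apply: rpred_sum => i _; rewrite rpredM ?intr_oint.
  have yF : y \in F by apply: rpred_sum => i _; rewrite rpredM // rpred_int.
  have yw (k : 'I_r) : exists q : int, reltrace (w`_k * y) = (p%:Z * q)%:~R.
    have -> : reltrace (w`_k * y) = (\sum_i z i * Hz i k)%:~R.
      rewrite /y mulr_sumr reltrace_sum rmorph_sum /=; apply: eq_bigr => i _.
      rewrite rmorphM /= -[(Hz i k)%:~R]/(intr _).
      have -> : (Hz i k)%:~R = H i k by rewrite HzE mxE.
      by rewrite mxE -alg_int mulr_algl -scalerAr reltraceZ mulrC [w`_k * _]mulrC; ring.
    have /dvdzP[q ->] : (p %| \sum_i z i * Hz i k)%Z.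
      have := congr1 (fun A : 'rV_r => A 0 k) vH; rewrite !mxE => vk.
      have : (\sum_i z i * Hz i k)%:~R = 0 :> 'F_p.
        rewrite rmorph_sum /= -[RHS]vk; apply: eq_bigr => i _.
        by rewrite rmorphM /= zv mxE.
      by move/eqP; rewrite Fp_int_eq0.
    by exists q; rewrite mulrC.
  have yM x : x \in M -> exists q : int, reltrace (x * y) = (p%:Z * q)%:~R.
    move=> /wE[a ->]; have /choice[q qE] := yw.
    exists (\sum_i a i * q i); rewrite mulr_suml reltrace_sum mulr_sumr rmorph_sum.
    apply: eq_bigr => i _; rewrite -alg_int mulr_algl -scalerAl reltraceZ qE -rmorphM /=.
    by congr _%:~R; ring.
  have yfB : fixedby B y by apply/fixed_subfieldP.
  have : y \in pOint E p.
    apply: (unramified_trace pp (tame_cop pp)) => //.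
      by move=> s sI; apply: yfB; apply: (fintype.subsetP (inertiaB pp)).
    move=> x xo xf; rewrite -reltraceM //; apply: yM; apply/andP; split.
      by apply: rpred_sum => s _; rewrite gal_oint.
    by apply/fixed_subfieldP; exact: sum_fixedby.
  rewrite pOintE => yp; have /wE[a aE] : y / p%:R \in M.
    by rewrite unfold_in yp /= rpred_div // rpred_nat.
  case/negP: v0; apply/eqP/rowP => i; rewrite [RHS]mxE -zv.
  have pE0 : p%:R != 0 :> E by rewrite natE_eq0 -lt0n prime_gt0.
  have y0 : \sum_i ((z i)%:~R - p%:R * (a i)%:~R : rat) *: w`_i = 0.
    under eq_bigr do rewrite scalerBl.
    rewrite sumrB; apply/eqP; rewrite subr_eq0; apply/eqP.
    transitivity y; first by apply: eq_bigr => k _; rewrite -mulr_algl alg_int.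
    rewrite -[y](divfK pE0) aE mulr_suml; apply: eq_bigr => k _.
    have := rmorphM (in_alg E) p%:R (a k)%:~R; rewrite /= alg_nat alg_int => aE'.
    by rewrite -[RHS]mulr_algl aE'; ring.
  have /freeP/(_ _ y0 i)/eqP := basis_free bw.
  rewrite subr_eq0 -[p%:R]/((p%:Z)%:~R) -intrM eqr_int => /eqP ->.
  by rewrite rmorphM /= -pmulrn pchar_Fp_0 // mul0r.
have dH1 : \det H = 1.
  rewrite dHE; have [n nE] : exists n : nat, \det Hz = n%:Z by exists `|\det Hz|%N; rewrite gtz0_abs.
  rewrite nE; have n0 : (0 < n)%N by rewrite -ltz_nat -nE.
  have [->//|n1] := eqVneq n 1%N.
  have /npr : prime (pdiv n) by rewrite pdiv_prime // ltn_neqAle eq_sym n1.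
  by rewrite nE dvdzE /= pdiv_dvd.
have r0 : (0 < r)%N by exact: adim_gt0.
have [r1|r1] := leqP r 1.
  apply/group_inj/eqP; rewrite eqEcard finset.subsetT cardsT (card_gal galE) -dim_F.
  by rewrite -[X in (_ <= X)%N]mul1n leq_mul2r r1 orbT.
exfalso; have [e eE] : exists e : 'cV[rat]_r, vec e = 1.
  exists (\col_i coord w i 1); rewrite [RHS](coord_basis bw (mem1v _)).
  by apply: eq_bigr => i _; rewrite mxE.
have rQ0 : r%:R != 0 :> rat by rewrite pnatr_eq0 -lt0n.
(* The form Tr (x ^ 2) + (Tr x) ^ 2 / r: v holds the coefficients of the linear form Tr. *)
pose v := H *m e; pose H' := H + r%:R^-1 *: (v *m v^T).
have vT : v^T = e^T *m H by rewrite /v trmx_mul HT.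
have quad' (x : 'cV[rat]_r) : (x^T *m H' *m x) 0 0 = reltrace (vec x * vec x) + reltrace (vec x) ^+ 2 / r%:R.
  rewrite /H' mulmxDr mulmxDl mxE quad; congr (_ + _).
  rewrite -scalemxAr -scalemxAl mxE mulrC; congr (_ / _).
  have -> : x^T *m (v *m v^T) *m x = (x^T *m v) *m (v^T *m x) by rewrite !mulmxA.
  rewrite mxE big_ord1 expr2; congr (_ * _).
    by rewrite /v mulmxA bil eE mulr1.
  by rewrite vT bil eE mul1r.
have pH' : posdef H'.
  split; first by rewrite /H' linearD linearZ /= trmx_mul trmxK HT.
  move=> x x0; rewrite quad' ltr_wpDr ?divr_ge0 ?sqr_ge0 ?ler0n //.
  by rewrite divr_gt0 ?trace_sqr_gt0 ?vec0 ?cF // ltr0n cardG_gt0.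
have dH' : \det H' = 2.
  have -> : H' = H *m (1%:M + (r%:R^-1 *: e) *m v^T).
    by rewrite mulmxDr mulmx1 mulmxA -scalemxAr -scalemxAl.
  rewrite det_mulmx dH1 mul1r det_1Dmul -scalemxAr mxE vT bil eE mulr1 reltrace1.
  by rewrite mulVf.
have b0 : 0 < 1 + r%:R^-1 :> rat by rewrite addr_gt0 // invr_gt0 ltr0n.
have [|x x0] := minkowski_form r0 pH' b0; first by rewrite dH' two_lt_pow.
rewrite quad' mulrDr mulr1 mulfV //; set X := vec _.
have XM : X \in M.
  rewrite unfold_in vecF andbT; apply: rpred_sum => i _.
  by rewrite mxE -mulr_algl alg_int rpredM ?intr_oint.
have [Xo XF] := andP XM; have Xf := fixed_subfieldP _ XF.
have X0 : X != 0.
  apply: vec0; apply: contra_neq x0 => /matrixP x0; apply/matrixP => i k.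
  by have := x0 i k; rewrite !mxE => /eqP; rewrite intr_eq0 => /eqP.
move=> lt_r1.
have X1 : X * X = 1.
  apply: trace_sqr_min => //; first exact: cF.
  have /intrP[q qE] : reltrace (X * X) \is a Num.int.
    by apply: reltrace_int; [rewrite rpredM | apply/fixed_subfieldP; rewrite rpredM].
  have : reltrace (X * X) <= r%:R.
    have : reltrace (X * X) < r%:R + 1.
      by apply: le_lt_trans lt_r1; rewrite lerDl divr_ge0 ?sqr_ge0 ?ler0n.
    by rewrite qE -[r%:R]/(r%:Z%:~R) -[1]/(1%:~R) -intrD ltr_int ltzD1 ler_int.
  by rewrite /reltrace ler_pdivrMr ?ltr0n ?cardG_gt0 // -natrM dim_F.
have trX : reltrace X ^+ 2 = r%:R ^+ 2.
  have /eqP : X ^+ 2 = 1 by rewrite expr2.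
  rewrite sqrf_eq1 => /orP[]/eqP ->; first by rewrite reltrace1.
  by rewrite -scaleN1r reltraceZ reltrace1 mulN1r sqrrN.
move: lt_r1; rewrite X1 reltrace1 trX expr2 mulfK // ltrD2l.
by rewrite ltrn1 ltnNge r0.
Qed.

End RealUnramified.
Lemma conj_involutive x : c (c x) = x.
Proof. by apply: (fmorph_inj j); rewrite !jc conjCK. Qed.

(** After the real case, only an imaginary quadratic fixed field Q(d), with d ^ 2 = - k and k minimal, could
   remain. A prime factor of k would be ramified, and k = 1 ramifies at 2. *)
Lemma unramified_rational (B : {group gal}) :
  (forall p, prime p -> coprime p #|inertia p|) ->
  (forall p, prime p -> inertia p \subset B) -> B = [set: gal]%G.
Proof.
move=> tame_cop inB; have [cB|cB] := boolP (c \in B); first exact: real_unramified.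
have B'T : (B <*> <[c]>)%G = [set: gal]%G.
  apply: real_unramified => //; first by rewrite mem_gen // inE cycle_id orbT.
  by move=> p pp; apply: fintype.subset_trans (inB p pp) _; exact: joing_subl.
have fixT x : fixedby B x -> c x = x -> forall s, s x = x.
  move=> xf cx s; have gS : group_set [set t : gal | t x == x].
    apply/group_setP; split=> [|t t']; rewrite !inE ?gal_id //.
    by move=> /eqP tx /eqP t'x; rewrite galMx tx t'x.
  have : (B <*> <[c]>)%G \subset Group gS.
    rewrite join_subG cycle_subG inE cx eqxx andbT.
    by apply/fintype.subsetP => t tB; rewrite inE xf.
  by rewrite B'T => /fintype.subsetP/(_ s); rewrite !inE => /(_ isT)/eqP.
pose Q k := `[< (0 < k)%N /\ exists d, [/\ d \in oint E, fixedby B d, c d = - d & d ^+ 2 = - k%:R] >].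
have exQ : exists k, Q k.
  have [x xf cx] : exists2 x, fixedby B x & c x != x.
    apply: contrapT => H; case/negP: cB.
    rewrite -(gal_fixedField B) gal_kHom ?subvf //; apply/kHomP_tmp; split.
      by move=> x xF; apply: contrapT => /eqP cx; apply: H; exists x => //; apply/fixed_subfieldP.
    by move=> x y _ _; rewrite rmorphM.
  have [N N0 No] := oint_clear x.
  pose d := N%:R * (x - c x).
  have d_o : d \in oint E.
    have -> : d = N%:R * x - c (N%:R * x) by rewrite rmorphM rmorph_nat /= /d mulrBr.
    by rewrite rpredB // gal_oint.
  have df : fixedby B d.
    by move=> s sB; rewrite /d rmorphM rmorph_nat rmorphB /= abel !(xf s sB).
  have cd : c d = - d by rewrite /d rmorphM rmorph_nat rmorphB /= conj_involutive -mulrN opprB.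
  have d0 : d != 0 by rewrite mulf_neq0 ?natE_eq0 -?lt0n // subr_eq0 eq_sym.
  have [z zE] : exists z : int, d ^+ 2 = z%:~R.
    apply: (fixed_int galE); first exact: rpredX.
    by apply: fixT; [move=> s sB; rewrite rmorphXn /= df | rewrite rmorphXn /= cd sqrrN].
  have jd : (j d) ^+ 2 = - (`|j d| ^+ 2).
    by rewrite normCK -jc cd rmorphN mulrN opprK expr2.
  have z0 : z < 0.
    rewrite -(ltrz0 C) -(rmorph_int j) -zE rmorphXn /= jd oppr_lt0 exprn_gt0 // normr_gt0.
    by rewrite fmorph_eq0.
  exists `|z|%N; apply/asboolP; split; first by rewrite absz_gt0 lt_eqF.
  by exists d; split=> //; rewrite zE pmulrn ltz0_abs // rmorphN opprK.
case: (ex_minnP exQ) => k /asboolP[k0 [d [d_o df cd d2]]] kmin.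
have nilp_d p : prime p -> d \in nilp E p -> d \in pOint E p.
  move=> pp dn; apply: nilp_fixedby => //; first exact: tame_cop.
  by move=> s sI; apply: df; apply: (fintype.subsetP (inB p pp)).
(* Otherwise d / p contradicts the minimality of k for p a prime factor of k. *)
have k1 : k = 1%N.
  apply/eqP; rewrite eqn_leq k0 andbT leqNgt; apply/negP => k1.
  have pp := pdiv_prime k1; set p := pdiv k in pp; have p0 := prime_gt0 pp.
  have [q kE] : exists q, k = (q * p)%N by apply/dvdnP; exact: pdiv_dvd.
  have : d \in pOint E p.
    apply: nilp_d => //; apply: (@nilp_root E p d 2) => //; apply: pOint_nilp => //.
    by rewrite d2 rpredN kE natrM mulrC pOint_p ?rpred_nat.
  rewrite pOintE; set e := d / p%:R => eo.
  have pE0 : p%:R != 0 :> E by rewrite natE_eq0 -lt0n.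
  have e2 : e ^+ 2 = (- (k%:R / p%:R ^+ 2) : rat)%:A.
    rewrite /e expr_div_n d2 scaleNr mulNr; congr (- _).
    have := fmorph_div (in_alg E) k%:R (p%:R ^+ 2); rewrite rmorphXn /=.
    by rewrite !alg_nat.
  have : (- (k%:R / p%:R ^+ 2) : rat) \is a Num.int by apply: (@oint_rat E); rewrite -e2 rpredX.
  rewrite rpredN => /intrP[z zE].
  have zk : k%:Z = z * p%:Z ^+ 2.
    apply: (@intr_inj rat); rewrite rmorphM rmorphXn /= -zE divfK //.
    by rewrite expf_neq0 // pnatr_eq0 -lt0n.
  have z0 : 0 < z.
    have := k0; rewrite -ltz_nat zk pmulr_lgt0 // exprn_gt0 //.
  have /kmin : Q `|z|%N.
    apply/asboolP; split; first by rewrite absz_gt0 gt_eqF.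
    exists e; split=> //.
    - by move=> s sB; rewrite /e fmorph_div rmorph_nat /= df.
    - by rewrite /e fmorph_div rmorph_nat /= cd mulNr.
    - by rewrite e2 zE scaleNr alg_int pmulrn gtz0_abs.
  rewrite leqNgt -ltz_nat gtz0_abs // zk ltr_pMr //.
  by rewrite exprn_egt1 // ltz_nat prime_gt1.
have d2' : d ^+ 2 = - 1 by rewrite d2 k1.
(* Now d is a square root of - 1, and (1 + d) / 2 has fourth power - 1 / 4. *)
have sq : (1 + d) ^+ 2 = 2%:R * d by rewrite sqrrD expr1n d2' mul1r mulr2n; ring.
have h_o : 1 + d \in pOint E 2.
  apply: nilp_fixedby => //; first exact: tame_cop.
    apply: (@nilp_root E 2 (1 + d) 2); first by rewrite rpredD ?rpred1.
    by apply: pOint_nilp => //; rewrite sq pOint_p.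
  move=> s sI; rewrite rmorphD rmorph1 /= df //.
  by apply: (fintype.subsetP (inB 2 isT)).
have : ((1 + d) / 2%:R) ^+ 4 \in oint E by rewrite rpredX.
have -> : ((1 + d) / 2%:R) ^+ 4 = (- (4%:R^-1) : rat)%:A.
  rewrite expr_div_n -[4%N]/(2 * 2)%N exprM sq exprMn d2' scaleNr.
  have := fmorphV (in_alg E) 4%:R; rewrite /= alg_nat => ->.
  by field; rewrite ?natE_eq0.
by move=> /oint_rat; rewrite rpredN Qint_def -[4%:R]/(4%:Z%:~R) denqVz.
Qed.

End Minkowski.
End Inertia.

(** * Embeddings of number fields *)

Section Embedding.
Variable K : fieldExtType rat.
Let t := separable_generator 1 {:K}.

Lemma numfield_generator (x : K) : exists p : {poly rat}, (map_poly (in_alg K) p).[t] = x.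
Proof.
have xt : x \in <<1; t>>%VS.
  rewrite -eq_adjoin_separable_generator ?memvf ?sub1v //.
  apply/separableP=> y _; apply: (@pcharf0_separable _ _ 1%AS) => k.
  by rewrite pchar_lalg; exact: pchar_num.
have /polyOver1P[p pE] := Fadjoin_polyOver 1 t x.
by exists p; rewrite -pE Fadjoin_poly_eq.
Qed.

Lemma rat_morph_eq (F : fieldType) (f g : {rmorphism K -> F}) (q : rat) : f q%:A = g q%:A.
Proof.
have e (h : {rmorphism K -> F}) := fmorph_eq_rat (h \o in_alg K).
by have := e f q; have := e g q; rewrite /= => -> ->.
Qed.

Lemma morph_gen_eq (F : fieldType) (f g : {rmorphism K -> F}) : f t = g t -> f =1 g.
Proof.
move=> fg x; have [p <-] := numfield_generator x.
rewrite -!horner_map fg -!map_poly_comp /=; congr (_.[_]).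
by apply: eq_map_poly => q; exact: rat_morph_eq.
Qed.

(** The polynomial q is the minimal polynomial of the generator, so evaluation at z is well defined. *)
Lemma embed_exists (F : fieldType) (iota : {rmorphism rat -> F}) (q : {poly rat}) (z : F) :
  minPoly 1 t = map_poly (in_alg K) q -> root (map_poly iota q) z ->
  exists f : {rmorphism K -> F}, f t = z.
Proof.
move=> qE qz.
have key (a b : {poly rat}) : (map_poly (in_alg K) a).[t] = (map_poly (in_alg K) b).[t] ->
    (map_poly iota a).[z] = (map_poly iota b).[z].
  move=> ab; have : root (map_poly (in_alg K) (a - b)) t.
    by rewrite rootE rmorphB hornerD hornerN ab subrr.
  move=> rt; have : minPoly 1 t %| map_poly (in_alg K) (a - b).
    by apply: minPoly_dvdp rt; apply/polyOver1P; exists (a - b).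
  rewrite qE dvdp_map => /dvdpP[c cE].
  apply/eqP; rewrite -subr_eq0 -hornerN -hornerD -rmorphB cE rmorphM hornerM.
  by rewrite (rootP qz) mulr0.
have /choice[P PE] := numfield_generator.
pose f x := (map_poly iota (P x)).[z].
have fB : zmod_morphism f.
  move=> x y; rewrite /f -hornerN -hornerD -rmorphB; apply: key.
  by rewrite rmorphB hornerD hornerN !PE.
have fM : monoid_morphism f.
  split=> [|x y]; rewrite /f.
    rewrite -[RHS](hornerC 1 z) -[1%:P](rmorph1 (map_poly iota)); apply: key.
    by rewrite PE rmorph1 hornerC.
  rewrite -hornerM -rmorphM; apply: key.
  by rewrite rmorphM hornerM !PE.
pose fa := GRing.isZmodMorphism.Build K F f fB.
pose fm := GRing.isMonoidMorphism.Build K F f fM.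
exists (HB.pack_for {rmorphism K -> F} f fa fm); rewrite /= /f.
rewrite -[RHS](hornerX z) -(map_polyX iota); apply: key.
by rewrite PE map_polyX hornerX.
Qed.

Lemma closed_embed_exists (C : numClosedFieldType) : exists f : {rmorphism K -> C}, True.
Proof.
have /polyOver1P[q qE] := minPolyOver 1 t.
have [r rE] := closed_field_poly_normal (map_poly (ratr : rat -> C) q).
have [z zr] : exists z, root (map_poly (ratr : rat -> C) q) z.
  apply/closed_rootP; rewrite size_map_poly -(size_map_poly (in_alg K)) -qE.
  by rewrite size_minPoly eqSS -lt0n adjoin_degreeE divn_gt0 ?adim_gt0 // dimvS ?subv_adjoin.
by have [f _] := embed_exists qE zr; exists f.
Qed.
End Embedding.

Lemma morph_alg (K E : fieldExtType rat) (f : {rmorphism K -> E}) (q : rat) : f q%:A = q%:A.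
Proof. exact: etrans (fmorph_eq_rat (f \o in_alg K) q) (esym (fmorph_eq_rat (in_alg E) q)). Qed.

Section NormalEmbedding.
Variable K : splittingFieldType rat.
Hypothesis galK : galois 1 {:K}.
Local Notation gal := (gal_of {:K}).
Let t := separable_generator 1 {:K}.

Lemma galpoly_rat (x : K) : exists q : {poly rat}, map_poly (in_alg K) q = galpoly x.
Proof.
have /choice[c cE] i : exists q : rat, (galpoly x)`_i = q%:A.
  by apply: (gal_fixedP galK) => s; rewrite -{2}(galpoly_fix s x) coef_map.
exists (\poly_(i < size (galpoly x)) c i); apply/polyP => i; rewrite coef_map coef_poly /=.
by case: ltnP => li; [rewrite cE | rewrite scale0r nth_default].
Qed.

(** A normal extension has only one image in a field. *)
Lemma morph_conj (F : fieldType) (f g : {rmorphism K -> F}) :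
  exists s : gal, forall x, g x = f (s x).
Proof.
have [q qE] := galpoly_rat t.
have gt : root (map_poly f (galpoly t)) (g t).
  have -> : map_poly f (galpoly t) = map_poly g (galpoly t).
    by apply/polyP => i; rewrite -qE !coef_map /=; exact: rat_morph_eq.
  by rewrite fmorph_root galpoly_root.
move: gt; rewrite /galpoly rmorph_prod /= rootE horner_prod prodf_seq_eq0 => /hasP[s _].
rewrite rmorphB /= map_polyX map_polyC /= hornerXsubC subr_eq0 => /eqP gs.
exists s => x; exact: (morph_gen_eq (f := g) (g := f \o s) gs).
Qed.
End NormalEmbedding.

(** * Adjoining roots of unity *)

Section Compositum.
Variable K : splittingFieldType rat.
Hypothesis galK : galois 1 {:K}.

Lemma galois_char0 (E : splittingFieldType rat) : galois 1 {:E}.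
Proof.
rewrite /galois sub1v normalFieldf andbT.
apply/separableP => y _; apply: (@pcharf0_separable _ _ 1%AS) => k.
by rewrite pchar_lalg; exact: pchar_num.
Qed.

Lemma splitting_compositum n (q : {poly rat}) : (0 < n)%N -> q != 0 ->
  exists (E : splittingFieldType rat) (w : E) (r : seq E),
  [/\ n.-primitive_root w, <<1 & w :: r>>%VS = {:E}%VS &
      map_poly (in_alg E) q %= \prod_(y <- r) ('X - y%:P)].
Proof.
move=> n0 q0; have [z zn] := C_prim_root_exists n0.
have [l lE] := closed_field_poly_normal (map_poly (ratr : rat -> algC) q).
have [Q [QC [r rE genQ]]] := num_field_exists (z :: l).
case: r rE genQ => [//|w r] [wz rE] genQ.
have wn : n.-primitive_root w by rewrite -(fmorph_primitive_root QC) wz.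
have qr : map_poly (in_alg Q) q %= \prod_(y <- r) ('X - y%:P).
  rewrite -(eqp_map QC) -map_poly_comp rmorph_prod /=.
  have -> : map_poly (QC \o in_alg Q) q = map_poly (ratr : rat -> algC) q.
    by apply: eq_map_poly => a /=; rewrite rmorphZ_num rmorph1 mulr1.
  rewrite lE (eqp_ltrans (eqp_scale _ _)) ?lead_coef_eq0 ?map_poly_eq0 //.
  rewrite -rE big_map; apply/eqpW; apply: eq_bigr => y _.
  by rewrite rmorphB /= map_polyX map_polyC.
pose rw := [seq w ^+ (val i) | i : 'I_n].
have Dr : 'X^n - 1 = \prod_(y <- rw) ('X - y%:P).
  by rewrite -(factor_Xn_sub_1 wn) big_mkord big_image.
have Qax : splitting_field_axiom Q.
  exists (('X^n - 1) * map_poly (in_alg Q) q).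
    rewrite rpredM ?rpredB ?rpred1 ?rpredX ?polyOverX //.
    by apply/polyOver1P; exists q.
  exists (rw ++ r); first by rewrite Dr big_cat eqp_mull.
  apply/eqP; rewrite eqEsubv subvf -genQ; apply/Fadjoin_seqP; split; first exact: subv_adjoin_seq.
  move=> y; rewrite inE => /orP[/eqP->|yr]; apply: seqv_sub_adjoin; rewrite mem_cat; last by rewrite yr orbT.
  by rewrite -root_prod_XsubC -Dr; apply/orP; left; apply/unity_rootP/prim_expr_order.
by exists (HB.pack_for (splittingFieldType rat) Q (FieldExt_isSplittingField.Build _ Q Qax)), w, r.
Qed.

(** The field K(w): the splitting field of 'X ^ n - 1 and of the characteristic polynomial of a generator of
   K, so that an automorphism is determined by its values on K and on w. *)
Lemma cyclotomic_compositum n : (0 < n)%N -> exists (E : splittingFieldType rat)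
   (iota : {rmorphism K -> E}) (w : E), n.-primitive_root w /\
   forall s : gal_of {:E}, (forall x, s (iota x) = iota x) -> s w = w -> s = 1%g.
Proof.
move=> n0; pose t := separable_generator 1 {:K}.
have [q qE] := galpoly_rat galK t.
have q0 : q != 0.
  rewrite -(map_poly_eq0 (in_alg K)) qE; apply/monic_neq0/monic_prod => s _.
  exact: monicXsubC.
have [E [w [r [wn genE qr]]]] := splitting_compositum n0 q0.
have /polyOver1P[m mE] := minPolyOver 1 t.
have [y yr ym] : exists2 y, y \in r & root (map_poly (in_alg E) m) y.
  have mq : m %| q.
    rewrite -(dvdp_map (in_alg K)) -mE; apply: minPoly_dvdp; first by apply/polyOver1P; exists q.
    by rewrite qE galpoly_root.
  have : map_poly (in_alg E) m %| \prod_(y <- r) ('X - y%:P) by rewrite -(eqp_dvdr _ qr) dvdp_map.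
  move=> /dvdp_prod_XsubC[mask eqm].
  have : size (map_poly (in_alg E) m) != 1%N.
    rewrite size_map_poly -(size_map_poly (in_alg K)) -mE size_minPoly eqSS -lt0n.
    by rewrite adjoin_degreeE divn_gt0 ?adim_gt0 // dimvS ?subv_adjoin.
  rewrite (eqp_size eqm) size_prod_XsubC eqSS size_eq0.
  case ml : (seq.mask mask r) => [|y l] // _; exists y.
    by apply: (mem_mask (m := mask)); rewrite ml mem_head.
  by rewrite (eqp_root eqm) ml big_cons rootM root_XsubC eqxx.
have [iota iota_t] := embed_exists mE ym.
exists E, iota, w; split=> // s s_iota sw.
have s_r x : x \in r -> s x = x.
  rewrite -root_prod_XsubC -(eqp_root qr).
  have -> : map_poly (in_alg E) q = map_poly iota (galpoly t).
    by rewrite -qE -map_poly_comp; apply: eq_map_poly => a /=; rewrite morph_alg.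
  rewrite /galpoly rmorph_prod /= rootE horner_prod prodf_seq_eq0 => /hasP[u _].
  rewrite rmorphB /= map_polyX map_polyC /= hornerXsubC subr_eq0 => /eqP ->.
  exact: s_iota.
have full : (<<1 & w :: r>> <= fixedField [set s])%VS.
  apply/Fadjoin_seqP; split; first exact: sub1v.
  move=> x; rewrite inE => xwr; apply/fixedFieldP => [|u]; first exact: memvf.
  rewrite inE => /eqP ->; case/orP: xwr => [/eqP ->//|]; exact: s_r.
apply/eqP/gal_eqP => x _; rewrite gal_id.
have xw : x \in <<1 & w :: r>>%VS by rewrite genE memvf.
have /(fixedFieldP (memvf x)) := subvP full x xw; apply.
by rewrite inE.
Qed.

End Compositum.

Section Restriction.
Variables (K E : splittingFieldType rat) (iota : {rmorphism K -> E}).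
Hypothesis galK : galois 1 {:K}.

Lemma res_exists (s : gal_of {:E}) : exists u : gal_of {:K}, forall x, s (iota x) = iota (u x).
Proof. exact: (morph_conj galK iota (s \o iota)). Qed.

Definition res (s : gal_of {:E}) : gal_of {:K} := proj1_sig (cid (res_exists s)).

Lemma resE (s : gal_of {:E}) x : s (iota x) = iota (res s x).
Proof. exact: (proj2_sig (cid (res_exists s))). Qed.

Lemma resM s t : res (s * t)%g = (res s * res t)%g.
Proof.
apply/eqP/gal_eqP => x _; apply: (fmorph_inj iota).
by rewrite -resE !galMx !resE.
Qed.

Lemma res_oint x : (iota x \in oint E) = (x \in oint K).
Proof.
apply/ointP/ointP => -[p mp rp]; exists p => //; move: rp.
  have -> : map_poly (intr : int -> E) p = map_poly iota (map_poly intr p).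
    by apply/polyP => i; rewrite !coef_map /= rmorph_int.
  by rewrite fmorph_root.
have -> : map_poly (intr : int -> E) p = map_poly iota (map_poly intr p).
  by apply/polyP => i; rewrite !coef_map /= rmorph_int.
by rewrite fmorph_root.
Qed.

Lemma res_nilp p x : iota x \in nilp E p -> x \in nilp K p.
Proof.
move=> /nilpP[xo [k xk]]; apply/nilpP; split; first by rewrite -res_oint.
exists k; rewrite pOintE -res_oint fmorph_div rmorphXn rmorph_nat //.
Qed.

Lemma res_inertia p s : s \in inertia E p -> res s \in inertia K p.
Proof.
move=> /inertiaP sI; apply/inertiaP => x xo; apply: res_nilp.
by rewrite rmorphB -resE sI // res_oint.
Qed.

(** The fixed field of the image consists of rationals, so the image is everything by Galois theory. *)
Lemma res_onto u : exists s, res s = u.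
Proof.
have galE := galois_char0 E.
have gR : group_set [set res s | s : gal_of {:E}].
  apply/group_setP; split.
    apply/imsetP; exists 1%g => //; apply/eqP/gal_eqP => x _; rewrite gal_id.
    by apply: (fmorph_inj iota); rewrite -resE gal_id.
  by move=> _ _ /imsetP[s _ ->] /imsetP[t _ ->]; rewrite -resM; apply/imsetP; exists (s * t)%g.
have fR : fixedField (Group gR) = 1%VS :> {vspace K}.
  apply/eqP; rewrite eqEsubv sub1v andbT; apply/subvP => x /(fixedFieldP (memvf x)) xf.
  have [q qE] : exists q, iota x = q%:A.
    apply: (gal_fixedP galE) => s; rewrite resE xf //.
    by apply/imsetP; exists s.
  apply/vlineP; exists q; apply: (fmorph_inj iota).
  by rewrite qE morph_alg.
have := gal_fixedField (Group gR); rewrite fR => eR.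
have : u \in 'Gal({:K} / 1)%g by exact: mem_gal.
by rewrite eR => /imsetP[s _ ->]; exists s.
Qed.
End Restriction.

(** * Cyclotomic structure *)

Lemma prod_prime_dvd (r : seq nat) t : uniq r -> (forall p, p \in r -> prime p) ->
  (forall p, p \in r -> (p %| t)%N) -> (\prod_(p <- r) p %| t)%N.
Proof.
elim: r => [|p r IH] /= ; first by rewrite big_nil dvd1n.
move=> /andP[pr ur] rp rt; rewrite big_cons Gauss_dvd.
  rewrite rt ?mem_head // IH // => q qr; [apply: rp | apply: rt]; rewrite in_cons qr orbT //.
rewrite big_seq_cond; elim/big_ind: _ => [|a b ca cb|q /andP[qr _]].
- exact: coprimen1.
- by rewrite coprimeMr ca.
- rewrite prime_coprime ?rp ?mem_head // dvdn_prime2 ?rp ?mem_head // ?in_cons ?qr ?orbT //.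
  by apply: contraNneq pr => ->.
Qed.

Section Cyclotomic.
Variable E : splittingFieldType rat.
Hypothesis galE : galois 1 {:E}.
Local Notation gal := (gal_of {:E}).
Implicit Types (s t : gal) (x y : E).

Lemma root1_oint n x : (0 < n)%N -> x ^+ n = 1 -> x \in oint E.
Proof.
move=> n0 xn; apply/ointP; exists ('X^n - 1); first exact: monicXnsubC.
by rewrite rmorphB rmorph1 /= map_polyXn rootE !hornerE xn subrr.
Qed.

(** Modulo p, (1 - x) ^ p is 1 - x ^ p = 0. *)
Lemma one_sub_root_nilp p x : prime p -> x ^+ p = 1 -> 1 - x \in nilp E p.
Proof.
move=> pp xp; have xo := root1_oint (prime_gt0 pp) xp.
have x1o : 1 - x \in oint E by rewrite rpredB ?rpred1.
apply/nilpP; split=> //; exists p.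
have := pOint_binom pp x1o xo; rewrite subrK expr1n xp.
by rewrite opprD addrCA subrr addr0 rpredN.
Qed.

(** If x is not 1, the powers of x sum to 0, and each of them is congruent to 1, so that q lies in the
   radical of p. *)
Lemma one_sub_root_notin p q x : prime p -> prime q -> p != q -> x ^+ q = 1 ->
  1 - x \in nilp E p -> x = 1.
Proof.
move=> pp qp pq xq xn; apply: contrapT => /eqP x1; case/negP: pq.
have xo := root1_oint (prime_gt0 qp) xq.
have sum0 : \sum_(i < q) x ^+ i = 0.
  have := subrX1 x q; rewrite xq subrr => /esym/eqP.
  by rewrite mulf_eq0 subr_eq0 (negPf x1) => /eqP.
have : (q%:Z)%:~R \in nilp E p.
  have -> : (q%:Z)%:~R = \sum_(i < q) (1 - x ^+ i) :> E.
    by rewrite sumrB sum0 subr0 sumr_const card_ord -pmulrn.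
  apply: rpred_sum => i _; rewrite -(expr1n _ i) subrXX mulrC nilpMl // rpred_sum // => k _.
  by rewrite expr1n mul1r rpredX.
by move/(nilp_int pp); rewrite dvdzE /= dvdn_prime2.
Qed.

Lemma gal_root n (z : E) s : n.-primitive_root z -> exists2 k : 'I_n, coprime k n & s z = z ^+ k.
Proof.
move=> zn; have szn : s z ^+ n = 1 by rewrite -rmorphXn /= prim_expr_order // rmorph1.
have [k kE] := prim_rootP zn szn; exists k => //.
by rewrite -(prim_root_exp_coprime _ zn) -kE fmorph_primitive_root.
Qed.

(** Irreducibility of the cyclotomic polynomial. *)
Lemma gal_root_trans n (z : E) k : n.-primitive_root z -> coprime k n ->
  exists s : gal, s z = z ^+ k.
Proof.
move=> zn ck; have n0 := prim_order_gt0 zn.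
have [j _] := closed_embed_exists E algC.
have [q qE] := galpoly_rat galE z.
have qj : map_poly (ratr : rat -> algC) q = map_poly j (galpoly z).
  by apply/polyP => i; rewrite -qE !coef_map /= rmorphZ_num rmorph1 mulr1.
have jzn : n.-primitive_root (j z) by rewrite fmorph_primitive_root.
have [q0 [q0E _] q0P] := minCpolyP (j z).
have : root (map_poly ratr q) (j (z ^+ k)).
  have /dvdpP[r ->] : q0 %| q by rewrite -q0P qj fmorph_root galpoly_root.
  rewrite rmorphM rootM /= -q0E (minCpoly_cyclotomic jzn) (root_cyclotomic jzn).
  by rewrite rmorphXn /= prim_root_exp_coprime // ck orbT.
rewrite qj fmorph_root /galpoly rootE horner_prod prodf_seq_eq0 => /hasP[s _].
by rewrite hornerXsubC subr_eq0 => /eqP e; exists s.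
Qed.

Hypothesis abel : forall s t x, s (t x) = t (s x).
Variables (S : seq nat) (zeta : nat -> E).
Hypothesis S_uniq : uniq S.
Hypothesis S_prime : forall p, p \in S -> prime p.
Hypothesis zetaP : forall p, p \in S -> p.-primitive_root (zeta p).
Hypothesis cop : forall p, prime p -> coprime p #|inertia E p|.
Hypothesis unr : forall p, prime p -> p \notin S -> inertia E p = [set 1%g].
Variables (C : numClosedFieldType) (j : {rmorphism E -> C}) (c : gal).
Hypothesis jc : forall x, j (c x) = (j x)^*.

Lemma zeta_neq0 p : p \in S -> zeta p != 0.
Proof. move=> pS; apply/eqP => z0; move: (prim_expr_order (zetaP pS)).
by rewrite z0 expr0n gtn_eqF ?prime_gt0 ?S_prime // => /esym/eqP; rewrite oner_eq0. Qed.

Lemma zetaX p : p \in S -> zeta p ^+ p = 1.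
Proof. by move=> /zetaP/prim_expr_order. Qed.

Lemma inertia_fix p q s : prime p -> q \in S -> p != q -> s \in inertia E p ->
  s (zeta q) = zeta q.
Proof.
move=> pp qS pq /inertiaP sI; have qp := S_prime qS; have z0 := zeta_neq0 qS.
have zo : zeta q \in oint E by exact: root1_oint (prime_gt0 qp) (zetaX qS).
suff : s (zeta q) / zeta q = 1 by move=> /(congr1 ( *%R^~ (zeta q))); rewrite mulfVK // mul1r.
apply: (one_sub_root_notin pp qp pq).
  by rewrite expr_div_n -rmorphXn /= zetaX // rmorph1 divr1.
have -> : 1 - s (zeta q) / zeta q = - (zeta q ^+ q.-1 * (s (zeta q) - zeta q)).
  have -> : zeta q ^+ q.-1 = (zeta q)^-1.
    by apply: (mulfI z0); rewrite -exprS prednK ?prime_gt0 // zetaX // divff.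
  by rewrite mulrBr mulVf // opprB [X in _ = 1 - X]mulrC.
by rewrite rpredN nilpMl ?rpredX ?sI.
Qed.

Local Notation I p := (inertia_group E p).

Definition inertia_prod (s : seq nat) : {group gal} := (\prod_(p <- s) I p)%G.

Lemma abelM s t : (s * t)%g = (t * s)%g.
Proof. by apply/eqP/gal_eqP => x _; rewrite !galMx abel. Qed.

Lemma abel_norm (A B : {set gal}) : A \subset 'N(B)%g.
Proof.
apply/fintype.subsetP => s _; rewrite inE; apply/fintype.subsetP => _ /imsetP[t tB ->].
by rewrite /conjg abelM -mulgA mulgV mulg1.
Qed.

Lemma inertia_prod_cons p (r : seq nat) :
  inertia_prod (p :: r) = (inertia E p * inertia_prod r)%g :> {set gal}.
Proof. by rewrite /inertia_prod big_cons /= norm_joinEl // abel_norm. Qed.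

Lemma inertia_prod_rem p (r : seq nat) : p \in r ->
  inertia_prod r = (inertia E p * inertia_prod (rem p r))%g :> {set gal}.
Proof.
by move=> pr; rewrite -inertia_prod_cons /inertia_prod (perm_big _ (perm_to_rem pr)).
Qed.

(** The inertia groups generate the Galois group since Q has no unramified abelian extension. *)
Lemma inertia_prodT : inertia_prod S = [set: gal]%G.
Proof.
apply: (unramified_rational galE abel jc cop) => p pp.
have [pS|pS] := boolP (p \in S); last by rewrite unr // sub1G.
by rewrite (inertia_prod_rem pS) mulG_subl.
Qed.

Lemma inertia_prod_fix (r : seq nat) q t : {subset r <= S} -> q \in S -> q \notin r ->
  t \in inertia_prod r -> t (zeta q) = zeta q.
Proof.
move=> + qS; elim: r t => [|p r IH] t rS.
  by rewrite /inertia_prod big_nil => _ /set1gP ->; rewrite gal_id.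
rewrite in_cons negb_or => /andP[qp qr].
rewrite inertia_prod_cons => /imset2P[u v uI vI ->].
have [pS rS'] : p \in S /\ {subset r <= S}.
  by split=> [|k kr]; apply: rS; rewrite in_cons ?eqxx ?kr ?orbT.
rewrite galMx (inertia_fix _ qS _ uI) ?S_prime // 1?eq_sym //.
exact: IH.
Qed.

(** The whole group is transitive on the primitive p-th roots of unity, and only the factor at p moves them. *)
Lemma inertia_trans p k : p \in S -> coprime k p ->
  exists2 s, s \in inertia E p & s (zeta p) = zeta p ^+ k.
Proof.
move=> pS ck; have [t tz] := gal_root_trans (zetaP pS) ck.
have : t \in inertia_prod S by rewrite inertia_prodT inE.
rewrite (inertia_prod_rem pS) => /imset2P[u v uI vI e].
exists u => //; rewrite -tz e galMx abel (inertia_prod_fix _ pS _ vI) //.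
  by move=> q /mem_rem.
by rewrite mem_rem_uniqF.
Qed.

(** The inertia group at p has at most p - 1 elements and is transitive on p - 1 roots: the action is simply
   transitive. This is where the Galois group of the compositum is identified as a product of the unit
   groups of the fields F_p. *)
Lemma inertia_param p : p \in S -> exists g : 'I_p.-1 -> gal,
  [/\ injective g, inertia E p = [set g i | i in 'I_p.-1] & forall i, g i (zeta p) = zeta p ^+ i.+1].
Proof.
move=> pS; have pp := S_prime pS; have p0 := prime_gt0 pp.
have lt (i : 'I_p.-1) : (i.+1 < p)%N by rewrite -[X in (_ < X)%N](prednK p0) ltnS.
have ex (i : 'I_p.-1) : exists s : gal, s \in inertia E p /\ s (zeta p) = zeta p ^+ i.+1.
  have [|s sI sz] := @inertia_trans p i.+1 pS; last by exists s.
  by rewrite coprime_sym prime_coprime // gtnNdvd.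
have [g gP] := choice ex; exists g.
have gi : injective g.
  move=> i k e; apply: val_inj; apply: succn_inj; apply/eqP.
  have := eq_prim_root_expr (zetaP pS) i.+1 k.+1.
  by rewrite -(proj2 (gP i)) e (proj2 (gP k)) eqxx !modn_small // => /esym.
split=> // [|i]; last by case: (gP i).
apply/esym/eqP; rewrite eqEcard card_imset // card_ord inertia_card ?cop // andbT.
by apply/fintype.subsetP => _ /imsetP[i _ ->]; case: (gP i).
Qed.

Lemma inertia_inj p s t : p \in S -> s \in inertia E p -> t \in inertia E p ->
  s (zeta p) = t (zeta p) -> s = t.
Proof.
move=> pS; have [g [_ -> gz]] := inertia_param pS; have p0 := prime_gt0 (S_prime pS).
have lt (i : 'I_p.-1) : (i.+1 < p)%N by rewrite -[X in (_ < X)%N](prednK p0) ltnS.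
move=> /imsetP[i _ ->] /imsetP[k _ ->]; rewrite !gz => e; congr g; apply: val_inj.
apply: succn_inj; apply/eqP; have := eq_prim_root_expr (zetaP pS) i.+1 k.+1.
by rewrite e eqxx !modn_small // => /esym.
Qed.

Lemma sum_inertia_unity p x : p \in S -> x ^+ p = 1 ->
  \sum_(s in inertia E p) s x = p%:R * (x == 1)%:R - 1.
Proof.
move=> pS xp; have [g [gi gE gz]] := inertia_param pS; have p0 := prime_gt0 (S_prime pS).
have [k xE] := prim_rootP (zetaP pS) xp.
rewrite gE big_imset /=; last by move=> ? ? _ _; exact: gi.
have sx (i : 'I_p.-1) : g i x = x ^+ i.+1.
  by rewrite xE rmorphXn /= gz -!exprM mulnC.
under eq_bigr do rewrite sx.
have -> : \sum_(i < p.-1) x ^+ i.+1 = \sum_(i < p) x ^+ i - 1.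
  rewrite -[X in \sum_(i < X) x ^+ i](prednK p0) big_ord_recl expr0 addrAC subrr add0r.
  by apply: eq_bigr => i _.
congr (_ - 1); have [->|x1] := eqVneq x 1.
  by rewrite mulr1 (eq_bigr (fun=> 1)) ?sumr_const ?card_ord // => i _; rewrite expr1n.
have := subrX1 x p; rewrite xp subrr mulr0 => /esym/eqP.
by rewrite mulf_eq0 subr_eq0 (negPf x1) => /eqP.
Qed.

Lemma inertia_prod_faithful (r : seq nat) t : uniq r -> {subset r <= S} -> t \in inertia_prod r ->
  (forall p, p \in r -> t (zeta p) = zeta p) -> t = 1%g.
Proof.
elim: r t => [|p r IH] t; first by rewrite /inertia_prod big_nil inE => _ _ /eqP.
move=> /andP[pr ur] rS; rewrite inertia_prod_cons => /imset2P[u v uI vI tE] fix_t.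
have [pS rS'] : p \in S /\ {subset r <= S}.
  by split=> [|k kr]; apply: rS; rewrite in_cons ?eqxx ?kr ?orbT.
have u1 : u = 1%g.
  apply: (inertia_inj pS uI); first exact: (group1 (inertia_group E p)).
  rewrite gal_id -[RHS]fix_t ?mem_head // tE galMx abel.
  by rewrite (inertia_prod_fix rS' pS pr vI).
move: tE; rewrite u1 mul1g => tE; rewrite tE; apply: IH => // q qr.
by rewrite -tE fix_t // in_cons qr orbT.
Qed.

Lemma inertia_prod_inj (r : seq nat) p u v u' v' : uniq (p :: r) -> {subset p :: r <= S} ->
  u \in inertia E p -> u' \in inertia E p -> v \in inertia_prod r -> v' \in inertia_prod r ->
  (u * v = u' * v')%g -> u = u' /\ v = v'.
Proof.
move=> /= /andP[pr ur] rS uI u'I vI v'I e.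
have [pS rS'] : p \in S /\ {subset r <= S}.
  by split=> [|k kr]; apply: rS; rewrite in_cons ?eqxx ?kr ?orbT.
have uu : u = u'.
  apply: (inertia_inj pS uI u'I).
  rewrite -{1}(inertia_prod_fix rS' pS pr vI) -{2}(inertia_prod_fix rS' pS pr v'I).
  by rewrite -!(abel _ u) -?(abel v') -!galMx e.
by split=> //; move: e; rewrite uu => /mulgI.
Qed.

(** Sums over the Galois group factor over the primes: chi is multiplicative and F p depends only on the
   component at p. *)
Lemma sum_inertia_prod (R : comNzRingType) (chi : gal -> R) (F : nat -> gal -> R) (r : seq nat) :
  chi 1%g = 1 -> (forall s t, chi (s * t)%g = chi s * chi t) ->
  (forall p s t, p \in S -> t (zeta p) = zeta p -> F p (s * t)%g = F p s) ->
  uniq r -> {subset r <= S} ->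
  \sum_(s in inertia_prod r) chi s * \prod_(p <- r) F p s =
  \prod_(p <- r) \sum_(s in inertia E p) chi s * F p s.
Proof.
move=> chi1 chiM FE; elim: r => [|p r IH] ur rS.
  rewrite big_nil /inertia_prod big_nil big_set1 big_nil chi1 mulr1 //.
have [pS rS'] : p \in S /\ {subset r <= S}.
  by split=> [|k kr]; apply: rS; rewrite in_cons ?eqxx ?kr ?orbT.
have /andP[pr ur'] := ur.
have cE : inertia_prod (p :: r) =
    [set (x.1 * x.2)%g | x in finset.setX (inertia E p) (inertia_prod r)] :> {set gal}.
  rewrite inertia_prod_cons; apply/setP => x; apply/imset2P/imsetP.
    by move=> [u v uI vI ->]; exists (u, v) => //; apply/setXP.
  by move=> [[u v]]; rewrite inE => /andP[uI vI] ->; exists u v.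
rewrite big_cons -IH // (eq_bigl _ _ (fun x : gal => congr1 (fun A : {set gal} => x \in A) cE)).
rewrite big_imset /=; last first.
  move=> [u v] [u' v'] /setXP[/= uI vI] /setXP[/= u'I v'I] e.
  by have [-> ->] := inertia_prod_inj ur rS uI u'I vI v'I e.
rewrite (eq_bigl (fun x : gal * gal => (x.1 \in inertia E p) && (x.2 \in inertia_prod r))); last first.
  by move=> x; rewrite inE.
rewrite -(pair_big (mem (inertia E p)) (mem (inertia_prod r)) (fun u v =>
   chi (u * v)%g * \prod_(q <- p :: r) F q (u * v)%g)) /=.
rewrite mulr_suml; apply: eq_bigr => u uI.
rewrite mulr_sumr; apply: eq_bigr => v vI.
rewrite big_cons /= chiM (FE p) ?(inertia_prod_fix rS' pS pr vI) //.
have -> : \prod_(q <- r) F q (u * v)%g = \prod_(q <- r) F q v.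
  apply: eq_big_seq => q qr; rewrite abelM FE ?rS' // (inertia_fix _ _ _ uI) ?rS' ?S_prime //.
  by apply: contraNneq pr => ->.
by rewrite mulrACA.
Qed.

Definition zetaS := \prod_(p <- S) zeta p.
(** The conjugates of this element, divided by the product of S, form the basis dual to the conjugates of
   zetaS: over each prime, Tr (z ^ a * (z ^ - b - 1)) = p when a = b and 0 otherwise. *)
Definition dualS := \prod_(p <- S) ((zeta p)^-1 - 1).
Local Notation n := (\prod_(p <- S) p)%N.

Lemma gal_zeta_eq (u v : gal) : (forall p, p \in S -> u (zeta p) = v (zeta p)) -> u = v.
Proof.
move=> e; apply: (mulgI (u^-1)%g); rewrite mulVg; apply/esym.
apply: (inertia_prod_faithful S_uniq) => // [|p pS]; first by rewrite inertia_prodT inE.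
by rewrite galMx abel -e // -galMx mulgV gal_id.
Qed.

Lemma trace_zetaS_dualS (u v : gal) : trace (u zetaS * v dualS) = (n%:R * (u == v)%:R).
Proof.
apply: (@in_alg_inj E); rewrite traceE //.
transitivity (\sum_(s in inertia_prod S) 1 * \prod_(p <- S) s (u (zeta p) * v ((zeta p)^-1 - 1))).
  apply: eq_big => [s|s _]; first by rewrite inertia_prodT inE.
  by rewrite mul1r /zetaS /dualS !rmorph_prod -big_split rmorph_prod.
pose F p s := s (u (zeta p) * v ((zeta p)^-1 - 1)).
have FE p s t : p \in S -> t (zeta p) = zeta p -> F p (s * t)%g = F p s.
  move=> pS tz; rewrite /F galMx abel; congr (s _).
  by rewrite rmorphM /= !(abel t) rmorphB /= fmorphV /= tz rmorph1.
rewrite (@sum_inertia_prod _ (fun=> 1) F S erefl (fun _ _ => esym (mulr1 1)) FE S_uniq (fun _ => id)) /F.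
have step p : p \in S -> \sum_(s in inertia E p) 1 * s (u (zeta p) * v ((zeta p)^-1 - 1)) =
    (p * (u (zeta p) == v (zeta p)))%:R :> E.
  move=> pS; have v0 : v (zeta p) != 0 by rewrite fmorph_eq0 zeta_neq0.
  have uX : u (zeta p) ^+ p = 1 by rewrite -rmorphXn /= zetaX // rmorph1.
  have uvX : (u (zeta p) / v (zeta p)) ^+ p = 1.
    by rewrite expr_div_n uX -rmorphXn /= zetaX // rmorph1 divr1.
  under eq_bigr => s _.
    rewrite mul1r rmorphB /= fmorphV rmorph1 /= mulrBr mulr1 rmorphB /=; over.
  rewrite sumrB !sum_inertia_unity // opprB addrA subrK natrM.
  have -> : (u (zeta p) / v (zeta p) == 1) = (u (zeta p) == v (zeta p)).
    by rewrite -subr_eq0 -(divff v0) -mulrBl mulf_eq0 invr_eq0 (negPf v0) orbF subr_eq0.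
  have -> : (u (zeta p) == 1) = false; last by rewrite mulr0 subr0.
  apply/eqP => u1; have := S_prime pS.
  have := prim_order_dvd (zetaP pS) 1.
  have z1 : zeta p = 1 by apply: (fmorph_inj u); rewrite rmorph1; exact: u1.
  by rewrite expr1 z1 eqxx dvdn1 => /eqP ->.
rewrite (eq_big_seq _ step) -natr_prod.
have -> : (n%:R * (u == v)%:R : rat)%:A = (n * (u == v))%:R :> E.
  by rewrite -natrM alg_nat.
congr (_%:R); have [->|uv] := eqVneq u v.
  by rewrite muln1; apply: eq_bigr => p _; rewrite eqxx muln1.
have [p pS pne] : exists2 p, p \in S & u (zeta p) != v (zeta p).
  apply: contrapT => ne; case/eqP: uv; apply: gal_zeta_eq => p pS.
  by apply/eqP; apply: contrapT => /negP ne'; apply: ne; exists p.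
by rewrite muln0 (bigD1_seq p) //= (negPf pne) muln0 mul0n.
Qed.

(** The factor z ^ - 1 - 1 of dualS for the prime p lies in the radical of p, so these traces are divisible
   by every p in S. This is the integrality of the coordinates on the conjugates of zetaS: no other
   description of the ring of integers is needed. *)
Lemma trace_dualS_dvd x (v : gal) : x \in oint E -> exists z : int, trace (x * v dualS) = (n%:Z * z)%:~R.
Proof.
move=> xo; have dn p : p \in S -> (zeta p)^-1 - 1 \in nilp E p.
  move=> pS; rewrite -opprB rpredN; apply: one_sub_root_nilp; first exact: S_prime.
  by rewrite exprVn zetaX // invr1.
have ddn p : p \in S -> dualS \in nilp E p.
  move=> pS; rewrite /dualS (bigD1_seq p) //= mulrC nilpMl ?dn //.
  rewrite big_seq_cond rpred_prod // => q /andP[qS _]; exact: nilp_oint (dn q qS).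
have xd p : p \in S -> x * v dualS \in nilp E p.
  by move=> pS; rewrite nilpMl // nilp_gal // ddn.
have xdo : x * v dualS \in oint E.
  rewrite rpredM ?gal_oint // /dualS big_seq_cond rpred_prod // => q /andP[qS _].
  exact: nilp_oint (dn q qS).
have /intrP[t tE] := trace_oint galE xdo.
suff /dvdzP[z zE] : (n%:Z %| t)%Z by exists z; rewrite tE zE mulrC.
rewrite dvdzE /=; apply: prod_prime_dvd => // p pS.
have [z] := trace_nilp galE (S_prime pS) (xd p pS).
by rewrite tE => /intr_inj ->; rewrite abszM dvdn_mulr.
Qed.

Hypothesis cS : forall p, p \in S -> c (zeta p) = (zeta p)^-1.

(** Orthogonality of characters. *)
Lemma sum_char (B : {group gal}) (chi : gal -> C) :
  (forall s t, chi (s * t)%g = chi s * chi t) ->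
  \sum_(s in B) chi s = if [forall s in B, chi s == 1] then #|B|%:R else 0.
Proof.
move=> chiM; case: ifP => [/forall_inP chi1|/negbT].
  by rewrite (eq_bigr (fun=> 1)) ?sumr_const // => s /chi1/eqP.
rewrite negb_forall_in => /existsP[t /andP[tB t1]]; apply/eqP.
have : (1 - chi t) * \sum_(s in B) chi s == 0; last first.
  by rewrite mulf_eq0 subr_eq0 eq_sym (negPf t1).
rewrite mulrBl mul1r subr_eq0 mulr_sumr; apply/eqP.
rewrite (reindex_inj (mulgI t)) /=; apply: eq_big => [s|s _]; first by rewrite groupMl.
by rewrite chiM.
Qed.

(** The squared absolute value of a Gauss sum for a prime modulus; it is 1 for the trivial character, as the sum of
   the primitive roots is - 1. *)
Lemma gauss_sum_prime p (chi : gal -> C) : p \in S ->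
  chi 1%g = 1 -> (forall s t, chi (s * t)%g = chi s * chi t) ->
  (\sum_(s in inertia E p) chi s * j (s (zeta p))) *
  (\sum_(s in inertia E p) chi (s^-1)%g * j (s (zeta p)^-1)) =
  (if [forall s in inertia E p, chi s == 1] then 1%N else p)%:R.
Proof.
move=> pS chi1 chiM; have z0 := zeta_neq0 pS; have pp := S_prime pS.
transitivity (\sum_(s in inertia E p) chi s * j (\sum_(t in inertia E p) t (s (zeta p) / zeta p))).
  rewrite mulrC mulr_suml.
  transitivity (\sum_(t in inertia E p) \sum_(s in inertia E p) chi s * j (t (s (zeta p) / zeta p))).
    apply: eq_bigr => t tI; rewrite mulr_sumr.
    rewrite (reindex_inj (mulIg t)) /=; apply: eq_big => [s|s sI].
      by rewrite groupMr.
    have e : chi t^-1%g * chi t = 1 by rewrite -chiM mulVg.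
    rewrite chiM galMx 2!rmorphM /=.
    transitivity (chi t^-1%g * chi t * (chi s * (j (t (s (zeta p))) * j (t (zeta p)^-1)))); first by ring.
    by rewrite e mul1r.
  rewrite exchange_big /=; apply: eq_bigr => s sI.
  by rewrite rmorph_sum mulr_sumr.
under eq_bigr => s sI.
  rewrite sum_inertia_unity //; last first.
    by rewrite expr_div_n -rmorphXn /= zetaX // rmorph1 divr1.
  have -> : (s (zeta p) / zeta p == 1) = (s == 1%g).
    apply/eqP/eqP => [e|->]; last by rewrite gal_id divff.
    apply: (inertia_inj pS sI); first exact: (group1 (inertia_group E p)).
    by rewrite gal_id; apply: (divIf z0); rewrite e divff.
  rewrite rmorphB rmorphM rmorph1 !rmorph_nat /= mulrBr mulr1; over.
rewrite sumrB (@sum_char (inertia_group E p) chi chiM) (bigD1 1%g) /=; last exact: (group1 (inertia_group E p)).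
rewrite eqxx chi1 mul1r mulr1 big1 ?addr0; last by move=> s /andP[_ /negPf ->]; rewrite !mulr0.
have -> : #|inertia E p| = p.-1.
  by have [g [gi -> _]] := inertia_param pS; rewrite card_imset // card_ord.
case: ifP => _; last by rewrite subr0.
by rewrite -natrB ?leq_pred // -subn1 subKn // prime_gt0.
Qed.

(** A product of Gauss sums over the primes in S. *)
Lemma gauss_sum (chi : gal -> C) :
  chi 1%g = 1 -> (forall s t, chi (s * t)%g = chi s * chi t) ->
  (\sum_(s : gal) chi s * j (s zetaS)) * (\sum_(s : gal) chi (s^-1)%g * j (s (c zetaS))) =
  \prod_(p <- S) (if [forall s in inertia E p, chi s == 1] then 1%N else p)%:R.
Proof.
move=> chi1 chiM.
have chiV : forall s t, chi (s * t)^-1%g = chi s^-1%g * chi t^-1%g.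
  by move=> s t; rewrite abelM invMg chiM.
have factor (x : gal -> C) (y : nat -> E) : x 1%g = 1 -> (forall s t, x (s * t)%g = x s * x t) ->
    (forall p t, p \in S -> t (zeta p) = zeta p -> t (y p) = y p) ->
    \sum_(s : gal) x s * j (s (\prod_(p <- S) y p)) =
    \prod_(p <- S) \sum_(s in inertia E p) x s * j (s (y p)).
  move=> x1 xM yP; rewrite -(@sum_inertia_prod _ x (fun p s => j (s (y p))) S) //; last first.
    by move=> p s t pS tz; rewrite galMx abel yP.
  apply: eq_big => [s|s _]; first by rewrite inertia_prodT inE.
  by rewrite !rmorph_prod.
have -> : c zetaS = \prod_(p <- S) (zeta p)^-1.
  by rewrite rmorph_prod; apply: eq_big_seq => p pS; rewrite /= cS.
rewrite (factor chi) // (factor (fun s => chi s^-1%g)) //; first last.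
- by move=> p t pS tz; rewrite fmorphV /= tz.
- by rewrite invg1.
rewrite -big_split; apply: eq_big_seq => p pS /=.
exact: gauss_sum_prime.
Qed.

End Cyclotomic.

(** * Descending to a cyclic field *)

Section Descent.
Variables (K E : splittingFieldType rat) (iota : {rmorphism K -> E}).
Hypothesis galK : galois 1 {:K}.
Local Notation galk := (gal_of {:K}).
Local Notation gal := (gal_of {:E}).
Local Notation res := (res iota galK).
Let galE := galois_char0 E.

Lemma res1 : res 1%g = 1%g.
Proof. by apply: (mulgI (res 1%g)); rewrite -resM !mulg1. Qed.

Lemma resV s : res s^-1%g = (res s)^-1%g.
Proof. by apply: (mulgI (res s)); rewrite -resM !mulgV res1. Qed.

Lemma resX s k : res (s ^+ k)%g = (res s ^+ k)%g.
Proof. by elim: k => [|k IH]; rewrite ?expg0 ?res1 // !expgS resM IH. Qed.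

Lemma res_eq1 (s : gal) : (forall x, s (iota x) = iota x) -> res s = 1%g.
Proof.
move=> sx; apply/eqP/gal_eqP => x _; apply: (fmorph_inj iota).
by rewrite -resE sx gal_id.
Qed.

(** By Galois theory for E over the image of K. *)
Lemma res_kernel_fixed (y : E) : (forall s : gal, res s = 1%g -> s y = y) -> exists x, iota x = y.
Proof.
move=> yfix; pose t := separable_generator 1 {:K}.
pose F := <<1; iota t>>%AS.
have galF : galois F {:E} by apply: galoisS galE; rewrite sub1v subvf.
have : y \in fixedField 'Gal({:E} / F)%g.
  apply/fixedFieldP; first exact: memvf.
  move=> s sF; apply: yfix; apply/eqP/gal_eqP => x _; rewrite gal_id.
  have st : res s t = t.
    apply: (fmorph_inj iota); rewrite -resE; apply: (fixed_gal _ sF); first exact: subvf.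
    exact: memv_adjoin.
  exact: (morph_gen_eq (f := res s) (g := idfun) st).
rewrite (galois_fixedField galF) => /Fadjoin_polyP[p /polyOver1P[q ->] ->].
exists ((map_poly (in_alg K) q).[t]); rewrite -horner_map -map_poly_comp; congr (_.[_]).
by apply: eq_map_poly => r /=; rewrite morph_alg.
Qed.

(** The trace from E down to the image of K. *)
Definition relative_trace (y : E) := \sum_(s : gal | res s == 1%g) s y.

Lemma relative_trace_descends y : exists x, iota x = relative_trace y.
Proof.
apply: res_kernel_fixed => t t1; rewrite rmorph_sum [RHS](reindex_inj (mulIg t)) /=.
by apply: eq_big => [s|s _]; rewrite ?galMx // resM t1 mulg1.
Qed.

Lemma relative_trace_conj x y : iota x = relative_trace y ->
  forall u : galk, iota (u x) = \sum_(s : gal | res s == u) s y.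
Proof.
move=> xE u; have [s0 <-] := res_onto iota galK u.
rewrite -resE xE rmorph_sum [RHS](reindex_inj (mulIg s0)) /=.
apply: eq_big => [s|s _]; last by rewrite galMx.
by rewrite resM -{2}[res s0]mul1g (inj_eq (mulIg _)).
Qed.

(** Grouping the sum over the Galois group of E by the restriction to K; the function chi will be a
   character. *)
Lemma relative_trace_sum (C : pzRingType) (j : {rmorphism E -> C}) (chi : galk -> C) x y :
  iota x = relative_trace y ->
  \sum_(u : galk) chi u * j (iota (u x)) = \sum_(s : gal) chi (res s) * j (s y).
Proof.
move=> xE; rewrite [RHS](partition_big res xpredT) //=; apply: eq_bigr => u _.
rewrite (relative_trace_conj xE) rmorph_sum mulr_sumr.
by apply: eq_bigr => s /eqP ->.
Qed.

Lemma trace_relative x y : iota x = relative_trace y -> trace x = trace y.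
Proof.
move=> xE; apply: (@in_alg_inj E); rewrite traceE // -(morph_alg iota) traceE // rmorph_sum.
have := relative_trace_sum idfun (fun=> 1) xE.
under eq_bigr do rewrite mul1r /=.
by under [X in _ = X]eq_bigr do rewrite mul1r /=.
Qed.

Lemma relative_traceM x y : relative_trace (iota x * y) = iota x * relative_trace y.
Proof.
rewrite mulr_sumr; apply: eq_bigr => s /eqP s1.
by rewrite rmorphM /= resE s1 gal_id.
Qed.

End Descent.

Section CyclotomicCompositum.
Variables (K E : splittingFieldType rat) (iota : {rmorphism K -> E}).
Hypothesis galK : galois 1 {:K}.
Hypothesis tameK : tame K.
Hypothesis abelK : forall (s t : gal_of {:K}) x, s (t x) = t (s x).
Local Notation galk := (gal_of {:K}).
Local Notation gal := (gal_of {:E}).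
Local Notation res := (res iota galK).
Let galE := galois_char0 E.
Variables (S : seq nat) (w : E).
Hypothesis S_uniq : uniq S.
Hypothesis S_prime : forall p, p \in S -> prime p.
Hypothesis unrK : forall p, prime p -> p \notin S -> inertia K p = [set 1%g].
Local Notation n := (\prod_(p <- S) p)%N.
Hypothesis wn : n.-primitive_root w.
Hypothesis gen : forall s : gal, (forall x, s (iota x) = iota x) -> s w = w -> s = 1%g.

Definition root_of p := w ^+ (n %/ p).
Local Notation zeta := root_of.

Lemma root_ofP p : p \in S -> p.-primitive_root (zeta p).
Proof. by move=> pS; apply: dvdn_prim_root => //; rewrite (bigD1_seq p) //= dvdn_mulr. Qed.

Lemma gal_ext (s t : gal) : (forall x, s (iota x) = t (iota x)) -> s w = t w -> s = t.
Proof.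
have tV y : (t^-1)%g (t y) = y by rewrite -galMx mulgV gal_id.
move=> ex ew; suff : (s * t^-1)%g = 1%g by move/eqP; rewrite -eq_mulgV1 => /eqP.
by apply: gen => [x|]; rewrite galMx ?ex ?ew tV.
Qed.

Lemma abelE (s t : gal) x : s (t x) = t (s x).
Proof.
rewrite -2!galMx; suff -> : (t * s)%g = (s * t)%g by []; apply: gal_ext => [y|]; rewrite !galMx.
  by rewrite !(resE iota galK) abelK.
have [a _ sw] := gal_root s wn; have [b _ tw] := gal_root t wn.
by rewrite sw tw !rmorphXn /= sw tw -!exprM mulnC.
Qed.

Lemma gal_fix_roots (s : gal) : (forall x, s (iota x) = iota x) ->
  (forall p, p \in S -> s (zeta p) = zeta p) -> s = 1%g.
Proof.
move=> sx sz; apply: gen => //; have [k ck sw] := gal_root s wn.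
rewrite sw; have [k0|k0] := posnP k.
  move: ck wn; rewrite k0 /coprime gcd0n => /eqP -> /prim_expr_order.
  by rewrite expr1 => ->; rewrite expr0.
have kS p : p \in S -> (p %| k - 1)%N.
  move=> pS; rewrite -eqn_mod_dvd // -(eq_prim_root_expr (root_ofP pS)) expr1 -[X in _ == X](sz p pS).
  by rewrite /zeta rmorphXn /= sw -!exprM mulnC.
have /dvdnP[q qE] := prod_prime_dvd S_uniq S_prime kS.
by rewrite -(subnK k0) qE exprD mulnC exprM (prim_expr_order wn) expr1n mul1r expr1.
Qed.

(** If z is mapped to z ^ k, then k ^ p is congruent to 1, and k ^ p is congruent to k modulo p. *)
Lemma root_of_pth (s : gal) p : p \in S -> (s ^+ p)%g = 1%g -> s (zeta p) = zeta p.
Proof.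
move=> pS sp; have [k _ sz] := gal_root s (root_ofP pS).
have iter_k i : (s ^+ i)%g (zeta p) = zeta p ^+ (k ^ i).
  elim: i => [|i IH]; first by rewrite expg0 gal_id expn0 expr1.
  by rewrite expgSr galMx IH rmorphXn /= sz -exprM expnS.
have := iter_k p; rewrite sp gal_id => e.
have : (k ^ p == 1 %[mod p])%N.
  by rewrite -(eq_prim_root_expr (root_ofP pS)) -e expr1.
rewrite fermat_little ?S_prime // -(eq_prim_root_expr (root_ofP pS)) expr1 => /eqP.
by rewrite sz.
Qed.

Lemma inertia_fix_root p q (s : gal) : prime p -> q \in S -> p != q -> s \in inertia E p ->
  s (zeta q) = zeta q.
Proof. exact: (inertia_fix S_prime root_ofP). Qed.

(** An element of order p of inertia is trivial on K, where inertia has order prime to p by tameness; it fixes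
   the roots of unity of order prime to p as inertia does, and those of order p by root_of_pth. *)
Lemma inertia_coprime p : prime p -> coprime p #|inertia E p|.
Proof.
move=> pp; rewrite prime_coprime //; apply/negP => /(Cauchy pp)[s sI os].
have sp : (s ^+ p)%g = 1%g by rewrite -os expg_order.
have r1 : res s = 1%g.
  have rI : res s \in inertia K p by exact: res_inertia sI.
  have rp : (#[res s]%g %| p)%N by rewrite order_dvdn -resX sp res1.
  have := order_dvdG (G := inertia_group K p) rI => rc.
  apply/eqP; rewrite -order_eq1 -dvdn1 -(eqP (tame_inertia_coprime galK tameK pp)).
  by rewrite dvdn_gcd rp.
have : s = 1%g.
  apply: gal_fix_roots => [x|q qS]; first by rewrite resE r1 gal_id.
  move: qS; have [<- pS|pq qS] := eqVneq p q; first exact: root_of_pth.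
  exact: inertia_fix_root sI.
by move=> s1; move: os pp; rewrite s1 order1 => <-.
Qed.

Lemma inertia_unramified p : prime p -> p \notin S -> inertia E p = [set 1%g].
Proof.
move=> pp pS; apply/eqP; rewrite finset.eqEsubset finset.sub1set (group1 (inertia_group E p)) andbT.
apply/fintype.subsetP => s sI; apply/set1P; apply: gal_fix_roots => [x|q qS].
  have : res s \in inertia K p by exact: res_inertia sI.
  by rewrite unrK // resE => /set1P ->; rewrite gal_id.
by apply: inertia_fix_root sI => //; apply: contraNneq pS => ->.
Qed.

Variables (R : realType) (j : {rmorphism E -> R[i]}).
Hypothesis realK : totally_real R K.

Lemma real_conj x : (j (iota x))^* = j (iota x).
Proof.
have := realK (ex_intro _ (j \o iota : {rmorphism K -> R[i]}) erefl) x => /=.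
by case: (j (iota x)) => a b /= ->; rewrite -[LHS]/(a -i* 0)%C; simpc.
Qed.

(** Complex conjugation inverts roots of unity; as K is totally real it is trivial on K. *)
Lemma conj_exists : exists c : gal, (forall x, j (c x) = (j x)^*) /\
   (forall x, c (iota x) = iota x) /\ (forall p, p \in S -> c (zeta p) = (zeta p)^-1).
Proof.
have [c cE] := morph_conj galE j (Num.conj \o j); exists c.
have jc x : j (c x) = (j x)^* by rewrite -cE.
split=> //; split=> [x|p pS]; first by apply: (fmorph_inj j); rewrite jc real_conj.
apply: (fmorph_inj j); rewrite jc fmorphV; have pp := S_prime pS.
have n1 : `|j (zeta p)| = 1.
  apply/eqP; rewrite -(@pexpr_eq1 _ _ p) ?prime_gt0 // -normrX -rmorphXn /=.
  by rewrite (prim_expr_order (root_ofP pS)) rmorph1 normr1.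
have j0 : j (zeta p) != 0 by rewrite -normr_eq0 n1 oner_eq0.
by apply: (mulfI j0); rewrite -normCK n1 expr1n divff.
Qed.

(** The elements a and d are the relative traces of zetaS and dualS. As complex conjugation is in the kernel of
   the restriction to K, a is also the relative trace of the conjugate of zetaS, and the two factors of
   gauss_sum become sums over the conjugates of a. *)
Lemma descended_generator : exists (a d : K) (f : {rmorphism K -> R[i]}),
  [/\ a \in oint K, (forall u : galk, trace (u a * d) = n%:R * (u == 1%g)%:R),
   (forall x, x \in oint K -> exists z : int, trace (x * d) = (n%:Z * z)%:~R) &
   forall chi : galk -> R[i], chi 1%g = 1 -> (forall u v, chi (u * v)%g = chi u * chi v) ->
     (\sum_(u : galk) chi u * f (u a)) * (\sum_(u : galk) chi u^-1%g * f (u a)) =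
     \prod_(p <- S) (if [forall u in res @: inertia E p, chi u == 1] then 1%N else p)%:R].
Proof.
have [c [jc [cK cS]]] := conj_exists.
have [a aE] := relative_trace_descends iota galK (zetaS S zeta).
have [d dE] := relative_trace_descends iota galK (dualS S zeta).
exists a, d, (j \o iota).
have cop := inertia_coprime; have unr := inertia_unramified.
have zo p : p \in S -> zeta p \in oint E.
  by move=> pS; apply: (root1_oint (prime_gt0 (S_prime pS))); exact: prim_expr_order (root_ofP pS).
have trd x : trace (x * d) = trace (iota x * dualS S zeta).
  by apply: (trace_relative (iota := iota) (galK := galK)); rewrite relative_traceM -dE rmorphM.
split.
- rewrite -(res_oint iota) aE rpred_sum // => s _; rewrite gal_oint //.
  by rewrite /zetaS big_seq_cond rpred_prod // => p /andP[pS _]; exact: zo.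
- move=> u; rewrite trd (relative_trace_conj aE) mulr_suml trace_sum //.
  transitivity (\sum_(s : gal | res s == u) n%:R * (s == 1%g)%:R : rat).
    apply: eq_bigr => s _.
    have := trace_zetaS_dualS galE abelE S_uniq S_prime root_ofP cop unr jc s 1%g.
    by rewrite gal_id.
  have [->|u1] := eqVneq u 1%g.
    rewrite -mulr_sumr; congr (_ * _); rewrite (bigD1 1%g) ?res1 /= ?eqxx //.
    by rewrite big1 ?addr0 // => s /andP[_ /negPf ->].
  rewrite mulr0 big1 // => s /eqP su; have [s1|] := eqVneq s 1%g; last by rewrite mulr0.
  by move: u1; rewrite -su s1 res1 eqxx.
- move=> x xo; have [|z] := @trace_dualS_dvd _ galE S zeta S_uniq S_prime root_ofP (iota x) 1%g.
    by rewrite res_oint.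
  by rewrite gal_id -trd => zE; exists z.
move=> chi chi1 chiM.
have cr : res c = 1%g by apply: res_eq1.
have aE' : iota a = relative_trace iota galK (c (zetaS S zeta)).
  rewrite aE /relative_trace (reindex_inj (mulgI c)) /=.
  by apply: eq_big => [s|s _]; rewrite ?galMx // resM cr mul1g.
have := @gauss_sum _ galE abelE S zeta S_uniq S_prime root_ofP cop unr _ j c jc cS (chi \o res).
rewrite /= res1 chi1 => /(_ erefl) gs.
rewrite (relative_trace_sum j chi aE) (relative_trace_sum j (fun u => chi u^-1%g) aE').
under [X in _ * X = _]eq_bigr do rewrite -resV.
rewrite gs; last by move=> s t; rewrite resM chiM.
apply: eq_bigr => p _; congr (_%:R); congr (if _ then _ else _).
apply/forall_inP/forall_inP => [h u /imsetP[s sI ->]|h s sI]; first exact: h.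
by apply: h; apply: imset_f.
Qed.

End CyclotomicCompositum.

(** * The Gram matrix of a cyclic field *)

(** An integral generator x is moved by every s other than 1, and a prime with s in its inertia group divides the
   norm of s x - x. So only the divisors of one nonzero integer are ramified. *)
Lemma ramified_bound (K : splittingFieldType rat) : galois 1 {:K} ->
  exists B, forall p, prime p -> (B <= p)%N -> inertia K p = [set 1%g].
Proof.
move=> galK; pose t := separable_generator 1 {:K}.
have [N N0 xo] := oint_clear t; set x := N%:R * t in xo.
pose D : K := \prod_(s : gal_of {:K} | s != 1%g) \prod_(u : gal_of {:K}) u (s x - x).
have so (s u : gal_of {:K}) : u (s x - x) \in oint K by rewrite gal_oint ?rpredB ?gal_oint.
have [z zE] : exists z : int, D = z%:~R.
  have DO : D \in oint K.
    rewrite /D; apply: rpred_prod => s _.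
    apply: rpred_prod => u _.
    exact: so.
  apply: (fixed_int galK DO) => v; rewrite rmorph_prod; apply: eq_bigr => s _ /=.
  rewrite rmorph_prod [RHS](reindex_inj (mulIg v)) /=.
  by apply: eq_bigr => u _; rewrite galMx.
have D0 : D != 0.
  apply/prodf_neq0 => s s1; apply/prodf_neq0 => u _; rewrite fmorph_eq0 subr_eq0.
  apply: contraNneq s1 => sx; apply/eqP/eqP/gal_eqP => y _; rewrite gal_id.
  apply: (morph_gen_eq (f := s) (g := idfun)) => /=.
  have NK : N%:R != 0 :> K by rewrite natE_eq0 -lt0n.
  by apply: (mulfI NK); move: sx; rewrite /x rmorphM rmorph_nat.
exists `|z|.+1%N => p pp pB; apply/eqP.
rewrite finset.eqEsubset finset.sub1set (group1 (inertia_group K p)) andbT.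
apply/fintype.subsetP => s /inertiaP sI; apply/set1P; apply: contrapT => /eqP s1.
have : z%:~R \in nilp K p.
  rewrite -zE /D (bigD1 s) //= (bigD1 1%g) //= -mulrA mulrC.
  rewrite gal_id nilpMl ?sI // rpredM ?rpred_prod // => u _; first exact: so.
  by apply: rpred_prod => v _; exact: so.
move/(nilp_int pp); rewrite dvdzE /= => /dvdn_leq.
rewrite absz_gt0 -(intE_eq0 K) -zE D0 => /(_ isT).
by rewrite leqNgt (leq_trans _ pB).
Qed.

Lemma prim_root_exists (C : numClosedFieldType) (K : splittingFieldType rat) m : galois 1 {:K} ->
  (0 < m)%N -> exists w : C, m.-primitive_root w.
Proof.
move=> galK m0; have [E [_ [w [wm _]]]] := cyclotomic_compositum galK m0.
by have [f _] := closed_embed_exists E C; exists (f w); rewrite fmorph_primitive_root.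
Qed.

Lemma cyclic_field_gen m (K : splittingFieldType rat) : (0 < m)%N -> cyclic_number_field m K ->
  [/\ galois 1 {:K}, \dim {:K} = m & exists2 g : gal_of {:K}, <[g]>%g = [set: gal_of {:K}] & #[g]%g = m].
Proof.
move=> m0 [galK iso]; have gT : 'Gal({:K} / 1)%g = [set: gal_of {:K}].
  by apply/setP => s; rewrite mem_gal inE.
have cT : #|'Gal({:K} / 1)%g| = m by rewrite (card_isog iso) card_Zp.
split=> //; first by rewrite -(card_gal galK) -cT gT cardsT.
have : cyclic 'Gal({:K} / 1)%g.
  rewrite (@isog_cyclic _ _ ('Gal({:K} / 1))%G (Zp_group m) iso) /= /Zp.
  by case: ifP => _; [apply/cyclicP; exists Zp1; exact: Zp_cycle | exact: cyclic1].
by case/cyclicP => g gE; exists g; rewrite -?gT -?gE // orderE -gE cT.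
Qed.

(** The compositum is eliminated; what remains of it are the images J p of its inertia groups. *)
Lemma abelian_generator (R : realType) (K : splittingFieldType rat) (S : seq nat) :
  galois 1 {:K} -> (forall (s t : gal_of {:K}) x, s (t x) = t (s x)) ->
  tame K -> totally_real R K -> uniq S -> (forall p, p \in S -> prime p) ->
  (forall p, prime p -> p \notin S -> inertia K p = [set 1%g]) ->
  exists (a d : K) (f : {rmorphism K -> R[i]}) (J : nat -> {group gal_of {:K}}),
  [/\ a \in oint K,
      (forall u : gal_of {:K}, trace (u a * d) = (\prod_(p <- S) p)%:R * (u == 1%g)%:R),
      (forall x, x \in oint K -> exists z : int, trace (x * d) = ((\prod_(p <- S) p)%N%:Z * z)%:~R) &
      forall chi : gal_of {:K} -> R[i], chi 1%g = 1 -> (forall u v, chi (u * v)%g = chi u * chi v) ->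
     (\sum_(u : gal_of {:K}) chi u * f (u a)) * (\sum_(u : gal_of {:K}) chi u^-1%g * f (u a)) =
     \prod_(p <- S) (if [forall u in J p, chi u == 1] then 1%N else p)%:R].
Proof.
move=> galK abelK tK realK uS pS unrK.
have n0 : (0 < \prod_(p <- S) p)%N.
  by rewrite big_seq_cond prodn_cond_gt0 // => p /andP[/pS/prime_gt0].
have [E [iota [w [wn gen]]]] := cyclotomic_compositum galK n0.
have [j _] := closed_embed_exists E (R[i] : numClosedFieldType).
have [a [d [f [ao ad xd gs]]]] := descended_generator galK tK abelK uS pS unrK wn gen j realK.
have Jg p : group_set [set res iota galK x | x in inertia E p].
  apply/group_setP; split; first by apply/imsetP; exists 1%g; rewrite ?res1 //; exact: (group1 (inertia_group E p)).
  move=> _ _ /imsetP[s sI ->] /imsetP[t tI ->]; rewrite -resM; apply: imset_f.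
  exact: (groupM (G := inertia_group E p)).
by exists a, d, f, (fun p => Group (Jg p)); split=> // chi chi1 chiM; rewrite gs.
Qed.

(** A subgroup of a cyclic group is the set of powers of g ^ (m / #|H|). *)
Lemma cycle_char_trivial (C : fieldType) (gT : finGroupType) (g : gT) (H : {group gT}) (chi : gT -> C) :
  H \subset <[g]>%g -> (forall u v, chi (u * v)%g = chi u * chi v) -> chi 1%g = 1 ->
  (#[g]%g).-primitive_root (chi g) ->
  forall k, [forall u in H, chi u ^+ k == 1] = (#|H| %| k)%N.
Proof.
move=> Hg chiM chi1 wm k; set m := #[g]%g in wm.
have em : (#|H| %| m)%N by rewrite /m orderE cardSg.
have HE : H = <[g ^+ (m %/ #|H|)]>%G.
  by have := cycle_sub_group em => /setP/(_ H); rewrite !inE Hg eqxx => /esym/eqP.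
have chiX u i : chi (u ^+ i)%g = chi u ^+ i.
  by elim: i => [|i IH]; rewrite ?expg0 // expgS chiM IH exprS.
have e0 : (0 < #|H|)%N by exact: cardG_gt0.
have m0 : (0 < m)%N := order_gt0 g.
have -> : [forall u in H, chi u ^+ k == 1] = (chi (g ^+ (m %/ #|H|))%g ^+ k == 1).
  apply/forall_inP/idP => [h|/eqP h u].
    by apply: h; rewrite [X in _ \in pred_of_set (gval X)]HE; exact: cycle_id.
  rewrite [X in _ \in pred_of_set (gval X)]HE => /cycleP[i ->].
  by rewrite chiX exprAC h expr1n.
rewrite chiX -exprM -(prim_order_dvd wm) -{1}(divnK em) dvdn_pmul2l //.
by rewrite divn_gt0 // dvdn_leq.
Qed.

(** * The cyclic normal integral basis *)

Definition int_basis m (K : fieldExtType rat) (w : 'I_m -> K) : Prop :=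
  [/\ m = \dim {:K}, (forall i, w i \in oint K) &
      forall x, x \in oint K -> exists z : 'I_m -> int, x = \sum_i (z i)%:~R * w i].

Section CyclicField.
Variables (m : nat) (K : splittingFieldType rat) (g : gal_of {:K}).
Hypothesis galK : galois 1 {:K}.
Hypothesis gT : <[g]>%g = [set: gal_of {:K}].
Hypothesis gm : #[g]%g = m.
Local Notation galk := (gal_of {:K}).

Let m0 : (0 < m)%N. Proof. by rewrite -gm order_gt0. Qed.

Lemma cyclic_abelian (s t : galk) x : s (t x) = t (s x).
Proof.
rewrite -!galMx; congr (_ x).
have /cycleP[i ->] : s \in <[g]>%g by rewrite gT inE.
have /cycleP[k ->] : t \in <[g]>%g by rewrite gT inE.
by rewrite -!expgD addnC.
Qed.

Lemma cyclic_dim : \dim {:K} = m.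
Proof. by rewrite -(card_gal galK) -cardsT -gT -orderE gm. Qed.

Lemma cyclic_sum (V : nmodType) (F : galk -> V) : \sum_(u : galk) F u = \sum_(i < m) F (g ^+ i)%g.
Proof.
have inj : injective (fun i : 'I_m => (g ^+ i)%g).
  by move=> i k /eqP; rewrite eq_expg_ord ?gm // => /eqP.
rewrite [RHS](reindex_inj (h := @id _)) //=.
transitivity (\sum_(u in [set (g ^+ (i : nat))%g | i : 'I_m]) F u).
  apply: eq_bigl => u; apply/esym/imsetP.
  have : u \in <[g]>%g by rewrite gT inE.
  by case/cyclePmin=> i; rewrite gm => im ->; exists (Ordinal im).
by rewrite big_imset //= => i k _ _; exact: inj.
Qed.

Variables (a d : K) (n : nat).
Hypothesis n0 : (0 < n)%N.
Hypothesis ao : a \in oint K.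
Hypothesis ad : forall u : galk, trace (u a * d) = n%:R * (u == 1%g)%:R.
Hypothesis xd : forall x, x \in oint K -> exists z : int, trace (x * d) = (n%:Z * z)%:~R.

Definition conj_family (i : 'I_m) : K := (g ^+ i)%g a.
Local Notation w := conj_family.

Lemma trace_conj_dual (i k : 'I_m) : trace (w i * (g ^+ k)%g d) = n%:R * (i == k)%:R.
Proof.
have -> : w i * (g ^+ k)%g d = (g ^+ k)%g ((g ^+ i * (g ^+ k)^-1)%g a * d).
  by rewrite rmorphM /= -galMx mulgKV.
rewrite trace_gal // ad; congr (_ * (_ : bool)%:R).
by rewrite -eq_mulgV1 eq_expg_ord ?gm.
Qed.

Let nQ : n%:R != 0 :> rat. Proof. by rewrite pnatr_eq0 -lt0n. Qed.

Lemma conj_family_coord (c : 'I_m -> rat) (k : 'I_m) :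
  trace ((\sum_i c i *: w i) * (g ^+ k)%g d) = n%:R * c k.
Proof.
rewrite mulr_suml trace_sum // (bigD1 k) //= -scalerAl traceZ // trace_conj_dual eqxx mulr1 mulrC.
rewrite big1 ?addr0 // => i /negPf ik.
by rewrite -scalerAl traceZ // trace_conj_dual ik !mulr0.
Qed.

(** The conjugates of d / n are the dual basis, and they have integral pairings with o, so coordinates are
   integers. *)
Lemma conj_family_basis : int_basis w.
Proof.
split=> [|i|x xo]; [by rewrite cyclic_dim | by rewrite /conj_family gal_oint |].
pose W := [tuple w i | i < m].
have fW : free W.
  apply/freeP => c c0 k; have := conj_family_coord c k.
  have -> : \sum_i c i *: w i = \sum_(i < m) c i *: W`_i.
    by apply: eq_bigr => i _; rewrite -tnth_nth tnth_mktuple.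
  rewrite c0 mul0r trace0 // => /esym/eqP; rewrite mulf_eq0 (negPf nQ) => /eqP //.
have bW : basis_of {:K} W.
  by rewrite basisEfree fW subvf size_tuple cyclic_dim leqnn.
have xE : x = \sum_i coord W i x *: w i.
  rewrite {1}(coord_basis bW (memvf x)); apply: eq_bigr => i _.
  by rewrite -tnth_nth tnth_mktuple.
have /choice[z zE] k : exists z : int, coord W k x = z%:~R.
  have [|z zE] := xd (x := (g ^- k)%g x); first by rewrite gal_oint.
  exists z; apply: (mulfI nQ); rewrite -(conj_family_coord (fun i => coord W i x)) -xE.
  rewrite -(trace_gal galK (g ^- k)%g) rmorphM /= -[X in _ * X]galMx mulgV gal_id zE.
  by rewrite intrM.
exists z; rewrite xE; apply: eq_bigr => i _.
by rewrite zE -mulr_algl alg_int.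
Qed.

Variables (R : realType) (f : {rmorphism K -> R[i]}) (omega : R[i]).
Hypothesis omegaP : m.-primitive_root omega.

Lemma cyclic_char_exists : exists chi : galk -> R[i],
  [/\ chi 1%g = 1, (forall u v, chi (u * v)%g = chi u * chi v) & chi g = omega].
Proof.
have /choice[l lE] (u : galk) : exists i : nat, u = (g ^+ i)%g.
  have /cycleP[i uE] : u \in <[g]>%g by rewrite gT inE.
  by exists i.
have om i k : (g ^+ i)%g = (g ^+ k)%g -> omega ^+ i = omega ^+ k.
  move/eqP; rewrite eq_expg_mod_order gm => e.
  by apply/eqP; rewrite (eq_prim_root_expr omegaP).
exists (fun u => omega ^+ l u); split.
- by rewrite -[RHS](expr0 omega); apply: om; rewrite -lE expg0.
- by move=> u v; rewrite -exprD; apply: om; rewrite -lE expgD -!lE.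
- by rewrite -[RHS]expr1; apply: om; rewrite -lE expg1.
Qed.

Variables (S : seq nat) (J : nat -> {group galk}).
Hypothesis gauss : forall chi : galk -> R[i], chi 1%g = 1 -> (forall u v, chi (u * v)%g = chi u * chi v) ->
     (\sum_(u : galk) chi u * f (u a)) * (\sum_(u : galk) chi u^-1%g * f (u a)) =
     \prod_(p <- S) (if [forall u in J p, chi u == 1] then 1%N else p)%:R.

(** The eigenvalue of the Gram matrix for the character g |-> omega ^ k, where e p is the ramification index
   of p: the character is ramified at p if and only if e p does not divide k. *)
Definition spectrum (e : nat -> nat) (k : nat) := (\prod_(p <- S) (if e p %| k then 1 else p))%N.

Lemma fourier_trace (chi : galk -> R[i]) : chi 1%g = 1 -> (forall u v, chi (u * v)%g = chi u * chi v) ->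
  \sum_(u : galk) chi u * ratr (trace (a * u a)) =
  \prod_(p <- S) (if [forall u in J p, chi u == 1] then 1%N else p)%:R.
Proof.
move=> chi1 chiM; rewrite -gauss // mulrC mulr_suml.
transitivity (\sum_(u : galk) \sum_(v : galk) chi u * f (v a * u (v a))).
  apply: eq_bigr => u _; rewrite -mulr_sumr; congr (_ * _).
  have fE q : ratr q = f q%:A by rewrite rmorphZ_num rmorph1 mulr1.
  rewrite fE traceE // rmorph_sum; apply: eq_bigr => v _.
  by rewrite rmorphM /= cyclic_abelian.
rewrite exchange_big /=; apply: eq_bigr => v _; rewrite mulr_sumr.
rewrite [RHS](reindex_inj (mulgI v)) /=; apply: eq_bigr => u _.
rewrite chiM galMx rmorphM /= mulrACA; congr (_ * _).
by rewrite mulrA -chiM mulVg chi1 mul1r.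
Qed.

(** The Gram matrix is circulant, so the characters of the cyclic group are its eigenvectors. *)
Lemma gram_fourier (i k : 'I_m) :
  \sum_l ratr (gram w i l) * omega ^+ (k * l) =
  omega ^+ (k * i) * (spectrum (fun p => #|J p|) k)%:R.
Proof.
have [chi [chi1 chiM chig]] := cyclic_char_exists.
have chiX u q : chi (u ^+ q)%g = chi u ^+ q.
  by elim: q => [|q IH]; rewrite ?expg0 // expgS chiM IH exprS.
have chiE q : omega ^+ (k * q) = chi (g ^+ q)%g ^+ k by rewrite chiX chig -exprM mulnC.
pose ck u := chi u ^+ k.
have ck1 : ck 1%g = 1 by rewrite /ck chi1 expr1n.
have ckM u v : ck (u * v)%g = ck u * ck v by rewrite /ck chiM exprMn.
have -> : (spectrum (fun p => #|J p|) k)%:R = \sum_(u : galk) ck u * ratr (trace (a * u a)) :> R[i].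
  rewrite fourier_trace // natr_prod; apply: eq_bigr => p _.
  rewrite (cycle_char_trivial (g := g)) ?gT ?finset.subsetT //; last by rewrite chig gm.
rewrite mulr_sumr.
transitivity (\sum_(u : galk) ratr (trace (w i * u a)) * ck u).
  by rewrite cyclic_sum; apply: eq_bigr => l _; rewrite mxE /trace_form chiE.
rewrite (reindex_inj (mulgI (g ^+ i)%g)) /=; apply: eq_bigr => u _.
rewrite ckM chiE -/(ck _) mulrC -mulrA; congr (_ * (_ * ratr _)).
by rewrite galMx cyclic_abelian -rmorphM trace_gal.
Qed.

(** The case of the trivial character. *)
Lemma trace_generator_sqr : trace a * trace a = 1.
Proof.
have /(_ (fun=> 1) erefl) := gauss; move=> /(_ (fun _ _ => esym (mulr1 1))).
have fE q : ratr q = f q%:A by rewrite rmorphZ_num rmorph1 mulr1.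
have -> : \sum_(u : galk) 1 * f (u a) = ratr (trace a).
  by rewrite fE traceE // rmorph_sum; apply: eq_bigr => u _; rewrite mul1r.
rewrite -rmorphM => e.
apply: (fmorph_inj (ratr : rat -> R[i])); rewrite e rmorph1 big1 // => p _.
by rewrite ifT //; apply/forall_inP.
Qed.

Lemma sum_conj_family : \sum_i w i = (trace a)%:A.
Proof. by rewrite traceE // cyclic_sum. Qed.

End CyclicField.

(** * Lattices given by a Z-basis *)

(** The first component also says that M is a subgroup. *)
Definition zbasis r (V : zmodType) (M : set V) (b : 'I_r -> V) : Prop :=
  (forall x, M x <-> exists z : 'I_r -> int, x = \sum_i b i *~ z i) /\
  (forall z : 'I_r -> int, \sum_i b i *~ z i = 0 -> forall i, z i = 0).

Section Zbasis.
Variables (r : nat) (V : zmodType) (M : set V) (b : 'I_r -> V).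
Hypothesis Mb : zbasis M b.

Lemma zbasis_mem i : M (b i).
Proof.
apply/Mb.1; exists (fun k => (k == i)%:Z); rewrite (bigD1 i) //= eqxx mulr1z big1 ?addr0 //.
by move=> k /negPf ->; rewrite mulr0z.
Qed.

Lemma zbasis_uniq (z y : 'I_r -> int) : \sum_i b i *~ z i = \sum_i b i *~ y i -> z =1 y.
Proof.
move=> e i; apply/eqP; rewrite -subr_eq0; apply/eqP; apply: (Mb.2 (fun k => z k - y k)).
by under eq_bigr do rewrite mulrzBr; rewrite sumrB e subrr.
Qed.

Lemma zbasisD x y : M x -> M y -> M (x + y).
Proof.
move=> /Mb.1[z ->] /Mb.1[t ->]; apply/Mb.1; exists (fun i => z i + t i).
by rewrite -big_split; apply: eq_bigr => i _; rewrite mulrzDr.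
Qed.

Lemma zbasis0 : M 0.
Proof. by apply/Mb.1; exists (fun=> 0); rewrite big1 // => i _; rewrite mulr0z. Qed.

Lemma zbasisN x : M x -> M (- x).
Proof.
move=> /Mb.1[z ->]; apply/Mb.1; exists (fun i => - z i).
by rewrite -sumrN; apply: eq_bigr => i _; rewrite mulrNz.
Qed.

Lemma zbasisMz x (k : int) : M x -> M (x *~ k).
Proof.
move=> /Mb.1[z ->]; apply/Mb.1; exists (fun i => z i * k).
by rewrite mulrz_suml; apply: eq_bigr => i _; rewrite mulrzA.
Qed.

Variables (W : zmodType) (phi : V -> W).
Hypothesis phiD : {in M &, {morph phi : x y / x + y}}.

Let D x y : M x -> M y -> phi (x + y) = phi x + phi y.
Proof. by move=> Mx My; apply: phiD; rewrite inE. Qed.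

Lemma zmorph0 : phi 0 = 0.
Proof. by apply: (addrI (phi 0)); rewrite -D ?addr0 //; exact: zbasis0. Qed.

Lemma zmorphN x : M x -> phi (- x) = - phi x.
Proof.
move=> Mx; apply: (addrI (phi x)); rewrite -D ?subrr ?zmorph0 //; exact: zbasisN.
Qed.

Lemma zmorphMz x (k : int) : M x -> phi (x *~ k) = phi x *~ k.
Proof.
move=> Mx; have nat_case n : phi (x *+ n) = phi x *+ n.
  elim: n => [|n IH]; first by rewrite !mulr0n zmorph0.
  by rewrite !mulrSr D ?IH //; have := zbasisMz n Mx; rewrite -pmulrn.
case: (intP k) => [|n|n]; first by rewrite !mulr0z zmorph0.
  by rewrite -!pmulrn nat_case.
rewrite !mulrNz zmorphN ?nat_case -?pmulrn ?nat_case //.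
by have := zbasisMz n.+1 Mx; rewrite -pmulrn.
Qed.

Lemma zmorph_sum (z : 'I_r -> int) : phi (\sum_i b i *~ z i) = \sum_i phi (b i) *~ z i.
Proof.
suff [] : M (\sum_i b i *~ z i) /\ phi (\sum_i b i *~ z i) = \sum_i phi (b i) *~ z i by [].
apply: (big_ind2 (fun x y => M x /\ phi x = y)) => [|x1 x2 y1 y2 [M1 <-] [M2 <-]|i _].
- by rewrite zmorph0; split=> //; exact: zbasis0.
- by rewrite D //; split=> //; exact: zbasisD.
- by have Mi := zbasis_mem i; rewrite zmorphMz //; split=> //; exact: zbasisMz.
Qed.

End Zbasis.

Definition biadditive (V : zmodType) (F : zmodType) (B : V -> V -> F) :=
  (forall x, {morph B x : y z / y - z}) /\ (forall y, {morph B^~ y : x z / x - z}).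

Section Biadditive.
Variables (V F : zmodType) (B : V -> V -> F).
Hypothesis Bb : biadditive B.

Lemma biadditive_sum r (b : 'I_r -> V) (y z : 'I_r -> int) :
  B (\sum_i b i *~ y i) (\sum_k b k *~ z k) = \sum_i \sum_k B (b i) (b k) *~ (y i * z k).
Proof.
pose Bl y0 := GRing.isZmodMorphism.Build V F (B^~ y0) (Bb.2 y0).
pose Br x0 := GRing.isZmodMorphism.Build V F (B x0) (Bb.1 x0).
pose Bla y0 : {additive V -> F} := HB.pack_for {additive V -> F} (B^~ y0) (Bl y0).
pose Bra x0 : {additive V -> F} := HB.pack_for {additive V -> F} (B x0) (Br x0).
rewrite -[LHS]/(Bla _ _) raddf_sum; apply: eq_bigr => i _.
rewrite raddfMz -[Bla _ _]/(Bra (b i) _) raddf_sum mulrz_suml; apply: eq_bigr => k _.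
by rewrite raddfMz -mulrzA mulrC.
Qed.
End Biadditive.

(** Map the combination of the b i to the same combination of the c i. *)
Lemma isometric_gram (T : zmodType) r (V W : zmodType) (M : set V) (N : set W)
    (B : V -> V -> T) (C : W -> W -> T) (b : 'I_r -> V) (c : 'I_r -> W) :
  biadditive B -> biadditive C -> zbasis M b -> zbasis N c ->
  (forall i k, B (b i) (b k) = C (c i) (c k)) -> isometric M B N C.
Proof.
move=> Bb Cb Mb Nc BC.
have /choice[z zE] x : exists z : 'I_r -> int, M x -> x = \sum_i b i *~ z i.
  have [Mx|nMx] := pselect (M x); last by exists (fun=> 0).
  by have [z xE] := (Mb.1 x).1 Mx; exists z.
pose phi x := \sum_i c i *~ z x i.
have zP x y : M x -> x = \sum_i b i *~ y i -> z x =1 y.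
  by move=> Mx xE; apply: (zbasis_uniq Mb); rewrite -xE -zE.
exists phi; split.
- split.
  + by move=> x _; apply/Nc.1; exists (z x).
  + move=> x y; rewrite !inE => Mx My /(zbasis_uniq Nc) e.
    by rewrite (zE x Mx) (zE y My); apply: eq_bigr => i _; rewrite e.
  + move=> y /Nc.1[t ->]; exists (\sum_i b i *~ t i); first by apply/Mb.1; exists t.
    apply: eq_bigr => i _; congr (_ *~ _); apply: zP => //.
    by apply/Mb.1; exists t.
- move=> x y; rewrite !inE => Mx My; rewrite /phi -big_split; apply: eq_bigr => i _ /=.
  rewrite -mulrzDr; congr (_ *~ _).
  apply: (zP _ (fun i => z x i + z y i)); first exact: zbasisD Mb _ _ Mx My.
  rewrite {1}(zE x Mx) {1}(zE y My) -big_split; apply: eq_bigr => k _ /=.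
  by rewrite mulrzDr.
- move=> x y; rewrite !inE => Mx My; rewrite {2}(zE x Mx) {2}(zE y My) !biadditive_sum //.
  by apply: eq_bigr => i _; apply: eq_bigr => k _; rewrite BC.
Qed.

(** The matrices of the isometry and of its inverse are integral, so their determinants are 1 or - 1. *)
Lemma isometric_det (F : numDomainType) r (V W : zmodType) (M : set V) (N : set W)
    (B : V -> V -> F) (C : W -> W -> F) (b : 'I_r -> V) (c : 'I_r -> W) :
  biadditive B -> biadditive C -> zbasis M b -> zbasis N c -> isometric M B N C ->
  \det (\matrix_(i, k) B (b i) (b k)) = \det (\matrix_(i, k) C (c i) (c k)).
Proof.
move=> Bb Cb Mb Nc [phi [[phiN phi_inj phi_surj] phiD phiB]].
have /choice[P PE] i : exists z : 'I_r -> int, phi (b i) = \sum_k c k *~ z k.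
  apply/Nc.1; apply: (phiN (b i)); exact: (zbasis_mem Mb).
have /choice[Q QE] i : exists z : 'I_r -> int, c i = \sum_k phi (b k) *~ z k.
  have [x Mx <-] := phi_surj _ (zbasis_mem Nc i); have [z ->] := (Mb.1 x).1 Mx.
  by exists z; rewrite (zmorph_sum Mb phiD).
pose PM : 'M[int]_r := \matrix_(i, k) P i k; pose QM : 'M[int]_r := \matrix_(i, k) Q i k.
have QP : QM *m PM = 1%:M.
  apply/matrixP => i k; rewrite !mxE.
  apply: (zbasis_uniq Nc (z := fun k => \sum_j QM i j * PM j k) (y := fun k => (i == k)%:R)).
  transitivity (c i).
    rewrite [RHS]QE; under [RHS]eq_bigr do rewrite PE mulrz_suml.
    rewrite exchange_big /=; apply: eq_bigr => l _.
    rewrite mulrz_sumr; apply: eq_bigr => q _.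
    by rewrite !mxE mulrC mulrzA.
  rewrite (bigD1 i) //= eqxx mulr1z big1 ?addr0 // => l.
  by rewrite eq_sym => /negPf ->; rewrite mulr0z.
pose PF : 'M[F]_r := map_mx intr PM.
have -> : (\matrix_(i, k) B (b i) (b k)) = PF *m (\matrix_(i, k) C (c i) (c k)) *m PF^T.
  apply/matrixP => i k; rewrite !mxE -phiB ?inE; try exact: (zbasis_mem Mb).
  rewrite !PE biadditive_sum // exchange_big /=; apply: eq_bigr => l _.
  rewrite !mxE mulr_suml; apply: eq_bigr => q _.
  rewrite !mxE -mulrzr intrM; ring.
rewrite !det_mulmx det_tr mulrAC -det_mulmx.
have : \det QM * \det PM = 1 by rewrite -det_mulmx QP det1.
have -> : \det (PF *m PF) = (\det PM ^+ 2)%:~R.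
  by rewrite det_mulmx det_map_mx -expr2 rmorphXn.
move=> /intUnitRing.unitzPl; rewrite unfold_in /= => /orP[]/eqP ->.
  by rewrite expr1n mul1r.
by rewrite sqrrN expr1n mul1r.
Qed.

(** * The trace form on totally real fields *)

(** All embeddings are real and are the conjugates of one of them. *)
Lemma b_form_trace (R : realType) (K : splittingFieldType rat) (x y : K) :
  totally_real R K -> b_form R x y = ratr (trace (x * y)).
Proof.
move=> realK; have galK := galois_char0 K.
have [f _] := closed_embed_exists K (R[i] : numClosedFieldType).
pose F (s : gal_of {:K}) : K -> R[i] := f \o s.
have Finj : injective F.
  move=> s t /(congr1 (fun h => h _)) e; apply/eqP/gal_eqP => z _.
  by apply: (fmorph_inj f); exact: e.
have embE : @embeddings R K = [set` [seq F s | s <- index_enum (gal_of {:K})]]%classic.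
  apply/seteqP; split=> [h [h' ->]|h] /=.
    have [s sE] := morph_conj galK f h'; apply/mapP; exists s; first exact: mem_index_enum.
    by apply/funext => z; rewrite sE.
  by case/mapP => s _ ->; exists (f \o s : {rmorphism K -> R[i]}).
rewrite /b_form embE -fsbig_seq; last by rewrite map_inj_uniq // index_enum_uniq.
rewrite big_map.
have fr (h : {rmorphism K -> R[i]}) z : h z = (complex.Re (h z))%:C%C.
  have := realK h (ex_intro _ h erefl) z.
  by case: (h z) => a b /= ->.
transitivity (\sum_(s : gal_of {:K}) complex.Re (f (s (x * y)))).
  apply: eq_bigr => s _; rewrite /F /= rmorphM rmorphM /=.
  rewrite (fr f (s x)) (fr f (s y)) /=; by rewrite oppr0 mulr0.
rewrite -raddf_sum -rmorph_sum -traceE // rmorphZ_num rmorph1 mulr1.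
by rewrite -[ratr _ in LHS](fmorph_eq_rat (real_complex R \o ratr)).
Qed.

(** * Discriminants and Gram determinants *)

Section IntBasis.
Variables (m : nat) (K : splittingFieldType rat) (w : 'I_m -> K).
Hypothesis wB : int_basis w.
Let galK := galois_char0 K.

(** The family spans K over Q since every element has an integral multiple, and its length is the dimension. *)
Lemma int_basis_free (c : 'I_m -> rat) : \sum_i c i *: w i = 0 -> forall i, c i = 0.
Proof.
have [mE wo wx] := wB.
pose W := [tuple w i | i < m].
have Wn (i : 'I_m) : W`_i = w i by rewrite -tnth_nth tnth_mktuple.
have bW : basis_of {:K} W.
  rewrite basisEdim; apply/andP; split; last by rewrite size_tuple -mE.
  apply/subvP => x _.
  have [N N0 /wx[z xE]] := oint_clear x.
  have -> : x = N%:R^-1 *: \sum_i (z i)%:~R * w i.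
    rewrite -xE; have -> : N%:R * x = N%:R *: x by rewrite -alg_nat mulr_algl.
    rewrite scalerA mulVf ?scale1r //.
    by rewrite pnatr_eq0 -lt0n.
  rewrite rpredZ // rpred_sum // => i _.
  by rewrite -alg_int mulr_algl rpredZ // memv_span // -Wn mem_nth // size_tuple.
move=> c0 i; have /freeP := basis_free bW; apply.
by rewrite -[RHS]c0; apply: eq_bigr => k _; rewrite Wn.
Qed.

Lemma intz_scale (x : K) (z : int) : x *~ z = z%:~R *: x.
Proof. by rewrite -mulr_algl alg_int mulrzl. Qed.

Lemma int_basis_zbasis : zbasis (@maximal_order K) w.
Proof.
have [mE wo wx] := wB; split=> [x|z z0 i].
  split=> [/ointP/wx[z xE]|[z ->]].
    by exists z; rewrite xE; apply: eq_bigr => i _; rewrite mulrzl.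
  by apply/ointP; rewrite rpred_sum // => i _; rewrite -mulrzl rpredM ?intr_oint ?wo.
apply: (@intr_inj rat); apply: (@int_basis_free (fun i => (z i)%:~R)).
by rewrite -[RHS]z0; apply: eq_bigr => k _; rewrite intz_scale.
Qed.
End IntBasis.

Lemma integral_basis_int (K : splittingFieldType rat) (w : 'I_(\dim {:K}) -> K) :
  integral_basis w <-> int_basis w.
Proof.
split=> [[wo wx]|wB].
  split=> // [i|x /ointP/wx[c [cE _]]]; first exact/ointP.
  by exists c; rewrite cE; apply: eq_bigr => i _; rewrite mulrzl.
have [_ wo wx] := wB; split=> [i|x /ointP/wx[z xE]]; first exact/ointP.
have xE' : x = \sum_i w i *~ z i by rewrite xE; apply: eq_bigr => i _; rewrite mulrzl.
exists [ffun i => z i]; split.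
  by rewrite {1}xE'; apply: eq_bigr => i _; rewrite ffunE.
move=> c cE; apply/ffunP => i; rewrite ffunE.
by apply: (zbasis_uniq (int_basis_zbasis wB)); rewrite -cE -xE'.
Qed.

Lemma trace_form_biadditive (K : splittingFieldType rat) : biadditive (@trace_form K).
Proof.
have galK := galois_char0 K.
by split=> x y z; rewrite /trace_form ?mulrBr ?mulrBl traceB.
Qed.

Lemma b_form_biadditive (R : realType) (K : splittingFieldType rat) :
  totally_real R K -> biadditive (@b_form R K).
Proof.
move=> rK; have galK := galois_char0 K.
by split=> x y z; rewrite !b_form_trace // ?mulrBr ?mulrBl traceB // rmorphB.
Qed.

Lemma isometric_id (T : zmodType) (V : zmodType) (M : set V) (B : V -> V -> T) : isometric M B M B.
Proof.
exists idfun; split=> //; by split=> // x Mx; exists x.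
Qed.

Lemma discriminant_gram m (K : splittingFieldType rat) (w : 'I_m -> K) :
  int_basis w -> discriminant K = \det (gram w).
Proof.
move=> wB; have [mE _ _] := wB; subst m.
rewrite /discriminant; case: xgetP => [_ _ [w' /integral_basis_int w'B ->]|/(_ (\det (gram w)))].
  apply: (isometric_det (trace_form_biadditive K) (trace_form_biadditive K)
    (int_basis_zbasis w'B) (int_basis_zbasis wB)); exact: isometric_id.
by case; exists w => //; exact/integral_basis_int.
Qed.

(** * The spectrum of the Gram matrix *)

Section Spectrum.
Variables (C : numClosedFieldType) (m : nat) (omega : C).
Hypothesis omegaP : m.-primitive_root omega.

Let F : 'M[C]_m := Vandermonde m (\row_k omega ^+ k).

Lemma fourier_det : \det F != 0.
Proof.
rewrite det_Vandermonde; apply/prodf_neq0 => i _; apply/prodf_neq0 => k ik.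
rewrite !mxE subr_eq0 (eq_prim_root_expr omegaP) !modn_small //.
by rewrite gtn_eqF.
Qed.

Lemma gram_diag (G : 'M[rat]_m) (d : nat -> nat) :
  (forall i k : 'I_m, \sum_l ratr (G i l) * omega ^+ (k * l) = omega ^+ (k * i) * (d k)%:R) ->
  map_mx ratr G *m F = F *m diag_mx (\row_k (d k)%:R).
Proof.
move=> GE; apply/matrixP => i k; rewrite mul_mx_diag !mxE -exprM -GE.
by apply: eq_bigr => l _; rewrite !mxE -exprM.
Qed.

Lemma gram_spectrum_det (G : 'M[rat]_m) (d : nat -> nat) :
  (forall i k : 'I_m, \sum_l ratr (G i l) * omega ^+ (k * l) = omega ^+ (k * i) * (d k)%:R) ->
  \det G = (\prod_(k < m) d k)%:R.
Proof.
move=> /gram_diag/(congr1 determinant); rewrite !det_mulmx mulrC => /(mulfI fourier_det).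
rewrite det_map_mx det_diag => e; apply: (fmorph_inj (ratr : rat -> C)).
by rewrite e rmorph_nat natr_prod; apply: eq_bigr => k _; rewrite mxE.
Qed.

(** The Fourier matrix is invertible, so the eigenvalues determine the matrix. *)
Lemma gram_spectrum_inj (G G' : 'M[rat]_m) (d d' : nat -> nat) : (forall k : 'I_m, d k = d' k) ->
  (forall i k : 'I_m, \sum_l ratr (G i l) * omega ^+ (k * l) = omega ^+ (k * i) * (d k)%:R) ->
  (forall i k : 'I_m, \sum_l ratr (G' i l) * omega ^+ (k * l) = omega ^+ (k * i) * (d' k)%:R) ->
  G = G'.
Proof.
move=> dd /gram_diag e /gram_diag e'.
have dE : \row_k (d' k)%:R = \row_(k < m) (d k)%:R :> 'rV[C]_m.
  by apply/rowP => k; rewrite !mxE dd.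
rewrite dE -e in e'; apply: (map_mx_inj (f := (ratr : rat -> C))).
have uF : F \in unitmx by rewrite unitmxE unitfE fourier_det.
by rewrite -[LHS](mulmxK uF) -e' mulmxK.
Qed.
End Spectrum.

Lemma logn_prod_primes (S : seq nat) (N : nat -> nat) p : uniq S -> (forall q, q \in S -> prime q) ->
  p \in S -> logn p (\prod_(q <- S) q ^ N q) = N p.
Proof.
move=> uS pS p_in; have pp := pS p p_in.
have rest0 : (0 < \prod_(q <- S | q != p) q ^ N q)%N.
  by rewrite big_seq_cond prodn_cond_gt0 // => q /andP[/pS qp _]; rewrite expn_gt0 prime_gt0.
rewrite (bigD1_seq p) //= lognM //; last by rewrite expn_gt0 prime_gt0.
rewrite lognX logn_prime // eqxx muln1 [X in (_ + X)%N](_ : _ = 0%N) ?addn0 //.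
rewrite big_seq_cond; elim/big_ind: _ => [|a b a0 b0|q /andP[/pS qp qNp]].
- by rewrite logn1.
- have [->|a_gt] := posnP a; first by rewrite mul0n logn0.
  have [->|b_gt] := posnP b; first by rewrite muln0 logn0.
  by rewrite lognM // a0 b0.
- by rewrite lognX logn_prime // eq_sym (negPf qNp) muln0.
Qed.

Lemma count_multiples m e : (0 < m)%N -> (0 < e)%N -> (e %| m)%N ->
  (\sum_(k < m) (e %| k) = m %/ e)%N.
Proof.
move=> m0 e0 em; rewrite divn_count_dvd -(big_mkord xpredT (fun k => (e %| k) : nat)).
rewrite big_ltn // dvdn0 [RHS](big_nat_recr _ _ _ m0) /= em addnC; congr (_ + _)%N.
Qed.

(** The exponent of p is the number of characters of the cyclic group ramified at p. *)
Lemma spectrum_prod S e m : (\prod_(k < m) spectrum S e k =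
  \prod_(p <- S) p ^ (m - \sum_(k < m) (e p %| k)))%N.
Proof.
rewrite /spectrum exchange_big /=; apply: eq_bigr => p _.
rewrite -[X in (X - _)%N](card_ord m) -sum1_card -sumnB; last by move=> k _; case: dvdn.
elim/big_rec2: _ => [|k x y _ ->]; first by rewrite expn0.
by case: dvdn; rewrite /= ?mul1n // expnS.
Qed.

(** The discriminant is the product of the p ^ (m - m / e p), so it determines every e p. *)
Lemma spectrum_inj S e e' m : (0 < m)%N -> uniq S -> (forall q, q \in S -> prime q) ->
  (forall p, 0 < e p /\ e p %| m)%N -> (forall p, 0 < e' p /\ e' p %| m)%N ->
  (\prod_(k < m) spectrum S e k = \prod_(k < m) spectrum S e' k)%N ->
  forall k, spectrum S e k = spectrum S e' k.
Proof.
move=> m0 uS pS eP e'P; rewrite !spectrum_prod => E k.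
apply: eq_big_seq => p p_in; suff -> : e p = e' p by [].
have [e0 em] := eP p; have [e'0 e'm] := e'P p.
have := congr1 (logn p) E.
rewrite !(logn_prod_primes (fun p => (m - \sum_(k < m) (_ p %| k))%N)) // !count_multiples // => Ee.
have q : (m %/ e p = m %/ e' p)%N.
  by rewrite -[LHS](subKn (leq_div m (e p))) Ee subKn // leq_div.
have d0 : (0 < m %/ e p)%N by rewrite divn_gt0 // dvdn_leq.
by apply/eqP; rewrite -(eqn_pmul2l d0) {2}q !divnK.
Qed.

(** * Existence of the cyclic normal basis *)

(** The normal integral basis, with a generator of trace 1 after a change of sign. *)
Lemma cyclic_normal_basis (R : realType) m (K : splittingFieldType rat) (S : seq nat) (omega : R[i]) :
  (0 < m)%N -> cyclic_number_field m K -> tame K -> totally_real R K -> uniq S ->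
  (forall p, p \in S -> prime p) -> (forall p, prime p -> p \notin S -> inertia K p = [set 1%g]) ->
  m.-primitive_root omega ->
  exists (w : 'I_m -> K) (e : nat -> nat),
  [/\ int_basis w, \sum_i w i = 1, forall i, trace (w i) = 1, (forall p, 0 < e p /\ e p %| m)%N &
      forall i k : 'I_m, \sum_l ratr (gram w i l) * omega ^+ (k * l) = omega ^+ (k * i) * (spectrum S e k)%:R].
Proof.
move=> m0 cK tK rK uS pS unr wm; have [galK int_basis_dim [g gT gm]] := cyclic_field_gen m0 cK.
have abel := cyclic_abelian gT.
have [a [d [f [J [ao ad xd gs]]]]] := abelian_generator galK abel tK rK uS pS unr.
have n0 : (0 < \prod_(p <- S) p)%N.
  by rewrite big_seq_cond prodn_cond_gt0 // => p /andP[/pS/prime_gt0].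
pose w := @conj_family m K g a; have wB : int_basis w := conj_family_basis galK gT gm n0 ao ad xd.
have wF := gram_fourier galK gT gm wm gs.
have w1 : \sum_i w i = (trace a)%:A := sum_conj_family galK gT gm a.
have wt i : trace (w i) = trace a by rewrite trace_gal.
have JP p : (0 < #|J p| /\ #|J p| %| m)%N.
  by rewrite cardG_gt0 -gm orderE gT cardSg ?finset.subsetT.
have /eqP := trace_generator_sqr galK gs.
rewrite -expr2 sqrf_eq1 => /orP[]/eqP ta.
  by exists w, (fun p => #|J p|); split=> // [|i]; rewrite ?w1 ?wt ta // scale1r.
have [mE wo wx] := wB.
exists (fun i => - w i), (fun p => #|J p|); split=> //.
- split=> // [i|x /wx[z ->]]; first by rewrite rpredN.
  exists (fun i => - z i); apply: eq_bigr => i _.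
  by rewrite intrN mulrNN.
- by rewrite sumrN w1 ta scaleN1r opprK.
- by move=> i; rewrite -[- w i]sub0r traceB // trace0 // wt ta sub0r opprK.
- move=> i k; rewrite -wF; apply: eq_bigr => l _; congr (ratr _ * _).
  by rewrite !mxE /trace_form mulrNN.
Qed.

(** * The sublattices of trace zero and of projections *)

(** The first row consists of the coordinates of 1, which is the sum of the normal basis. *)
Definition extend1_mx n (A : 'M[rat]_(n, 1 + n)) : 'M[rat]_(1 + n) := col_mx (const_mx 1) A.

Section Sublattices.
Variables (n : nat) (K : splittingFieldType rat) (w : 'I_(1 + n) -> K).
Hypothesis wB : int_basis w.
Hypothesis w1 : \sum_i w i = 1.
Hypothesis tw : forall i, trace (w i) = 1.
Let galK := galois_char0 K.

(** The projections of all the w i sum to 0, so those of nonzero index form a basis. *)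
Definition perp_family (i : 'I_n) : K := (1 + n)%:R * w (rshift 1 i) - 1.
Definition zero_family (i : 'I_n) : K := w (rshift 1 i) - w (lshift n 0).

Definition perp_mx : 'M[rat]_(n, 1 + n) := \matrix_(i, l) ((1 + n)%:R * (l == rshift 1 i)%:R - 1).
Definition zero_mx : 'M[rat]_(n, 1 + n) := \matrix_(i, l) ((l == rshift 1 i)%:R - (l == lshift n 0)%:R).

Lemma int_basis_dim : \dim {:K} = (1 + n)%N.
Proof. by case: wB. Qed.

Lemma split_sum (V : nmodType) (f : 'I_(1 + n) -> V) :
  \sum_i f i = f (lshift n 0) + \sum_(i < n) f (rshift 1 i).
Proof. by rewrite big_split_ord big_ord1. Qed.

Lemma sum_delta (i : 'I_(1 + n)) : \sum_l (l == i)%:R *: w l = w i.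
Proof.
rewrite (bigD1 i) //= eqxx scale1r big1 ?addr0 // => l /negPf ->.
by rewrite scale0r.
Qed.

Lemma perp_mxE i : perp_family i = \sum_l perp_mx i l *: w l.
Proof.
under eq_bigr do rewrite mxE scalerBl scale1r -scalerA.
by rewrite sumrB -scaler_sumr sum_delta w1 /perp_family -mulr_algl alg_nat.
Qed.

Lemma zero_mxE i : zero_family i = \sum_l zero_mx i l *: w l.
Proof.
by under eq_bigr do rewrite mxE scalerBl; rewrite sumrB !sum_delta.
Qed.

Lemma trace_perp i : trace (perp_family i) = 0.
Proof.
rewrite /perp_family traceB // trace1 // int_basis_dim.
have -> : (1 + n)%:R * w (rshift 1 i) = (1 + n)%:R *: w (rshift 1 i) by rewrite -alg_nat mulr_algl.
by rewrite traceZ // tw mulr1 subrr.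
Qed.

Lemma trace_zero_family i : trace (zero_family i) = 0.
Proof. by rewrite /zero_family traceB // !tw subrr. Qed.

Lemma perp_free (v : 'I_n -> rat) : \sum_i v i *: perp_family i = 0 -> forall i, v i = 0.
Proof.
move=> v0; pose s := \sum_i v i.
(* The coordinates on w of the given combination; the one at index 0 is - s. *)
pose c (l : 'I_(1 + n)) : rat := (1 + n)%:R * (if fintype.split l is inr i then v i else 0) - s.
have cw : \sum_l c l *: w l = 0.
  rewrite /c; under eq_bigr do rewrite scalerBl; rewrite sumrB -scaler_sumr w1 split_sum.
  rewrite (unsplitK (inl _)) mulr0 scale0r add0r -[RHS]v0 /s scaler_suml -sumrB.
  apply: eq_bigr => i _; rewrite (unsplitK (inr _)) /perp_family scalerBr mulrC -scalerA.
  by congr (_ *: _ - _); rewrite -[LHS]mulr_algl alg_nat.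
have c0 := int_basis_free wB cw; have s0 : s = 0.
  by have := c0 (lshift n 0); rewrite /c (unsplitK (inl _)) mulr0 sub0r => /eqP; rewrite oppr_eq0 => /eqP.
move=> i; have := c0 (rshift 1 i); rewrite /c (unsplitK (inr _)) s0 subr0 => /eqP.
by rewrite mulf_eq0 pnatr_eq0 /= => /eqP.
Qed.

Lemma zero_free (v : 'I_n -> rat) : \sum_i v i *: zero_family i = 0 -> forall i, v i = 0.
Proof.
move=> v0; pose s := \sum_i v i.
pose c (l : 'I_(1 + n)) : rat := if fintype.split l is inr i then v i else - s.
have cw : \sum_l c l *: w l = 0.
  rewrite split_sum /c (unsplitK (inl _)) -[RHS]v0 scaleNr /s scaler_suml addrC -sumrB.
  by apply: eq_bigr => i _; rewrite (unsplitK (inr _)) /zero_family scalerBr.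
by move=> i; have := int_basis_free wB cw (rshift 1 i); rewrite /c (unsplitK (inr _)).
Qed.

Lemma free_int (b : 'I_n -> K) (z : 'I_n -> int) :
  (forall v : 'I_n -> rat, \sum_i v i *: b i = 0 -> forall i, v i = 0) ->
  \sum_i b i *~ z i = 0 -> forall i, z i = 0.
Proof.
move=> bF z0 i; apply: (@intr_inj rat); apply: (bF (fun i => (z i)%:~R)).
by rewrite -[RHS]z0; apply: eq_bigr => k _; rewrite intz_scale.
Qed.

Lemma trace_comb (z : 'I_(1 + n) -> int) : trace (\sum_l w l *~ z l) = (\sum_l z l)%:~R.
Proof.
rewrite trace_sum // rmorph_sum; apply: eq_bigr => l _.
by rewrite intz_scale traceZ // tw mulr1.
Qed.

Lemma zero_zbasis : zbasis (@trace_zero K) zero_family.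
Proof.
split=> [x|z]; last by apply: free_int; exact: zero_free.
split=> [[/(int_basis_zbasis wB).1[z ->]]|[z ->]].
  rewrite trace_comb => /eqP; rewrite intr_eq0 => /eqP z0.
  exists (fun i => z (rshift 1 i)); rewrite split_sum.
  have -> : z (lshift n 0) = - \sum_i z (rshift 1 i).
    by apply/eqP; rewrite -addr_eq0 -split_sum z0.
  rewrite mulrNz mulrz_sumr addrC -sumrB; apply: eq_bigr => i _.
  by rewrite /zero_family mulrzBl.
have wo l : w l \in oint K by case: wB => _ /(_ l).
split; last first.
  by rewrite trace_sum // big1 // => i _; rewrite intz_scale traceZ // trace_zero_family mulr0.
apply/ointP; rewrite rpred_sum // => i _.
by rewrite -mulrzl rpredM ?intr_oint // rpredB ?wo.
Qed.

Lemma perp_zbasis : zbasis (@maximal_order_perp K) perp_family.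
Proof.
split=> [x|z]; last by apply: free_int; exact: perp_free.
pose c l := (1 + n)%:R * w l - 1.
have cE (z : 'I_(1 + n) -> int) : (1 + n)%:R * (\sum_l w l *~ z l) - (trace (\sum_l w l *~ z l))%:A = \sum_l c l *~ z l.
  rewrite trace_comb alg_int rmorph_sum mulr_sumr -sumrB; apply: eq_bigr => l _.
  by rewrite /c mulrzBl mulrzAr.
have c0 : \sum_l c l = 0.
  by rewrite sumrB -mulr_sumr w1 mulr1 sumr_const card_ord subrr.
rewrite /maximal_order_perp int_basis_dim; split=> [[a /(int_basis_zbasis wB).1[z ->] <-]|[z ->]].
  rewrite cE; exists (fun i => z (rshift 1 i) - z (lshift n 0)).
  transitivity (\sum_l c l *~ (z l - z (lshift n 0))).
    under [RHS]eq_bigr do rewrite mulrzBr.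
    by rewrite sumrB -mulrz_suml c0 mul0rz subr0.
  by rewrite split_sum subrr mulr0z add0r.
exists (\sum_i w (rshift 1 i) *~ z i).
  apply/ointP; rewrite rpred_sum // => i _; rewrite -mulrzl rpredM ?intr_oint //.
  by case: wB => _ /(_ (rshift 1 i)).
have := cE (fun l => if fintype.split l is inr i then z i else 0).
rewrite !split_sum (unsplitK (inl _)) !mulr0z !add0r.
have e (b : 'I_(1 + n) -> K) : \sum_(i < n) b (rshift 1 i) *~ (if fintype.split (rshift 1 i) is inr i0 then z i0 else 0) =
    \sum_(i < n) b (rshift 1 i) *~ z i.
  by apply: eq_bigr => i _; rewrite (unsplitK (inr _)).
by rewrite !e.
Qed.

(** Put 1 before the family b: it is orthogonal to b and has square 1 + n. The Gram determinant of the
   extended family is that of w up to the square of a determinant that does not depend on the field. *)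
Lemma gram_extend (b : 'I_n -> K) (A : 'M[rat]_(n, 1 + n)) :
  (forall i, b i = \sum_l A i l *: w l) -> (forall i, trace (b i) = 0) ->
  \det (extend1_mx A) ^+ 2 * \det (gram w) = (1 + n)%:R * \det (gram b).
Proof.
move=> bE tb; pose b' (i : 'I_(1 + n)) := if fintype.split i is inr k then b k else 1.
have b'E i : b' i = \sum_l extend1_mx A i l *: w l.
  rewrite /b' /extend1_mx; case: (split_ordP i) => k ->.
    by rewrite -[LHS]w1; apply: eq_bigr => l _; rewrite col_mxEu mxE scale1r.
  by rewrite bE; apply: eq_bigr => l _; rewrite col_mxEd.
have := gram_change galK b'E => /(congr1 determinant).
rewrite !det_mulmx det_tr mulrAC -expr2 => <-.
have -> : gram b' = block_mx (const_mx (1 + n)%:R) 0 0 (gram b) :> 'M_(1 + n).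
  apply/matrixP => i k; rewrite mxE /b' /trace_form.
  case: (split_ordP i) => i' ->; case: (split_ordP k) => k' ->.
  - by rewrite block_mxEul mxE mulr1 trace1 // int_basis_dim.
  - by rewrite block_mxEur mxE mul1r tb.
  - by rewrite block_mxEdl mxE mulr1 tb.
  - by rewrite block_mxEdr mxE.
by rewrite (@det_ublock _ 1 n) det_mx11 mxE.
Qed.

Lemma extend1_det_neq0 (b : 'I_n -> K) (A : 'M[rat]_(n, 1 + n)) :
  (forall i, b i = \sum_l A i l *: w l) -> (forall i, trace (b i) = 0) ->
  (forall v : 'I_n -> rat, \sum_i v i *: b i = 0 -> forall i, v i = 0) ->
  \det (extend1_mx A) != 0.
Proof.
move=> bE tb bF; apply/negP => /det0P[v v0 vP].
have vb : v 0 (lshift n 0) *: 1 + \sum_i v 0 (rshift 1 i) *: b i = 0.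
  rewrite -w1 scaler_sumr; under [X in _ + X]eq_bigr do rewrite bE scaler_sumr.
  rewrite exchange_big -big_split big1 // => l _ /=.
  under eq_bigr do rewrite scalerA.
  rewrite -scaler_suml -scalerDl; have /rowP/(_ l) := vP; rewrite !mxE split_sum col_mxEu mxE mulr1.
  under eq_bigr do rewrite col_mxEd.
  by move=> ->; rewrite scale0r.
have vl : v 0 (lshift n 0) = 0.
  have := congr1 (@trace K) vb; rewrite trace0 // traceD // traceZ // trace1 // int_basis_dim trace_sum //.
  rewrite big1 ?addr0; last by move=> i _; rewrite traceZ // tb mulr0.
  by move/eqP; rewrite mulf_eq0 pnatr_eq0 /= orbF => /eqP.
move: vb; rewrite vl scale0r add0r => /bF vr; case/eqP: v0; apply/rowP => l.
by rewrite mxE; case: (split_ordP l) => k ->; rewrite ?vr // ord1.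
Qed.

Lemma gram_perp (i k : 'I_n) : trace_form (perp_family i) (perp_family k) =
  (1 + n)%:R ^+ 2 * gram w (rshift 1 i) (rshift 1 k) - (1 + n)%:R.
Proof.
rewrite !mxE /trace_form /perp_family.
set N : K := _%:R; set x := w _; set y := w _.
have -> : (N * x - 1) * (N * y - 1) = N * N * (x * y) - N * x - N * y + 1 by ring.
have NZ u : N * u = (1 + n)%:R *: u by rewrite -[RHS]mulr_algl alg_nat.
rewrite traceD // !traceB // -mulrA !NZ !traceZ // !tw trace1 // int_basis_dim; ring.
Qed.

Lemma gram_zero (i k : 'I_n) : trace_form (zero_family i) (zero_family k) =
  gram w (rshift 1 i) (rshift 1 k) - gram w (rshift 1 i) (lshift n 0) -
  gram w (lshift n 0) (rshift 1 k) + gram w (lshift n 0) (lshift n 0).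
Proof.
rewrite !mxE /trace_form /zero_family mulrBl !mulrBr !traceB //; ring.
Qed.

End Sublattices.

(** * Comparing two fields *)

Section Pair.
Variables (R : realType) (n : nat) (K L : splittingFieldType rat).
Variables (wK : 'I_(1 + n) -> K) (wL : 'I_(1 + n) -> L).
Hypothesis bK : int_basis wK.
Hypothesis bL : int_basis wL.
Hypothesis sK : \sum_i wK i = 1.
Hypothesis sL : \sum_i wL i = 1.
Hypothesis tK : forall i, trace (wK i) = 1.
Hypothesis tL : forall i, trace (wL i) = 1.
Hypothesis rK : totally_real R K.
Hypothesis rL : totally_real R L.

Lemma isometric_order_disc :
  isometric (@maximal_order K) (@trace_form K) (@maximal_order L) (@trace_form L) ->
  discriminant K = discriminant L.
Proof.
rewrite (discriminant_gram bK) (discriminant_gram bL).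
exact: (isometric_det (trace_form_biadditive K) (trace_form_biadditive L)
  (int_basis_zbasis bK) (int_basis_zbasis bL)).
Qed.

Lemma gram_extend_inj (A : 'M[rat]_(n, 1 + n)) (b : 'I_n -> K) (c : 'I_n -> L) :
  (forall i, b i = \sum_l A i l *: wK l) -> (forall i, trace (b i) = 0) ->
  (forall v : 'I_n -> rat, \sum_i v i *: b i = 0 -> forall i, v i = 0) ->
  (forall i, c i = \sum_l A i l *: wL l) -> (forall i, trace (c i) = 0) ->
  \det (gram b) = \det (gram c) -> discriminant K = discriminant L.
Proof.
move=> bE tb bF cE tc; rewrite (discriminant_gram bK) (discriminant_gram bL) => e.
have d0 := extend1_det_neq0 bK sK bE tb bF.
apply: (mulfI (expf_neq0 2 d0)).
by rewrite (gram_extend bK sK bE tb) (gram_extend bL sL cE tc) e.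
Qed.

Lemma isometric_zero_disc :
  isometric (@trace_zero K) (@trace_form K) (@trace_zero L) (@trace_form L) ->
  discriminant K = discriminant L.
Proof.
move=> iso; apply: (gram_extend_inj (zero_mxE wK) (trace_zero_family tK) (zero_free bK)
  (zero_mxE wL) (trace_zero_family tL)).
exact: (isometric_det (trace_form_biadditive K) (trace_form_biadditive L)
  (zero_zbasis bK tK) (zero_zbasis bL tL) iso).
Qed.

Lemma isometric_perp_disc :
  isometric (@maximal_order_perp K) (@b_form R K) (@maximal_order_perp L) (@b_form R L) ->
  discriminant K = discriminant L.
Proof.
move=> iso; apply: (gram_extend_inj (perp_mxE sK) (trace_perp bK tK) (perp_free bK sK)
  (perp_mxE sL) (trace_perp bL tL)).
have := isometric_det (b_form_biadditive rK) (b_form_biadditive rL)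
  (perp_zbasis bK sK tK) (perp_zbasis bL sL tL) iso.
have bg (F : splittingFieldType rat) (c : 'I_n -> F) : totally_real R F ->
    \matrix_(i, k) b_form R (c i) (c k) = map_mx ratr (gram c).
  by move=> rF; apply/matrixP => i k; rewrite !mxE b_form_trace.
by rewrite !bg // !det_map_mx => /fmorph_inj.
Qed.

Hypothesis gramE : gram wK = gram wL.

Lemma gram_isometric_order :
  isometric (@maximal_order K) (@trace_form K) (@maximal_order L) (@trace_form L).
Proof.
apply: (isometric_gram (trace_form_biadditive K) (trace_form_biadditive L)
  (int_basis_zbasis bK) (int_basis_zbasis bL)) => i k.
by have /matrixP/(_ i k) := gramE; rewrite !mxE.
Qed.

Lemma gram_isometric_zero :
  isometric (@trace_zero K) (@trace_form K) (@trace_zero L) (@trace_form L).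
Proof.
apply: (isometric_gram (trace_form_biadditive K) (trace_form_biadditive L)
  (zero_zbasis bK tK) (zero_zbasis bL tL)) => i k.
by rewrite !gram_zero gramE.
Qed.

Lemma gram_isometric_perp :
  isometric (@maximal_order_perp K) (@b_form R K) (@maximal_order_perp L) (@b_form R L).
Proof.
apply: (isometric_gram (b_form_biadditive rK) (b_form_biadditive rL)
  (perp_zbasis bK sK tK) (perp_zbasis bL sL tL)) => i k.
rewrite !b_form_trace //; congr ratr.
by rewrite -2!/(trace_form _ _) (gram_perp bK tK) (gram_perp bL tL) gramE.
Qed.

End Pair.

Theorem theorem2p19 (R : realType) (m : nat) (K L : splittingFieldType rat) :
  (0 < m)%N ->
  cyclic_number_field m K -> cyclic_number_field m L ->
  totally_real R K -> totally_real R L ->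
  tame K -> tame L ->
  [<-> isometric (@maximal_order K) (@trace_form K)
                 (@maximal_order L) (@trace_form L);
       isometric (@maximal_order_perp K) (@b_form R K)
                 (@maximal_order_perp L) (@b_form R L);
       isometric (@trace_zero K) (@trace_form K)
                 (@trace_zero L) (@trace_form L);
       discriminant K = discriminant L].
Proof.
case: m => [//|n] m0 cK cL rK rL tK tL.
have galK := galois_char0 K; have galL := galois_char0 L.
have [BK BKP] := ramified_bound galK; have [BL BLP] := ramified_bound galL.
pose S := [seq p <- iota 0 (maxn BK BL) | prime p].
have uS : uniq S by rewrite filter_uniq // iota_uniq.
have pS p : p \in S -> prime p by rewrite mem_filter => /andP[].
have unr p : prime p -> p \notin S -> (BK <= p)%N /\ (BL <= p)%N.
  move=> pp; rewrite mem_filter pp mem_iota /= add0n -leqNgt geq_max => /andP[-> ->] //.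
have unrK p : prime p -> p \notin S -> inertia K p = [set 1%g].
  by move=> pp /(unr p pp)[? _]; exact: BKP.
have unrL p : prime p -> p \notin S -> inertia L p = [set 1%g].
  by move=> pp /(unr p pp)[_ ?]; exact: BLP.
have [omega om] := prim_root_exists (R[i] : numClosedFieldType) galK m0.
have [wK [eK [bK sK trK eKP FK]]] := cyclic_normal_basis m0 cK tK rK uS pS unrK om.
have [wL [eL [bL sL trL eLP FL]]] := cyclic_normal_basis m0 cL tL rL uS pS unrL om.
have discG : discriminant K = discriminant L -> gram wK = gram wL.
  rewrite (discriminant_gram bK) (discriminant_gram bL).
  rewrite (gram_spectrum_det om FK) (gram_spectrum_det om FL) => /eqP; rewrite eqr_nat => /eqP e.
  apply: (gram_spectrum_inj om _ FK FL) => k.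
  exact: (spectrum_inj m0 uS pS eKP eLP e).
have discA d := gram_isometric_order bK bL (discG d).
have discB d := gram_isometric_perp bK bL sK sL trK trL rK rL (discG d).
have discC d := gram_isometric_zero bK bL trK trL (discG d).
tfae.
- by move=> /(isometric_order_disc bK bL); exact: discB.
- by move=> /(isometric_perp_disc bK bL sK sL trK trL rK rL); exact: discC.
- exact: (isometric_zero_disc bK bL sK sL trK trL).
- exact: discA.
Qed.
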